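(* Let $b$ be a nonconstant function in $H^\infty_1$. Then the de Branges-Rovnyak space $\mathcal{H}(b)$ has the complete Nevanlinna-Pick property if and only if there exists a holomorphic function $h: b(\mathbb{D})\to\mathbb{C}$ such that both of the following hold: (1) $h(b(z))=z$ for all $z\in\mathbb{D}$; (2) the function $z\mapsto \dfrac{z-b(0)}{h(z)}$ (defined on $b(\mathbb{D})\setminus\{b(0)\}$) extends to a holomorphic function $q$ on $\mathbb{D}$ with $|q(z)|\leq |1-\overline{b(0)}\,z|$ for all $z\in\mathbb{D}$.
   Context: $\mathbb{D}$ is the open unit disk in $\mathbb{C}$ and $\mathbb{T}$ is the unit circle. $H^2$ is the Hardy space on $\mathbb{D}$, viewed also as the closed subspace of $L^2(\mathbb{T})$ of functions whose negative Fourier coefficients vanish. $H^\infty_1$ is the closed unit ball of $H^\infty$ (bounded holomorphic functions on $\mathbb{D}$ with the sup norm). For $f\in L^\infty(\mathbb{T})$, the Toeplitz operator on $H^2$ is $T_f(u)=P(fu)$, where $P$ is the orthogonal projection of $L^2(\mathbb{T})$ onto $H^2$. For a bounded operator $A$ on a Hilbert space $H$, the range space $AH$ carries the inner product $\langle Af,Ag\rangle_{AH}=\langle f,g\rangle_H$ for $f,g\in H\ominus\ker A$. For $b\in H^\infty_1$, the de Branges-Rovnyak space is the range space $\mathcal{H}(b)=(I-T_bT_{\bar b})^{1/2}H^2$. It is a reproducing kernel Hilbert space of functions on $\mathbb{D}$ with reproducing kernel $k^b(z,w)=\dfrac{1-\overline{b(w)}b(z)}{1-\bar w z}$. A function $K:X\times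 X\to\mathbb{C}$ is a positive kernel on $X$, written $K\succeq 0$, if $K(x,y)=\overline{K(y,x)}$ for all $x,y\in X$ and for every finite set $\{\lambda_1,\dots,\lambda_n\}\subset X$ the matrix $(K(\lambda_i,\lambda_j))_{i,j=1}^n$ is positive semi-definite. A positive kernel $K$ on $X$ that never vanishes is a complete Nevanlinna-Pick kernel if for some $\alpha\in X$ (equivalently, for all $\alpha\in X$) the function $(z,w)\mapsto 1-\dfrac{K(z,\alpha)K(\alpha,w)}{K(\alpha,\alpha)K(z,w)}$ is $\succeq 0$ on $X$. A reproducing kernel Hilbert space has the complete Nevanlinna-Pick property if its reproducing kernel is a complete Nevanlinna-Pick kernel. *)

(* Defs.v *)
(* Stdlib reals with Coquelicot's complex numbers. *)
From Stdlib Require Import Reals ZArith ClassicalEpsilon.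
From Coquelicot Require Import Coquelicot.

Open Scope C_scope.

Definition disk (z : C) : Prop := (Cmod z < 1)%R.

Definition unit_disk : Type := {z : C | disk z}.

(* Functions on [U] are represented by total functions [C -> C].  For open [U]
   this is the usual notion and depends only on the restriction of [f] to [U]. *)
Definition holomorphic_on (U : C -> Prop) (f : C -> C) : Prop :=
  forall z, U z -> @ex_derive C_AbsRing C_NormedModule f z.

Definition image_of (U : C -> Prop) (f : C -> C) (y : C) : Prop :=
  exists z, U z /\ f z = y.

Definition Hinf_unit_ball (b : C -> C) : Prop :=
  holomorphic_on disk b /\ forall z, disk z -> (Cmod (b z) <= 1)%R.

(* [sum_n u n] has the n+1 terms [u 0, ..., u n]. *)
Definition positive_kernel {X : Type} (K : X -> X -> C) : Prop :=
  (forall x y, K x y = Cconj (K y x)) /\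
  forall (n : nat) (x : nat -> X) (c : nat -> C),
    let s : C := sum_n (G := C_AbelianMonoid) (fun i =>
                   sum_n (G := C_AbelianMonoid) (fun j =>
                     Cconj (c i) * K (x i) (x j) * c j) n) n in
    Im s = 0%R /\ (0 <= Re s)%R.

Definition CNP_kernel {X : Type} (K : X -> X -> C) : Prop :=
  positive_kernel K /\
  (forall z w, K z w <> 0) /\
  exists a : X,
    positive_kernel (fun z w => 1 - (K z a * K a w) / (K a a * K z w)).

Record function_space (X : Type) : Type := FunctionSpace {
  carrier : (X -> C) -> Prop;
  inner : (X -> C) -> (X -> C) -> C }.
Arguments carrier {X} _ _.
Arguments inner {X} _ _ _.

Definition reproducing_kernel {X : Type} (H : function_space X)
    (K : X -> X -> C) : Prop :=
  forall w : X,
    carrier H (fun z => K z w) /\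
    forall F, carrier H F -> inner H F (fun z => K z w) = F w.

Definition has_CNP_property {X : Type} (H : function_space X) : Prop :=
  exists K, reproducing_kernel H K /\ CNP_kernel K.

(* Elements of the Hardy space and of L^2(T) are handled through coefficients.
    An element of H^2 is given by its sequence [u : nat -> C] of Taylor
    coefficients, subject to [l2 u]; the function on the disk is [H2_fun u].
    An element of L^2(T), in particular a bounded symbol, is given by its
    family [f : Z -> C] of Fourier coefficients, so that pointwise product on
    the circle is convolution. *)

Definition CSeries (a : nat -> C) : C :=
  (Series (fun n => Re (a n)), Series (fun n => Im (a n))).

Definition CSeriesZ (a : Z -> C) : C :=
  CSeries (fun n => a (Z.of_nat n)) + CSeries (fun n => a (- Z.of_nat (S n))%Z).

Definition l2 (u : nat -> C) : Prop := ex_series (fun n => (Cmod (u n) ^ 2)%R).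

Definition l2_inner (u v : nat -> C) : C := CSeries (fun n => u n * Cconj (v n)).

Definition l2_norm (u : nat -> C) : R := sqrt (Series (fun n => (Cmod (u n) ^ 2)%R)).

Definition H2_fun (u : nat -> C) : unit_disk -> C :=
  fun z => CSeries (fun n => u n * proj1_sig z ^ n).

Definition taylor (b : C -> C) : nat -> C :=
  epsilon (inhabits (fun _ => RtoC 0))
    (fun a => forall z, disk z -> @is_pseries C_AbsRing C_NormedModule a z (b z)).

Definition H2_to_L2 (u : nat -> C) : Z -> C :=
  fun k => if (k <? 0)%Z then RtoC 0 else u (Z.to_nat k).

(* The orthogonal projection of L^2(T) onto H^2. *)
Definition riesz_proj (f : Z -> C) : nat -> C := fun n => f (Z.of_nat n).

Definition L2_mult (f g : Z -> C) : Z -> C :=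
  fun k => CSeriesZ (fun m => f (k - m)%Z * g m).

Definition L2_conj (f : Z -> C) : Z -> C := fun k => Cconj (f (- k)%Z).

Definition op : Type := (nat -> C) -> (nat -> C).

Definition toeplitz (f : Z -> C) : op := fun u => riesz_proj (L2_mult f (H2_to_L2 u)).

(* Only the values of an [op] on [l2] matter. *)
Definition bounded_op (A : op) : Prop :=
  (forall u, l2 u -> l2 (A u)) /\
  (forall u v, l2 u -> l2 v ->
     forall n, A (fun k => u k + v k) n = A u n + A v n) /\
  (forall (c : C) u, l2 u -> forall n, A (fun k => c * u k) n = c * A u n) /\
  exists M : R, forall u, l2 u -> (l2_norm (A u) <= M * l2_norm u)%R.

Definition positive_op (A : op) : Prop :=
  bounded_op A /\
  forall u, l2 u -> Im (l2_inner (A u) u) = 0%R /\ (0 <= Re (l2_inner (A u) u))%R.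

(* Unique on [l2] for a positive operator [T]. *)
Definition sqrt_op (T : op) : op :=
  epsilon (inhabits (fun u => u))
    (fun A => positive_op A /\ forall u, l2 u -> forall n, A (A u) n = T u n).

Definition perp_ker (A : op) (f : nat -> C) : Prop :=
  l2 f /\ forall g, l2 g -> (forall n, A g n = 0) -> l2_inner f g = 0.

(* The unique [f] orthogonal to ker A with [A f = F]. *)
Definition range_rep (A : op) (F : unit_disk -> C) : nat -> C :=
  epsilon (inhabits (fun _ => RtoC 0))
    (fun f => perp_ker A f /\ forall z, H2_fun (A f) z = F z).

Definition range_space (A : op) : function_space unit_disk := {|
  carrier := fun F => exists f, l2 f /\ forall z, H2_fun (A f) z = F z;
  inner := fun F G => l2_inner (range_rep A F) (range_rep A G) |}.

Definition defect_op (b : C -> C) : op :=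
  let s := H2_to_L2 (taylor b) in
  fun u n => u n - toeplitz s (toeplitz (L2_conj s) u) n.

Definition dBR_space (b : C -> C) : function_space unit_disk :=
  range_space (sqrt_op (defect_op b)).

(* Main.v *)
Require Import Defs.
From Stdlib Require Import Reals ZArith Lra Lia FunctionalExtensionality ClassicalEpsilon Classical.
From Coquelicot Require Import Coquelicot.
Open Scope C_scope.

(** Write [k(z, w) = (1 - b(z) conj b(w)) / (1 - z conj w)].  The theorem has two independent halves:
    the space H(b), which is defined through a square root, has reproducing kernel [k], and [k] is a
    complete Nevanlinna-Pick kernel exactly when [h] and [q] exist.

    The kernel.  Multiplication by [b] is a contraction of the Hardy space.  This rests on the Taylor
    expansion of a merely complex differentiable function: Goursat's theorem for [f (exp s) exp (- n s)]
    makes the Fourier coefficients of [f] on circles depend on the radius as [r^n]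
    ([hat_const]), Chernoff's telescoping argument gives convergence of the expansion ([taylor_at]),
    and Bessel's inequality gives the contraction ([conv_taylor_contraction]).  Hence [I - T_b T_b^*] is
    positive; it has a positive square root by an iteration ([sqrt_exists]), and since
    [T_b^* k_w = conj (b w) k_w] for the Szego kernels [k_w], the reproducing kernel of the range
    space is [k] ([dBR_reproducing]).

    The Pick property.  The defining condition may be tested at the base point 0
    ([CNP_base_change]).  Let [phi = (b - b0) / (1 - conj b0 b)], where [b0 = b(0)].  At the base point 0
    the condition says that [(z conj w - phi(z) conj phi(w)) / (1 - phi(z) conj phi(w))] is a positive
    kernel ([CNP_kernel_phi]).  Dividing by [z conj w], this is the Pick condition for a function [Q] in
    the unit ball of H-infinity with [phi = z Q(phi)].

    Necessity.  The values of [phi] cluster at 0, and there Nevanlinna-Pick interpolation on an infinite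
    set is soft: the Pick condition makes [k_(phi z) |-> conj psi(z) k_(phi z)], [psi = phi / z], a
    contraction on the span of the kernel functions, and its adjoint is multiplication by [Q]
    ([Pick_interpolation]).  [Q] does not vanish at 0, since otherwise [phi = z Q(phi)] would vanish
    at 0 to a higher order than itself ([factor_nonzero]).  So [z = phi / Q(phi)] is a function of [phi],
    which yields [h], with no appeal to an inverse function theorem, and
    [q(y) = (1 - conj b0 y) Q((y - b0) / (1 - conj b0 y))].

    Sufficiency.  As [h (b z) = z], the definition of [q] reads [z q(b z) = b z - b0], which exhibits the
    kernel in question as a rescaled pullback under [b] of the kernel of H(Q) for
    [Q = q / (1 - conj b0 y)]; that kernel is positive by the first half. *)

(** * Sums, series and limits in C *)

Lemma Ceq (x y : C) : Re x = Re y -> Im x = Im y -> x = y.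
Proof. destruct x, y; simpl; congruence. Qed.

Definition csum (a : nat -> C) (n : nat) : C := sum_n (G := C_AbelianMonoid) a n.

Lemma csum_0 a : csum a 0 = a 0%nat.
Proof. apply sum_O. Qed.

Lemma csum_S a n : csum a (S n) = csum a n + a (S n).
Proof. apply (sum_Sn (G := C_AbelianMonoid)). Qed.

Lemma csum_ext a b n : (forall k, (k <= n)%nat -> a k = b k) -> csum a n = csum b n.
Proof. apply (sum_n_ext_loc (G := C_AbelianMonoid)). Qed.

Lemma csum_plus a b n : csum (fun k => a k + b k) n = csum a n + csum b n.
Proof. induction n; rewrite ?csum_0, ?csum_S; [ring|]; rewrite IHn; ring. Qed.

Lemma csum_scal c a n : csum (fun k => c * a k) n = c * csum a n.
Proof. induction n; rewrite ?csum_0, ?csum_S; [ring|]; rewrite IHn; ring. Qed.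

Lemma csum_conj a n : Cconj (csum a n) = csum (fun k => Cconj (a k)) n.
Proof. induction n; rewrite ?csum_0, ?csum_S; [ring|]; rewrite Cplus_conj, IHn; ring. Qed.

Lemma Re_csum a n : Re (csum a n) = sum_n (fun k => Re (a k)) n.
Proof. induction n; rewrite ?csum_0, ?csum_S, ?sum_O, ?sum_Sn; [reflexivity|]; rewrite re_plus, IHn; reflexivity. Qed.

Lemma Im_csum a n : Im (csum a n) = sum_n (fun k => Im (a k)) n.
Proof. induction n; rewrite ?csum_0, ?csum_S, ?sum_O, ?sum_Sn; [reflexivity|].
  rewrite <- IHn; destruct (csum a n), (a (S n)); reflexivity. Qed.

Lemma csum_zero n : csum (fun _ => 0) n = 0.
Proof. induction n; rewrite ?csum_0, ?csum_S; [ring|]; rewrite IHn; ring. Qed.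

Lemma csum_delta (a : nat -> C) n k : (k <= n)%nat ->
  csum (fun i => if Nat.eq_dec i k then a i else 0) n = a k.
Proof.
  induction n as [|n IH]; intros H.
  - rewrite csum_0. destruct (Nat.eq_dec 0 k); [congruence|lia].
  - rewrite csum_S. destruct (Nat.eq_dec (S n) k) as [e|e].
    + subst. rewrite (csum_ext _ (fun _ => 0)).
      * rewrite csum_zero. ring.
      * intros i Hi. destruct (Nat.eq_dec i (S n)); [lia|auto].
    + rewrite IH by lia. ring.
Qed.

Lemma Rsum_n_S (a : nat -> R) n : sum_n a (S n) = (sum_n a n + a (S n))%R.
Proof. apply (sum_Sn (G := R_AbelianMonoid)). Qed.

Lemma Rsum_n_pos (a : nat -> R) n : (forall k, (0 <= a k)%R) -> (0 <= sum_n a n)%R.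
Proof. intros H. induction n; rewrite ?sum_O, ?Rsum_n_S; [auto|]. specialize (H (S n)); lra. Qed.

Lemma Rsum_n_le (a b : nat -> R) n : (forall k, (k <= n)%nat -> (a k <= b k)%R) -> (sum_n a n <= sum_n b n)%R.
Proof. induction n; intros H; rewrite ?sum_O, ?Rsum_n_S; [apply H; lia|].
  assert (sum_n a n <= sum_n b n)%R by (apply IHn; intros; apply H; lia).
  specialize (H (S n) (Nat.le_refl _)); lra. Qed.

Lemma Rsum_n_mono (a : nat -> R) n m : (forall k, (0 <= a k)%R) -> (n <= m)%nat -> (sum_n a n <= sum_n a m)%R.
Proof. intros H L; induction L; [lra|]. rewrite Rsum_n_S. specialize (H (S m)). lra. Qed.

Lemma sum_le_Series (a : nat -> R) n : (forall k, (0 <= a k)%R) -> ex_series a -> (sum_n a n <= Series a)%R.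
Proof.
  intros H E. apply Series_correct in E.
  apply (is_lim_seq_le_loc (fun _ => sum_n a n) (sum_n a) (sum_n a n) (Series a)).
  - exists n. intros m Hm. apply Rsum_n_mono; auto.
  - apply is_lim_seq_const.
  - exact E.
Qed.

Lemma ex_series_bounded (a : nat -> R) M : (forall k, (0 <= a k)%R) -> (forall n, (sum_n a n <= M)%R) -> 
  ex_series a /\ (Series a <= M)%R.
Proof.
  intros H B.
  assert (E : ex_finite_lim_seq (sum_n a)).
  { apply (ex_finite_lim_seq_incr _ M); auto. intros n. rewrite Rsum_n_S. specialize (H (S n)); lra. }
  assert (E' : ex_series a) by (destruct E as [l Hl]; exists l; exact Hl).
  split; auto. apply Series_correct in E'.
  apply (is_lim_seq_le (sum_n a) (fun _ => M) (Series a) M); auto. apply is_lim_seq_const.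
Qed.

Lemma ex_series_dom (a b : nat -> R) : (forall n, (0 <= a n <= b n)%R) -> ex_series b -> ex_series a.
Proof.
  intros H E. apply (ex_series_le (K := R_AbsRing) (V := R_CompleteNormedModule) a b); auto.
  intros n. specialize (H n). unfold norm; simpl. unfold abs; simpl. rewrite Rabs_pos_eq; lra.
Qed.

Lemma Series_nonneg (a : nat -> R) : (forall n, (0 <= a n)%R) -> ex_series a -> (0 <= Series a)%R.
Proof. intros H E. eapply Rle_trans; [|apply (sum_le_Series a 0); auto]. rewrite sum_O; auto. Qed.

Definition asum (a : nat -> C) : Prop := ex_series (fun n => Cmod (a n)).

Lemma asum_dom (a : nat -> C) (b : nat -> R) : (forall n, (Cmod (a n) <= b n)%R) -> ex_series b -> asum a.
Proof. intros H E. apply (ex_series_dom _ b); auto. intros n; split; [apply Cmod_ge_0|auto]. Qed.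

Lemma im_le_Cmod (c : C) : (Rabs (Im c) <= Cmod c)%R.
Proof. eapply Rle_trans; [|apply Rmax_Cmod]. apply Rmax_r. Qed.

Lemma asum_Re a : asum a -> ex_series (fun n => Re (a n)).
Proof. intros E. apply ex_series_Rabs. eapply ex_series_dom; [|exact E].
  intros n; split; [apply Rabs_pos|apply re_le_Cmod]. Qed.

Lemma asum_Im a : asum a -> ex_series (fun n => Im (a n)).
Proof. intros E. apply ex_series_Rabs. eapply ex_series_dom; [|exact E].
  intros n; split; [apply Rabs_pos|apply im_le_Cmod]. Qed.

Lemma asum_scal c a : asum a -> asum (fun n => c * a n).
Proof. intros A. eapply asum_dom; [|apply (ex_series_scal (Cmod c) _ A)].
  intros n. rewrite Cmod_mult. apply Rle_refl. Qed.

Lemma asum_conj a : asum a -> asum (fun n => Cconj (a n)).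
Proof. intros A. eapply asum_dom; [|exact A]. intros n; rewrite Cmod_conj. apply Rle_refl. Qed.

Lemma CSeries_ext a b : (forall n, a n = b n) -> CSeries a = CSeries b.
Proof. intros H. f_equal. apply functional_extensionality; auto. Qed.

Lemma Re_CSeries a : Re (CSeries a) = Series (fun n => Re (a n)).
Proof. reflexivity. Qed.

Lemma Im_CSeries a : Im (CSeries a) = Series (fun n => Im (a n)).
Proof. reflexivity. Qed.

Lemma im_plus (a b : C) : Im (a + b) = (Im a + Im b)%R.
Proof. reflexivity. Qed.

Lemma CSeries_plus a b : asum a -> asum b -> CSeries (fun n => a n + b n) = CSeries a + CSeries b.
Proof.
  intros A B. apply Ceq.
  - rewrite re_plus, !Re_CSeries, <- Series_plus; auto using asum_Re.
  - rewrite im_plus, !Im_CSeries, <- Series_plus; auto using asum_Im.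
Qed.

Lemma CSeries_scal c a : asum a -> CSeries (fun n => c * a n) = c * CSeries a.
Proof.
  intros A. pose proof (asum_Re _ A) as Ar. pose proof (asum_Im _ A) as Ai.
  assert (E : forall x (f : nat -> R), ex_series f -> ex_series (fun n => x * f n)%R)
    by (intros; apply (ex_series_scal (V := R_NormedModule) x f); auto).
  apply Ceq.
  - rewrite re_mult, !Re_CSeries, Im_CSeries, <- !Series_scal_l, <- Series_minus; auto.
  - rewrite im_mult. rewrite !Im_CSeries, Re_CSeries. rewrite <- !Series_scal_l, <- Series_plus; auto.
Qed.

Lemma CSeries_conj a : Cconj (CSeries a) = CSeries (fun n => Cconj (a n)).
Proof.
  apply Ceq; [reflexivity|].
  rewrite im_conj, !Im_CSeries, <- Series_opp. reflexivity.
Qed.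

(** Rotating the sum onto the positive real axis reduces this to the real triangle inequality. *)
Lemma Cmod_CSeries a : asum a -> (Cmod (CSeries a) <= Series (fun n => Cmod (a n)))%R.
Proof.
  intros A. set (s := CSeries a).
  destruct (Req_dec (Cmod s) 0) as [e|e].
  { rewrite e. apply Series_nonneg; auto. intros; apply Cmod_ge_0. }
  assert (Hp : (0 < Cmod s)%R) by (pose proof (Cmod_ge_0 s); lra).
  apply (Rmult_le_reg_l (Cmod s)); auto.
  rewrite <- Series_scal_l.
  replace (Cmod s * Cmod s)%R with (Re (Cconj s * s)).
  2:{ rewrite Cmult_comm, <- Cmod2_conj. simpl. ring. }
  unfold s at 2. rewrite <- CSeries_scal by auto. rewrite Re_CSeries.
  eapply Rle_trans; [apply Rle_abs|]. 
  assert (E : ex_series (fun n => Rabs (Re (Cconj s * a n)))).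
  { eapply ex_series_dom; [|apply (asum_scal (Cconj s) _ A)]. intros n; split; [apply Rabs_pos|apply re_le_Cmod]. }
  eapply Rle_trans; [apply Series_Rabs; auto|].
  apply Series_le.
  - intros n. split; [apply Rabs_pos|]. eapply Rle_trans; [apply re_le_Cmod|].
    rewrite Cmod_mult, Cmod_conj. apply Rle_refl.
  - apply (ex_series_scal (V := R_NormedModule) (Cmod s) (fun n => Cmod (a n))); auto.
Qed.

Lemma asum_incr a n : asum a -> asum (fun k => a (S n + k)%nat).
Proof. intros A. apply (ex_series_incr_n (fun k => Cmod (a k)) (S n)) in A. exact A. Qed.

Lemma CSeries_split a n : asum a -> CSeries a = csum a n + CSeries (fun k => a (S n + k)%nat).
Proof.
  intros A. apply Ceq.
  - rewrite re_plus, !Re_CSeries, Re_csum, (Series_incr_n _ (S n)); [|lia|auto using asum_Re].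
    simpl pred. rewrite <- sum_n_Reals. reflexivity.
  - rewrite im_plus, !Im_CSeries, Im_csum, (Series_incr_n _ (S n)); [|lia|auto using asum_Im].
    simpl pred. rewrite <- sum_n_Reals. reflexivity.
Qed.

Lemma CSeries_0 : CSeries (fun _ => 0) = 0.
Proof.
  assert (E : Series (fun _ => 0%R) = 0%R).
  { rewrite (Series_ext _ (fun n => 0 * 0)%R) by (intros; ring). rewrite Series_scal_l. ring. }
  apply Ceq; exact E.
Qed.

Lemma ex_series_finite (a : nat -> R) n : (forall k, (n < k)%nat -> a k = 0%R) -> ex_series a.
Proof.
  intros H. apply (ex_series_incr_n a (S n)). exists 0%R.
  apply (is_series_ext (fun _ => 0%R)). { intros k; rewrite H; auto; lia. }
  change (is_lim_seq (sum_n (fun _ => 0%R)) 0%R).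
  apply (is_lim_seq_ext (fun _ => 0%R)); [|apply is_lim_seq_const].
  intros k. induction k; rewrite ?sum_O, ?Rsum_n_S; [auto|]. rewrite <- IHk. ring.
Qed.

Lemma asum_finite (a : nat -> C) n : (forall k, (n < k)%nat -> a k = 0) -> asum a.
Proof. intros H. apply (ex_series_finite _ n). intros k Hk; rewrite H, Cmod_0; auto. Qed.

Lemma CSeries_finite (a : nat -> C) n : (forall k, (n < k)%nat -> a k = 0) -> CSeries a = csum a n.
Proof.
  intros H. rewrite (CSeries_split a n) by (apply (asum_finite _ n); auto).
  rewrite (CSeries_ext (fun k => a (S n + k)%nat) (fun _ => 0)), CSeries_0; [ring|]. intros; apply H; lia.
Qed.

Definition clim (s : nat -> C) (l : C) : Prop :=
  forall eps, (0 < eps)%R -> exists N, forall n, (N <= n)%nat -> (Cmod (s n - l) <= eps)%R.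

Lemma ex_series_tail (a : nat -> R) : (forall n, (0 <= a n)%R) -> ex_series a ->
  forall eps, (0 < eps)%R -> exists N, forall n, (N <= n)%nat -> (Series (fun k => a (S n + k)%nat) <= eps)%R.
Proof.
  intros H E eps He. pose proof (Series_correct _ E) as L.
  assert (L' : is_lim_seq (sum_n a) (Series a)) by exact L.
  apply is_lim_seq_spec in L'. destruct (L' (mkposreal eps He)) as [N HN]. exists N. intros n Hn.
  specialize (HN n Hn). simpl in HN.
  rewrite (Series_incr_n a (S n)) in HN; auto; [|lia]. simpl pred in HN. rewrite <- sum_n_Reals in HN.
  revert HN. intros HN. apply Rabs_def2 in HN. simpl in *. lra.
Qed.

Lemma clim_CSeries a : asum a -> clim (csum a) (CSeries a).
Proof.
  intros A eps He. destruct (ex_series_tail (fun n => Cmod (a n)) (fun n => Cmod_ge_0 _) A eps He) as [N HN].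
  exists N. intros n Hn. rewrite (CSeries_split a n) by auto.
  replace (csum a n - (csum a n + CSeries (fun k => a (S n + k)%nat))) with (- CSeries (fun k => a (S n + k)%nat)) by ring.
  rewrite Cmod_opp. eapply Rle_trans; [apply Cmod_CSeries; apply asum_incr; auto|]. apply HN; auto.
Qed.

Lemma Cmod_small (x : C) : (forall eps, (0 < eps)%R -> (Cmod x <= eps)%R) -> x = 0.
Proof. intros H. apply Cmod_eq_0. pose proof (Cmod_ge_0 x).
  destruct (Req_dec (Cmod x) 0); auto. specialize (H (Cmod x / 2)%R). lra. Qed.

Lemma Cmod_minus_sym x y : Cmod (x - y) = Cmod (y - x).
Proof. replace (y - x) with (- (x - y)) by ring. rewrite Cmod_opp; auto. Qed.

Lemma clim_unique s l l' : clim s l -> clim s l' -> l = l'.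
Proof.
  intros A B. assert (l - l' = 0).
  { apply Cmod_small. intros eps He. destruct (A (eps/2)%R) as [N HN]; [lra|]. destruct (B (eps/2)%R) as [M HM]; [lra|].
    specialize (HN (N+M)%nat ltac:(lia)). specialize (HM (N+M)%nat ltac:(lia)).
    replace (l - l') with ((s (N+M)%nat - l') - (s (N+M)%nat - l)) by ring.
    eapply Rle_trans; [apply Cmod_triangle|]. rewrite Cmod_opp. lra. }
  replace l with (l - l' + l') by ring. rewrite H. ring.
Qed.

Lemma clim_const c : clim (fun _ => c) c.
Proof. intros eps He. exists 0%nat. intros. replace (c - c) with (RtoC 0) by ring. rewrite Cmod_0; lra. Qed.

Lemma clim_plus s t l m : clim s l -> clim t m -> clim (fun n => s n + t n) (l + m).
Proof.
  intros A B eps He. destruct (A (eps/2)%R) as [N HN]; [lra|]. destruct (B (eps/2)%R) as [M HM]; [lra|].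
  exists (N+M)%nat. intros n Hn. specialize (HN n ltac:(lia)). specialize (HM n ltac:(lia)).
  replace (s n + t n - (l + m)) with ((s n - l) + (t n - m)) by ring.
  eapply Rle_trans; [apply Cmod_triangle|]. lra.
Qed.

Lemma clim_scal c s l : clim s l -> clim (fun n => c * s n) (c * l).
Proof.
  intros A eps He. pose proof (Cmod_ge_0 c).
  destruct (A (eps / (Cmod c + 1))%R) as [N HN]. { apply Rdiv_lt_0_compat; lra. }
  exists N. intros n Hn. specialize (HN n Hn). replace (c * s n - c * l) with (c * (s n - l)) by ring.
  rewrite Cmod_mult. apply Rle_trans with (Cmod c * (eps / (Cmod c + 1)))%R.
  { apply Rmult_le_compat_l; auto. }
  replace (Cmod c * (eps / (Cmod c + 1)))%R with (eps * (Cmod c / (Cmod c + 1)))%R by (field; lra).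
  rewrite <- (Rmult_1_r eps) at 2. apply Rmult_le_compat_l; [lra|]. 
  apply (Rmult_le_reg_r (Cmod c + 1)%R); [lra|]. unfold Rdiv. rewrite Rmult_assoc, Rinv_l; lra.
Qed.

Lemma Rabs_Cmod_minus x y : (Rabs (Cmod x - Cmod y) <= Cmod (x - y))%R.
Proof.
  apply Rabs_le. split.
  - assert (Cmod y <= Cmod (y - x) + Cmod x)%R.
    { eapply Rle_trans; [|apply Cmod_triangle]. right; f_equal; ring. }
    rewrite Cmod_minus_sym in H. lra.
  - assert (Cmod x <= Cmod (x - y) + Cmod y)%R.
    { eapply Rle_trans; [|apply Cmod_triangle]. right; f_equal; ring. }
    lra.
Qed.

Lemma clim_Cmod s l : clim s l -> is_lim_seq (fun n => Cmod (s n)) (Cmod l).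
Proof.
  intros A. apply is_lim_seq_spec. intros [e He]. destruct (A (e/2)%R) as [N HN]; [lra|].
  exists N. intros n Hn. simpl. eapply Rle_lt_trans; [apply Rabs_Cmod_minus|]. specialize (HN n Hn). lra.
Qed.

Lemma clim_cauchy (s : nat -> C) :
  (forall eps, (0 < eps)%R -> exists N, forall n m, (N <= n)%nat -> (N <= m)%nat -> (Cmod (s n - s m) <= eps)%R) ->
  exists l, clim s l.
Proof.
  intros H.
  assert (R1 : exists a, is_lim_seq (fun n => Re (s n)) (Finite a)).
  { apply ex_lim_seq_cauchy_corr. intros [e He]. destruct (H (e/2)%R) as [N HN]; [lra|]. exists N. intros n m Hn Hm. simpl.
    specialize (HN n m Hn Hm). eapply Rle_lt_trans; [|eapply Rle_lt_trans;[exact HN|lra]].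
    eapply Rle_trans; [|apply re_le_Cmod]. right. f_equal. }
  assert (R2 : exists a, is_lim_seq (fun n => Im (s n)) (Finite a)).
  { apply ex_lim_seq_cauchy_corr. intros [e He]. destruct (H (e/2)%R) as [N HN]; [lra|]. exists N. intros n m Hn Hm. simpl.
    specialize (HN n m Hn Hm). eapply Rle_lt_trans; [|eapply Rle_lt_trans;[exact HN|lra]].
    eapply Rle_trans; [|apply im_le_Cmod]. right. f_equal. }
  destruct R1 as [a Ha], R2 as [b Hb]. exists (a, b).
  apply is_lim_seq_spec in Ha. apply is_lim_seq_spec in Hb.
  intros eps He. destruct (Ha (mkposreal (eps/2) ltac:(lra))) as [N HN]. destruct (Hb (mkposreal (eps/2) ltac:(lra))) as [M HM].
  exists (N+M)%nat. intros n Hn. specialize (HN n ltac:(lia)). specialize (HM n ltac:(lia)). simpl in HN, HM.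
  eapply Rle_trans; [apply Cmod_2Rmax|].
  replace (fst (s n - (a, b))) with (Re (s n) - a)%R by (destruct (s n); reflexivity).
  replace (snd (s n - (a, b))) with (Im (s n) - b)%R by (destruct (s n); reflexivity).
  assert (Rmax (Rabs (Re (s n) - a)) (Rabs (Im (s n) - b)) <= eps/2)%R by (apply Rmax_lub; lra).
  assert (sqrt 2 <= 2)%R.
  { rewrite <- (sqrt_Rsqr 2) at 2 by lra. apply sqrt_le_1_alt. unfold Rsqr; lra. }
  pose proof (sqrt_pos 2).
  apply Rle_trans with (2 * (eps/2))%R; [|lra].
  apply Rmult_le_compat; auto. eapply Rle_trans; [apply Rabs_pos|apply Rmax_l].
Qed.

(** * The Hilbert space of square-summable sequences *)

Definition vadd (u v : nat -> C) : nat -> C := fun k => u k + v k.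
Definition vscal (c : C) (u : nat -> C) : nat -> C := fun k => c * u k.
Definition vsub (u v : nat -> C) : nat -> C := fun k => u k - v k.
Definition vzero : nat -> C := fun _ => 0.

Tactic Notation "funext" ident(x) := apply functional_extensionality; intros x.
Ltac vec_ring := intros; apply functional_extensionality; intros ?; unfold vadd, vsub, vscal, vzero; ring.

Definition sqnorm (u : nat -> C) : R := Series (fun n => (Cmod (u n) ^ 2)%R).

Lemma sq_pos (x : R) : (0 <= x ^ 2)%R.
Proof. replace (x^2)%R with (x*x)%R by ring. apply Rle_0_sqr. Qed.

Lemma vsub_eq u v : vsub u v = vadd u (vscal (-1) v).
Proof. vec_ring. Qed.

Lemma l2_prod u v : l2 u -> l2 v -> asum (fun n => u n * v n).
Proof.
  intros U V. eapply asum_dom; [|apply (ex_series_plus _ _ U V)].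
  intros n. rewrite Cmod_mult. unfold plus; simpl.
  pose proof (Rle_0_sqr (Cmod (u n) - Cmod (v n))). unfold Rsqr in H.
  pose proof (Rmult_le_pos _ _ (Cmod_ge_0 (u n)) (Cmod_ge_0 (v n))). nra.
Qed.

Lemma l2_scal c u : l2 u -> l2 (vscal c u).
Proof.
  intros U. eapply ex_series_dom; [|apply (ex_series_scal (V := R_NormedModule) (Cmod c ^ 2)%R _ U)].
  intros n. split; [apply sq_pos|]. unfold vscal. rewrite Cmod_mult, Rpow_mult_distr. apply Rle_refl.
Qed.

Lemma l2_add u v : l2 u -> l2 v -> l2 (vadd u v).
Proof.
  intros U V. eapply ex_series_dom; [|apply (ex_series_scal (V := R_NormedModule) 2 _ (ex_series_plus _ _ U V))].
  intros n. split; [apply sq_pos|]. unfold vadd, plus, scal; simpl. unfold mult; simpl.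
  pose proof (Cmod_triangle (u n) (v n)). pose proof (Cmod_ge_0 (u n + v n)).
  pose proof (Rle_0_sqr (Cmod (u n) - Cmod (v n))). unfold Rsqr in H1. nra.
Qed.

Lemma l2_sub u v : l2 u -> l2 v -> l2 (vsub u v).
Proof. intros; rewrite vsub_eq; auto using l2_add, l2_scal. Qed.

Lemma l2_conj u : l2 u -> l2 (fun n => Cconj (u n)).
Proof. intros U. eapply ex_series_ext; [|exact U]. intros n; simpl; rewrite Cmod_conj; auto. Qed.

Lemma l2_finite (u : nat -> C) n : (forall k, (n < k)%nat -> u k = 0) -> l2 u.
Proof. intros H. apply (ex_series_finite _ n). intros k Hk; rewrite H, Cmod_0; auto; ring. Qed.

Lemma l2_zero : l2 vzero.
Proof. apply (l2_finite _ 0). auto. Qed.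

#[global] Hint Resolve l2_scal l2_add l2_sub l2_zero : l2.

Lemma asum_inner u v : l2 u -> l2 v -> asum (fun n => u n * Cconj (v n)).
Proof. intros. apply (l2_prod u (fun n => Cconj (v n))); auto using l2_conj. Qed.

Lemma inner_add_l u v w : l2 u -> l2 v -> l2 w -> l2_inner (vadd u v) w = l2_inner u w + l2_inner v w.
Proof.
  intros. unfold l2_inner. rewrite <- CSeries_plus by (apply asum_inner; auto).
  apply CSeries_ext. intros n; unfold vadd; ring.
Qed.

Lemma inner_scal_l c u w : l2 u -> l2 w -> l2_inner (vscal c u) w = c * l2_inner u w.
Proof.
  intros. unfold l2_inner. rewrite <- CSeries_scal by (apply asum_inner; auto).
  apply CSeries_ext. intros n; unfold vscal; ring.
Qed.

Lemma inner_conj u v : l2_inner v u = Cconj (l2_inner u v).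
Proof.
  unfold l2_inner. rewrite CSeries_conj. apply CSeries_ext. intros n. rewrite Cmult_conj, Cconj_conj. ring.
Qed.

Lemma inner_add_r u v w : l2 u -> l2 v -> l2 w -> l2_inner w (vadd u v) = l2_inner w u + l2_inner w v.
Proof. intros. rewrite (inner_conj (vadd u v)), inner_add_l, Cplus_conj, <- !inner_conj; auto. Qed.

Lemma inner_scal_r c u w : l2 u -> l2 w -> l2_inner w (vscal c u) = Cconj c * l2_inner w u.
Proof. intros. rewrite (inner_conj (vscal c u)), inner_scal_l, Cmult_conj, <- !inner_conj; auto. Qed.

Lemma inner_sub_l u v w : l2 u -> l2 v -> l2 w -> l2_inner (vsub u v) w = l2_inner u w - l2_inner v w.
Proof. intros. rewrite vsub_eq, inner_add_l, inner_scal_l; auto with l2. ring. Qed.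

Lemma Cconj_R (r : R) : Cconj (RtoC r) = RtoC r.
Proof. apply Ceq; simpl; ring. Qed.

Lemma Cconj_m1 : Cconj (-1) = -1.
Proof. apply Ceq; simpl; ring. Qed.

Lemma inner_sub_r u v w : l2 u -> l2 v -> l2 w -> l2_inner w (vsub u v) = l2_inner w u - l2_inner w v.
Proof. intros. rewrite vsub_eq, inner_add_r, inner_scal_r, Cconj_m1; auto with l2. ring. Qed.

Lemma inner_self u : l2_inner u u = RtoC (sqnorm u).
Proof.
  unfold l2_inner, sqnorm. apply Ceq; unfold CSeries; simpl.
  - apply Series_ext. intros n. destruct (u n) as [x y]. simpl. unfold Cmod; simpl. rewrite !Rmult_1_r.
    rewrite sqrt_sqrt by nra. ring.
  - rewrite (Series_ext _ (fun n => 0 * 0)%R) by (intros; ring). rewrite Series_scal_l. ring.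
Qed.

Lemma sqnorm_pos u : l2 u -> (0 <= sqnorm u)%R.
Proof. intros U. apply Series_nonneg; auto. intros; apply sq_pos. Qed.

Lemma sqnorm_inner u : sqnorm u = Re (l2_inner u u).
Proof. rewrite inner_self; reflexivity. Qed.

Lemma sqnorm_coord u n : l2 u -> (Cmod (u n) ^ 2 <= sqnorm u)%R.
Proof.
  intros U. eapply Rle_trans; [|apply (sum_le_Series _ n); [intros; apply sq_pos|exact U]].
  destruct n; rewrite ?sum_O; [lra|]. rewrite Rsum_n_S.
  pose proof (Rsum_n_pos (fun k => (Cmod (u k) ^ 2)%R) n (fun k => sq_pos _)). lra.
Qed.

Lemma sqnorm_zero u : l2 u -> (sqnorm u <= 0)%R -> u = vzero.
Proof.
  intros U H. funext n. unfold vzero.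
  pose proof (sqnorm_coord u n U). apply Cmod_eq_0. pose proof (Cmod_ge_0 (u n)). nra.
Qed.

Lemma sqnorm_scal c u : l2 u -> sqnorm (vscal c u) = (Cmod c ^ 2 * sqnorm u)%R.
Proof. intros U. unfold sqnorm. rewrite <- Series_scal_l. apply Series_ext. intros n.
  unfold vscal. rewrite Cmod_mult. ring. Qed.

Lemma sqnorm_add u v : l2 u -> l2 v ->
  sqnorm (vadd u v) = (sqnorm u + sqnorm v + 2 * Re (l2_inner u v))%R.
Proof.
  intros U V. rewrite !sqnorm_inner, inner_add_l, !inner_add_r, !re_plus, (inner_conj u v), re_conj; auto with l2. ring.
Qed.

Lemma sqnorm_sub u v : l2 u -> l2 v ->
  sqnorm (vsub u v) = (sqnorm u + sqnorm v - 2 * Re (l2_inner u v))%R.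
Proof.
  intros U V. rewrite !sqnorm_inner, inner_sub_l, !inner_sub_r; auto with l2.
  unfold Cminus. rewrite !re_plus, !re_opp, !re_plus, !re_opp, (inner_conj u v), re_conj. ring.
Qed.

Lemma l2_norm_sq u : l2 u -> (l2_norm u * l2_norm u = sqnorm u)%R.
Proof. intros U. unfold l2_norm. apply sqrt_sqrt. apply sqnorm_pos; auto. Qed.

Lemma l2_norm_pos u : (0 <= l2_norm u)%R.
Proof. apply sqrt_pos. Qed.

Lemma Cauchy_Schwarz_sq u v : l2 u -> l2 v -> (Cmod (l2_inner u v) ^ 2 <= sqnorm u * sqnorm v)%R.
Proof.
  intros U V. pose proof (sqnorm_pos v V) as Hv. pose proof (sqnorm_pos u U) as Hu.
  set (a := l2_inner u v).
  assert (K : forall t : R, (0 <= sqnorm u - 2 * t * Cmod a ^ 2 + t ^ 2 * Cmod a ^ 2 * sqnorm v)%R).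
  { intros t. pose proof (sqnorm_pos (vsub u (vscal (t * a) v))) as P.
    rewrite sqnorm_sub, sqnorm_scal, inner_scal_r in P; auto with l2.
    fold a in P. specialize (P ltac:(auto with l2)).
    rewrite Cmod_mult, Cmod_R, Cmult_conj, Cconj_R in P.
    replace (RtoC t * Cconj a * a) with (RtoC t * RtoC (Cmod a ^ 2)) in P by (rewrite Cmod2_conj; ring).
    rewrite <- RtoC_mult, re_RtoC, Rpow_mult_distr, pow2_abs in P. nra. }
  destruct (Req_dec (sqnorm v) 0) as [e|e].
  - rewrite e in *. apply Rnot_lt_le. intros L.
    specialize (K ((sqnorm u + 1) / (2 * Cmod a ^ 2))%R).
    replace (2 * ((sqnorm u + 1) / (2 * Cmod a ^ 2)) * Cmod a ^ 2)%R with (sqnorm u + 1)%R in K by (field; nra).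
    nra.
  - specialize (K (/ sqnorm v)%R).
    replace (sqnorm u - 2 * / sqnorm v * Cmod a ^ 2 + (/ sqnorm v) ^ 2 * Cmod a ^ 2 * sqnorm v)%R
      with ((sqnorm u * sqnorm v - Cmod a ^ 2) / sqnorm v)%R in K by (field; auto).
    assert (0 < sqnorm v)%R by lra.
    apply (Rmult_le_compat_r (sqnorm v)) in K; [|lra]. unfold Rdiv in K. rewrite Rmult_assoc, Rinv_l in K; lra.
Qed.

Lemma Rsq_le x y : (0 <= y)%R -> (x * x <= y * y)%R -> (x <= y)%R.
Proof. intros. apply Rnot_lt_le. intros L. nra. Qed.

Lemma Cauchy_Schwarz u v : l2 u -> l2 v -> (Cmod (l2_inner u v) <= l2_norm u * l2_norm v)%R.
Proof.
  intros U V. pose proof (Cauchy_Schwarz_sq u v U V). rewrite <- !l2_norm_sq in H by auto.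
  apply Rsq_le. { apply Rmult_le_pos; apply l2_norm_pos. } lra.
Qed.

Lemma l2_norm_add u v : l2 u -> l2 v -> (l2_norm (vadd u v) <= l2_norm u + l2_norm v)%R.
Proof.
  intros U V. pose proof (l2_norm_pos u). pose proof (l2_norm_pos v).
  apply Rsq_le; [lra|]. rewrite l2_norm_sq, sqnorm_add by auto with l2.
  pose proof (Cauchy_Schwarz u v U V). pose proof (re_le_Cmod (l2_inner u v)). pose proof (Rle_abs (Re (l2_inner u v))).
  rewrite <- !l2_norm_sq by auto. nra.
Qed.

Lemma l2_norm_scal c u : l2 u -> l2_norm (vscal c u) = (Cmod c * l2_norm u)%R.
Proof.
  intros U. pose proof (l2_norm_pos u). pose proof (Cmod_ge_0 c).
  pose proof (l2_norm_pos (vscal c u)). 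
  assert (l2_norm (vscal c u) * l2_norm (vscal c u) = (Cmod c * l2_norm u) * (Cmod c * l2_norm u))%R.
  { rewrite l2_norm_sq, sqnorm_scal, <- l2_norm_sq by auto with l2. ring. }
  apply Rle_antisym; apply Rsq_le; try lra. apply Rmult_le_pos; auto.
Qed.

Lemma l2_norm_sub u v : l2 u -> l2 v -> (l2_norm (vsub u v) <= l2_norm u + l2_norm v)%R.
Proof.
  intros U V. rewrite vsub_eq. eapply Rle_trans; [apply l2_norm_add; auto with l2|].
  rewrite l2_norm_scal by auto. replace (Cmod (-1)) with 1%R. lra.
  rewrite <- Cmod_m1. f_equal. ring.
Qed.

Lemma l2_norm_coord u n : l2 u -> (Cmod (u n) <= l2_norm u)%R.
Proof. intros U. apply Rsq_le; [apply l2_norm_pos|]. rewrite l2_norm_sq by auto.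
  pose proof (sqnorm_coord u n U). simpl in H. lra. Qed.

Lemma l2_norm_le u M : l2 u -> (0 <= M)%R -> (sqnorm u <= M * M)%R -> (l2_norm u <= M)%R.
Proof. intros. apply Rsq_le; auto. rewrite l2_norm_sq; auto. Qed.

Lemma is_lim_seq_sum_n (f : nat -> nat -> R) (l : nat -> R) N :
  (forall k, is_lim_seq (fun n => f n k) (l k)) -> is_lim_seq (fun n => sum_n (f n) N) (sum_n l N).
Proof.
  intros H. induction N.
  - rewrite sum_O. apply (is_lim_seq_ext (fun n => f n 0%nat)); auto. intros; rewrite sum_O; auto.
  - rewrite Rsum_n_S. apply (is_lim_seq_ext (fun n => sum_n (f n) N + f n (S N))%R). { intros; rewrite Rsum_n_S; auto. }
    apply is_lim_seq_plus'; auto.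
Qed.

(** Fatou's lemma for counting measure: each finite partial sum of the squared moduli passes to
    the coordinatewise limit, so no norm convergence is required. *)
Lemma l2_Fatou (s : nat -> nat -> C) (u : nat -> C) M :
  (exists K, forall k, (K <= k)%nat -> l2 (s k) /\ (l2_norm (s k) <= M)%R) ->
  (forall n, clim (fun k => s k n) (u n)) -> l2 u /\ (l2_norm u <= M)%R.
Proof.
  intros [K HK] L.
  assert (M0 : (0 <= M)%R).
  { destruct (HK K (le_n _)) as [_ h]. pose proof (l2_norm_pos (s K)). lra. }
  assert (B : forall N, (sum_n (fun n => (Cmod (u n) ^ 2)%R) N <= M * M)%R).
  { intros N. apply (is_lim_seq_le_loc (fun k => sum_n (fun n => (Cmod (s k n) ^ 2)%R) N) (fun _ => (M*M)%R)
      (sum_n (fun n => (Cmod (u n) ^ 2)%R) N) (M * M)%R).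
    - exists K. intros k Hk. destruct (HK k Hk) as [h1 h2].
      eapply Rle_trans; [apply sum_le_Series; [intros; apply sq_pos|exact h1]|].
      fold (sqnorm (s k)). rewrite <- l2_norm_sq by auto. pose proof (l2_norm_pos (s k)). nra.
    - apply (is_lim_seq_sum_n (fun k n => (Cmod (s k n) ^ 2)%R) (fun n => (Cmod (u n) ^ 2)%R)).
      intros n. pose proof (clim_Cmod _ _ (L n)) as h. simpl.
      apply is_lim_seq_mult'; [exact h|]. apply is_lim_seq_mult'; [exact h|apply is_lim_seq_const].
    - apply is_lim_seq_const. }
  destruct (ex_series_bounded _ (M*M)%R (fun k => sq_pos (Cmod (u k))) B) as [h1 h2].
  split; [exact h1|]. apply l2_norm_le; auto.
Qed.

Definition l2lim (s : nat -> nat -> C) (u : nat -> C) : Prop :=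
  forall eps, (0 < eps)%R -> exists N, forall k, (N <= k)%nat -> (l2_norm (vsub (s k) u) <= eps)%R.

(** The coordinatewise limit exists since C is complete; Fatou's lemma applied to the differences
    [s j - s k] with [j] fixed turns it into a limit in norm. *)
Lemma l2_complete (s : nat -> nat -> C) : (forall k, l2 (s k)) ->
  (forall eps, (0 < eps)%R -> exists N, forall j k, (N <= j)%nat -> (N <= k)%nat -> (l2_norm (vsub (s j) (s k)) <= eps)%R) ->
  exists u, l2 u /\ l2lim s u.
Proof.
  intros S H.
  assert (E : forall n, exists l, clim (fun k => s k n) l).
  { intros n. apply clim_cauchy. intros eps He. destruct (H eps He) as [N HN]. exists N. intros j k Hj Hk.
    eapply Rle_trans; [|apply (HN j k Hj Hk)]. apply (l2_norm_coord (vsub (s j) (s k)) n). auto with l2. }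
  set (u := fun n => proj1_sig (constructive_indefinite_description _ (E n))).
  assert (Hu : forall n, clim (fun k => s k n) (u n)).
  { intros n. unfold u. destruct (constructive_indefinite_description _ (E n)); auto. }
  assert (F : forall eps, (0 < eps)%R -> exists N, forall j, (N <= j)%nat -> l2 (vsub (s j) u) /\ (l2_norm (vsub (s j) u) <= eps)%R).
  { intros eps He. destruct (H eps He) as [N HN]. exists N. intros j Hj.
    apply (l2_Fatou (fun k => vsub (s j) (s k)) (vsub (s j) u)).
    - exists N. intros k Hk. split; auto with l2.
    - intros n. unfold vsub, Cminus. apply clim_plus; [apply clim_const|].
      assert (A : clim (fun k => (-1) * s k n) ((-1) * u n)) by (apply clim_scal; auto).
      intros e h. destruct (A e h) as [N' HN']. exists N'. intros m Hm. 
      replace (- s m n - - u n) with (-1 * s m n - -1 * u n) by ring. auto. }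
  exists u. split.
  - destruct (F 1%R ltac:(lra)) as [N HN]. destruct (HN N (le_n _)) as [h _].
    replace u with (vsub (s N) (vsub (s N) u)). { auto with l2. }
    vec_ring.
  - intros eps He. destruct (F eps He) as [N HN]. exists N. intros k Hk. apply HN; auto.
Qed.

Lemma inner_lim s u v : (forall k, l2 (s k)) -> l2 u -> l2 v -> l2lim s u ->
  clim (fun k => l2_inner v (s k)) (l2_inner v u).
Proof.
  intros S U V L eps He. pose proof (l2_norm_pos v).
  destruct (L (eps / (l2_norm v + 1))%R) as [N HN]. { apply Rdiv_lt_0_compat; lra. }
  exists N. intros k Hk. rewrite <- inner_sub_r by auto.
  eapply Rle_trans; [apply Cauchy_Schwarz; auto with l2|].
  specialize (HN k Hk). pose proof (l2_norm_pos (vsub (s k) u)).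
  apply Rle_trans with ((l2_norm v + 1) * (eps / (l2_norm v + 1)))%R. { nra. }
  right. field. lra.
Qed.

Lemma parallelogram_midpoint u v : l2 u -> l2 v ->
  sqnorm (vscal (/2)%R (vadd u v)) = (sqnorm u / 2 + sqnorm v / 2 - sqnorm (vsub u v) / 4)%R.
Proof.
  intros U V. rewrite sqnorm_scal, sqnorm_add, sqnorm_sub by auto with l2.
  rewrite Cmod_R, pow2_abs. field.
Qed.

Lemma midpoint_split (x y : C) : x + (/2)%R * (-1 * x) + (/2)%R * y = (/2)%R * (x + y).
Proof. apply Ceq; simpl; field. Qed.

(** For [t = - s conj b] with [s > 0] small the linear term beats the quadratic one. *)
Lemma quadratic_zero (b : C) (c : R) :
  (forall t : C, (0 <= 2 * Re (t * b) + Cmod t ^ 2 * c)%R) -> b = 0.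
Proof.
  intros H. apply Cmod_eq_0. destruct (Req_dec (Cmod b) 0) as [|e]; auto. exfalso.
  pose proof (Cmod_ge_0 b). pose proof (Rabs_pos c). pose proof (Rle_abs c).
  set (s := (/ (Rabs c + 1))%R).
  assert (Hs : (0 < s)%R) by (apply Rinv_0_lt_compat; lra).
  specialize (H (- (RtoC s) * Cconj b)).
  replace (- (RtoC s) * Cconj b * b) with (RtoC (- s * Cmod b ^ 2)) in H.
  2:{ rewrite RtoC_mult, Cmod2_conj, RtoC_opp; ring. }
  rewrite re_RtoC, Cmod_mult, Cmod_opp, Cmod_R, Cmod_conj, Rabs_pos_eq, Rpow_mult_distr in H by lra.
  assert (s * (Rabs c + 1) = 1)%R by (apply Rinv_l; lra).
  assert (0 < s * Cmod b ^ 2)%R by (apply Rmult_lt_0_compat; nra).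
  assert (s ^ 2 * Cmod b ^ 2 * c <= s * Cmod b ^ 2 * (s * Rabs c))%R.
  { replace (s ^ 2 * Cmod b ^ 2 * c)%R with (s * Cmod b ^ 2 * (s * c))%R by ring.
    apply Rmult_le_compat_l; [lra|]. nra. }
  assert (s * Rabs c <= 1)%R by nra.
  nra.
Qed.

(** Riesz representation of a bounded functional given by its graph [G] over a subspace that need
    not be closed.  The representative minimizes [|v|^2 - 2 Re a] over [G]: by the parallelogram
    law minimizing sequences are Cauchy, and the first variation vanishes at the limit.  That the
    representative is a limit of elements of the domain is what makes it an orthogonal projection
    when the functional is [<., f>]; the norm bound is what makes multipliers contractive. *)
Lemma Riesz_relation (G : (nat -> C) -> C -> Prop) (M : R) :
  (0 <= M)%R -> (exists v a, G v a) -> (forall v a, G v a -> l2 v) ->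
  (forall v a w b t, G v a -> G w b -> G (vadd v (vscal t w)) (a + t * b)) ->
  (forall v a, G v a -> (Cmod a <= M * l2_norm v)%R) ->
  exists u, l2 u /\ (l2_norm u <= M)%R /\ (forall v a, G v a -> l2_inner v u = a) /\
    exists s, (forall k, exists a, G (s k) a) /\ l2lim s u.
Proof.
  intros M0 [v0 [a0 H0]] HL HG HB.
  set (J := fun (v : nat -> C) (a : C) => (sqnorm v - 2 * Re a)%R).
  assert (Jlow : forall v a, G v a -> (- (M * M) <= J v a)%R).
  { intros v a Hv. specialize (HB v a Hv). specialize (HL v a Hv). unfold J. rewrite <- l2_norm_sq by auto.
    pose proof (re_le_Cmod a). pose proof (Rle_abs (Re a)).
    pose proof (Rle_0_sqr (l2_norm v - M)). unfold Rsqr in H2. nra. }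
  (* minus the supremum of - J, i.e. the infimum of J over G *)
  destruct (completeness (fun x => exists v a, G v a /\ x = (- J v a)%R)) as [mj [Hub Hlub]].
  { exists (M * M)%R. intros x [v [a [Hv ->]]]. specialize (Jlow v a Hv). lra. }
  { exists (- J v0 a0)%R. eauto. }
  set (j := (- mj)%R).
  assert (Jinf : forall v a, G v a -> (j <= J v a)%R).
  { intros v a Hv. assert (- J v a <= mj)%R by (apply Hub; eauto). unfold j; lra. }
  assert (Jmin : forall k : nat, exists p, G (fst p) (snd p) /\ (J (fst p) (snd p) <= j + / (INR k + 1))%R).
  { intros k. apply NNPP. intros N.
    assert (P : (0 < / (INR k + 1))%R). { apply Rinv_0_lt_compat. pose proof (pos_INR k). lra. }
    assert (mj <= mj - / (INR k + 1))%R; [|lra].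
    apply Hlub. intros x [v [a [Hv ->]]]. apply Rnot_lt_le. intros L. apply N. exists (v, a). simpl. split; auto.
    unfold j. lra. }
  set (p := fun k => proj1_sig (constructive_indefinite_description _ (Jmin k))).
  assert (Hp : forall k, G (fst (p k)) (snd (p k)) /\ (J (fst (p k)) (snd (p k)) <= j + / (INR k + 1))%R).
  { intros k. unfold p. destruct (constructive_indefinite_description _ (Jmin k)); auto. }
  set (s := fun k => fst (p k)). set (al := fun k => snd (p k)).
  assert (Sl2 : forall k, l2 (s k)) by (intros k; apply (HL _ _ (proj1 (Hp k)))).
  assert (Hsmall : forall e, (0 < e)%R -> exists N, forall k, (N <= k)%nat -> (/ (INR k + 1) <= e)%R).
  { intros e He. destruct (archimed_cor1 e He) as [N [HN HN0]]. exists N. intros k Hk.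
    apply Rle_trans with (/ INR N)%R; [|lra]. apply Rinv_le_contravar. { apply lt_0_INR; auto. }
    apply le_INR in Hk. lra. }
  assert (Hdist : forall k m, (sqnorm (vsub (s k) (s m)) <= 2 * / (INR k + 1) + 2 * / (INR m + 1))%R).
  { intros k m. destruct (Hp k) as [Gk Jk]. destruct (Hp m) as [Gm Jm]. fold (s k) (al k) in Gk, Jk. fold (s m) (al m) in Gm, Jm.
    assert (Z : G (vscal (-1) (s k)) (-1 * al k)).
    { replace (vscal (-1) (s k)) with (vadd (vadd (s k) (vscal (-1) (s k))) (vscal (-1) (s k))).
      replace (-1 * al k) with (al k + -1 * al k + -1 * al k) by ring. auto.
      vec_ring. }
    assert (W : G (vscal (/2)%R (vadd (s k) (s m))) ((/2)%R * (al k + al m))).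
    { replace (vscal (/2)%R (vadd (s k) (s m))) with (vadd (vadd (s k) (vscal (/2)%R (vscal (-1) (s k)))) (vscal (/2)%R (s m))).
      replace ((/2)%R * (al k + al m)) with ((al k + (/2)%R * (-1 * al k)) + (/2)%R * al m). auto.
      - apply midpoint_split.
      - funext n; unfold vadd, vscal. apply midpoint_split. }
    apply Jinf in W. unfold J in W, Jk, Jm. rewrite parallelogram_midpoint in W by auto.
    rewrite re_scal_l, re_plus in W. lra. }
  destruct (l2_complete s Sl2) as [u [Hu Lu]].
  { intros e He. destruct (Hsmall (e * e / 4)%R) as [N HN]; [nra|]. exists N. intros k m Hk Hm.
    apply l2_norm_le; [auto with l2|lra|]. specialize (Hdist k m). pose proof (HN k Hk). pose proof (HN m Hm). lra. }
  assert (Rep : forall v a, G v a -> l2_inner v u = a).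
  { intros v a Hv. pose proof (HL _ _ Hv) as Hv2.
    assert (B : l2_inner v u - a = 0).
    { apply (quadratic_zero _ (sqnorm v)). intros t.
      (* first variation: pass to the limit k -> oo in J (s k + t v) >= j *)
      assert (Q : forall k, (- / (INR k + 1) <= 2 * Re (t * (l2_inner v (s k) - a)) + Cmod t ^ 2 * sqnorm v)%R).
      { intros k. destruct (Hp k) as [Gk Jk]. fold (s k) (al k) in Gk, Jk.
        pose proof (Jinf _ _ (HG _ _ _ _ t Gk Hv)) as I. unfold J in I, Jk.
        rewrite sqnorm_add, sqnorm_scal, inner_scal_r, re_plus in I by auto with l2.
        replace (Re (Cconj t * l2_inner (s k) v)) with (Re (t * l2_inner v (s k))) in I.
        2:{ rewrite (inner_conj (s k) v). rewrite <- (Cconj_conj t) at 1. rewrite <- Cmult_conj, re_conj. auto. }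
        replace (t * (l2_inner v (s k) - a)) with (t * l2_inner v (s k) - t * a) by ring.
        unfold Cminus. rewrite re_plus, re_opp. lra. }
      apply Rnot_lt_le. intros L.
      set (X := (2 * Re (t * (l2_inner v u - a)) + Cmod t ^ 2 * sqnorm v)%R) in *.
      destruct (Hsmall (- X / 4)%R) as [N HN]; [lra|].
      pose proof (clim_scal t _ _ (inner_lim s u v Sl2 Hu Hv2 Lu)) as CL.
      destruct (CL (- X / 8)%R) as [N' HN']; [lra|].
      specialize (HN (N + N')%nat ltac:(lia)). specialize (HN' (N + N')%nat ltac:(lia)). specialize (Q (N + N')%nat).
      set (k := (N + N')%nat) in *.
      replace (t * (l2_inner v (s k) - a)) with (t * (l2_inner v u - a) + (t * l2_inner v (s k) - t * l2_inner v u)) in Q by ring.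
      rewrite re_plus in Q.
      pose proof (re_le_Cmod (t * l2_inner v (s k) - t * l2_inner v u)).
      pose proof (Rle_abs (Re (t * l2_inner v (s k) - t * l2_inner v u))). unfold X in *. lra. }
    replace (l2_inner v u) with (l2_inner v u - a + a) by ring. rewrite B. ring. }
  exists u. split; [auto|split;[|split;[auto|]]].
  (* the bound |<s_k, u>| <= M |s_k| passes to the limit *)
  - apply Rnot_lt_le. intros L. pose proof (l2_norm_pos u) as Pu. set (nu := l2_norm u) in *.
    set (e := ((nu - M) / 2)%R).
    destruct (Lu (e / 2)%R) as [N HN]; [unfold e; lra|]. specialize (HN N (le_n _)).
    assert (T1 : (l2_norm (s N) <= nu + e / 2)%R).
    { replace (s N) with (vadd (vsub (s N) u) u).
      2:{ vec_ring. }
      eapply Rle_trans; [apply l2_norm_add; auto with l2|]. fold nu. lra. }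
    destruct (Hp N) as [GN _]. fold (s N) (al N) in GN.
    pose proof (HB _ _ GN) as BN. rewrite <- (Rep _ _ GN) in BN.
    pose proof (Cauchy_Schwarz (vsub (s N) u) u (l2_sub _ _ (Sl2 N) Hu) Hu) as CS. fold nu in CS.
    rewrite inner_sub_l in CS by auto.
    assert (SQ : (nu * nu <= Cmod (l2_inner (s N) u - l2_inner u u) + Cmod (l2_inner (s N) u))%R).
    { unfold nu. rewrite l2_norm_sq by auto. rewrite Cmod_minus_sym.
      eapply Rle_trans; [|apply Cmod_triangle]. 
      replace (l2_inner u u - l2_inner (s N) u + l2_inner (s N) u) with (l2_inner u u) by ring.
      rewrite inner_self, Cmod_R. apply Rle_abs. }
    assert (M * l2_norm (s N) <= M * (nu + e/2))%R by (apply Rmult_le_compat_l; auto).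
    assert (l2_norm (vsub (s N) u) * nu <= e / 2 * nu)%R by (apply Rmult_le_compat_r; auto).
    unfold e in *. assert (M < nu)%R by lra. assert (0 < nu)%R by lra.
    assert (nu * nu <= (nu - M)/4 * nu + M * nu + M * ((nu - M)/4))%R by nra.
    assert (M * ((nu - M)/4) <= nu * ((nu-M)/4))%R by (apply Rmult_le_compat_r; lra). nra.
  - exists s. split; auto. intros k. exists (al k). apply Hp.
Qed.

(** * Operators and square roots *)

Definition lin_op (A : op) : Prop :=
  (forall u, l2 u -> l2 (A u)) /\
  (forall u v, l2 u -> l2 v -> A (vadd u v) = vadd (A u) (A v)) /\
  (forall c u, l2 u -> A (vscal c u) = vscal c (A u)).

Definition op_bound (A : op) (M : R) : Prop := forall u, l2 u -> (l2_norm (A u) <= M * l2_norm u)%R.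

Lemma bounded_op_iff A : bounded_op A <-> lin_op A /\ exists M, op_bound A M.
Proof.
  split.
  - intros (h1 & h2 & h3 & h4). repeat split; auto; intros; funext n.
    + apply h2; auto.
    + apply h3; auto.
  - intros ((h1 & h2 & h3) & h4). repeat split; auto.
    + intros u v hu hv n. exact (f_equal (fun w => w n) (h2 u v hu hv)).
    + intros c u hu n. exact (f_equal (fun w => w n) (h3 c u hu)).
Qed.

Lemma lin_sub A u v : lin_op A -> l2 u -> l2 v -> A (vsub u v) = vsub (A u) (A v).
Proof. intros (h1 & h2 & h3) U V. rewrite !vsub_eq, h2, h3; auto with l2. Qed.

Lemma lin_zero A : lin_op A -> A vzero = vzero.
Proof.
  intros (h1 & h2 & h3). replace vzero with (vscal 0 vzero) at 1.
  - rewrite h3 by auto with l2. vec_ring.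
  - vec_ring.
Qed.

Lemma l2_norm_zero u : l2 u -> (l2_norm u <= 0)%R -> u = vzero.
Proof.
  intros U H. apply sqnorm_zero; auto. rewrite <- l2_norm_sq by auto. pose proof (l2_norm_pos u).
  assert (l2_norm u = 0%R) by lra. rewrite H1; lra.
Qed.

Lemma op_bound_ge A M : op_bound A M -> exists M', (0 < M')%R /\ op_bound A M'.
Proof.
  intros H. exists (Rabs M + 1)%R. pose proof (Rabs_pos M). pose proof (Rle_abs M). split; [lra|].
  intros u U. specialize (H u U). pose proof (l2_norm_pos u). nra.
Qed.

(** Subtracting from [f] the representative of [<., f>] over the kernel leaves the component
    orthogonal to the kernel. *)
Lemma perp_ker_component A f : bounded_op A -> l2 f -> exists g, perp_ker A g /\ A g = A f.
Proof.
  intros HA F. apply bounded_op_iff in HA. destruct HA as [HL [M0 HM0]].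
  destruct (op_bound_ge _ _ HM0) as [M [M1 HM]]. pose proof HL as (h1 & h2 & h3).
  destruct (Riesz_relation (fun v a => l2 v /\ A v = vzero /\ a = l2_inner v f) (l2_norm f)) as [u [Hu [_ [Hrep [s [Hs Ls]]]]]].
  - apply l2_norm_pos.
  - exists vzero, (l2_inner vzero f). repeat split; auto with l2. apply lin_zero; auto.
  - tauto.
  - intros v a w b t (v1 & v2 & ->) (w1 & w2 & ->). repeat split; auto with l2.
    + rewrite h2, h3, v2, w2 by auto with l2. vec_ring.
    + rewrite inner_add_l, inner_scal_l; auto with l2.
  - intros v a (v1 & v2 & ->). rewrite Rmult_comm. apply Cauchy_Schwarz; auto.
  - assert (Au : A u = vzero).
    { apply l2_norm_zero; auto. apply Rnot_lt_le. intros L.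
      destruct (Ls (l2_norm (A u) / (2 * M))%R) as [N HN]. { apply Rdiv_lt_0_compat; lra. }
      specialize (HN N (le_n _)). destruct (Hs N) as [a (s1 & s2 & _)].
      pose proof (HM (vsub (s N) u) ltac:(auto with l2)) as B. rewrite lin_sub, s2 in B by auto.
      replace (vsub vzero (A u)) with (vscal (-1) (A u)) in B.
      2:{ vec_ring. }
      rewrite l2_norm_scal in B by auto. replace (Cmod (-1)) with 1%R in B.
      2:{ rewrite <- Cmod_m1. f_equal. ring. }
      assert (M * l2_norm (vsub (s N) u) <= M * (l2_norm (A u) / (2 * M)))%R by (apply Rmult_le_compat_l; lra).
      replace (M * (l2_norm (A u) / (2 * M)))%R with (l2_norm (A u) / 2)%R in H by (field; lra). lra. }
    exists (vsub f u). split.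
    + split; auto with l2. intros g Hg Ag. rewrite inner_conj, inner_sub_r by auto.
      rewrite (Hrep g (l2_inner g f)).
      * replace (l2_inner g f - l2_inner g f) with (RtoC 0) by ring. apply Cconj_R.
      * repeat split; auto. apply functional_extensionality; exact Ag.
    + rewrite lin_sub, Au by auto. vec_ring.
Qed.

(** Polarization: the quadratic form at [u + v] and [u + i v] is real. *)
Lemma positive_op_sym A u v : positive_op A -> l2 u -> l2 v -> l2_inner (A u) v = l2_inner u (A v).
Proof.
  intros [HB HP] U V. apply bounded_op_iff in HB. destruct HB as [(h1 & h2 & h3) _].
  pose proof (proj1 (HP _ U)) as P1. pose proof (proj1 (HP _ V)) as P2.
  pose proof (proj1 (HP (vadd u v) ltac:(auto with l2))) as P3.
  pose proof (proj1 (HP (vadd u (vscal Ci v)) ltac:(auto with l2))) as P4.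
  rewrite h2, inner_add_l, !inner_add_r in P3 by auto with l2.
  rewrite h2, h3, inner_add_l, !inner_add_r, !inner_scal_l, !inner_scal_r in P4 by auto with l2.
  rewrite (inner_conj (A v) u).
  set (x := l2_inner (A u) v) in *. set (y := l2_inner (A v) u) in *.
  set (p := l2_inner (A u) u) in *. set (q := l2_inner (A v) v) in *.
  clearbody x y p q. destruct x, y, p, q; simpl in *. apply Ceq; simpl; lra.
Qed.


(** For a symmetric contraction [T] the scheme [Y_0 = 0], [Y_(n+1) = (T + Y_n^2) / 2] converges to a
    solution of [2 Y = T + Y^2], so that [I - Y] is a square root of [I - T].  Everything is
    controlled by the same recursion for numbers, with [T = 1]. *)
Section SquareRoot.
Variable T : op.
Hypothesis T_lin : lin_op T.
Hypothesis T_bound : op_bound T 1.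
Hypothesis T_sym : forall u v, l2 u -> l2 v -> l2_inner (T u) v = l2_inner u (T v).

Fixpoint sqrt_iter (n : nat) : op :=
  match n with
  | O => fun _ => vzero
  | S m => fun u => vscal (/2)%R (vadd (T u) (sqrt_iter m (sqrt_iter m u)))
  end.

Fixpoint sqrt_bound (n : nat) : R :=
  match n with
  | O => 0
  | S m => (1 + sqrt_bound m * sqrt_bound m) / 2
  end.

Lemma sqrt_iter_lin n : lin_op (sqrt_iter n).
Proof.
  destruct T_lin as (s1 & s2 & s3).
  induction n as [|n (i1 & i2 & i3)]; simpl.
  - repeat split; auto with l2; vec_ring.
  - repeat split.
    + intros; auto with l2.
    + intros u v U V. rewrite s2, i2, i2 by auto.
      vec_ring.
    + intros c u U. rewrite s3, i3, i3 by auto.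
      vec_ring.
Qed.

Lemma sqrt_iter_l2 n u : l2 u -> l2 (sqrt_iter n u).
Proof. apply sqrt_iter_lin. Qed.

Lemma T_l2 u : l2 u -> l2 (T u).
Proof. apply T_lin. Qed.

#[local] Hint Resolve sqrt_iter_l2 T_l2 : l2.

Lemma sqrt_bound_range n : (0 <= sqrt_bound n <= 1)%R.
Proof. induction n; simpl; nra. Qed.

Lemma sqrt_bound_incr n : (sqrt_bound n <= sqrt_bound (S n))%R.
Proof. simpl. pose proof (Rle_0_sqr (1 - sqrt_bound n)). unfold Rsqr in H. lra. Qed.

Lemma sqrt_bound_mono n m : (n <= m)%nat -> (sqrt_bound n <= sqrt_bound m)%R.
Proof. induction 1; [lra|]. pose proof (sqrt_bound_incr m). lra. Qed.

Lemma l2_norm_half u : l2 u -> l2_norm (vscal (/2)%R u) = (l2_norm u / 2)%R.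
Proof. intros U. rewrite l2_norm_scal, Cmod_R, Rabs_pos_eq by (auto; lra). field. Qed.

Lemma sqrt_iter_bound n : op_bound (sqrt_iter n) (sqrt_bound n).
Proof.
  induction n; intros u U; simpl.
  - replace (l2_norm vzero) with 0%R; [lra|]. symmetry. apply Rle_antisym; [|apply l2_norm_pos].
    apply l2_norm_le; [auto with l2|lra|]. unfold sqnorm, vzero.
    rewrite (Series_ext _ (fun n => 0 * 0)%R), Series_scal_l. lra.
    intros; rewrite Cmod_0; ring.
  - rewrite l2_norm_half by auto with l2.
    pose proof (l2_norm_add (T u) (sqrt_iter n (sqrt_iter n u)) ltac:(auto with l2) ltac:(auto with l2)).
    pose proof (T_bound u U). pose proof (IHn u U). pose proof (IHn (sqrt_iter n u) ltac:(auto with l2)).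
    pose proof (sqrt_bound_range n). pose proof (l2_norm_pos u).
    assert (sqrt_bound n * l2_norm (sqrt_iter n u) <= sqrt_bound n * (sqrt_bound n * l2_norm u))%R
      by (apply Rmult_le_compat_l; lra). nra.
Qed.

(** Since [Y_m^2 - Y_n^2 = Y_m (Y_m - Y_n) + (Y_m - Y_n) Y_n], the increments of the numerical
    recursion dominate those of the operators; the former is increasing and bounded by 1, whence
    convergence in norm. *)
Lemma sqrt_iter_diff n m u : (n <= m)%nat -> l2 u ->
  (l2_norm (vsub (sqrt_iter m u) (sqrt_iter n u)) <= (sqrt_bound m - sqrt_bound n) * l2_norm u)%R.
Proof.
  revert m u. induction n; intros m u L U.
  - replace (vsub (sqrt_iter m u) (sqrt_iter 0 u)) with (sqrt_iter m u).
    + simpl sqrt_bound at 2. rewrite Rminus_0_r. apply sqrt_iter_bound; auto.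
    + funext k; unfold vsub; simpl; unfold vzero; ring.
  - destruct m as [|m]; [lia|]. apply le_S_n in L.
    pose proof (sqrt_iter_lin m) as Lm.
    replace (vsub (sqrt_iter (S m) u) (sqrt_iter (S n) u)) with
      (vscal (/2)%R (vadd (sqrt_iter m (vsub (sqrt_iter m u) (sqrt_iter n u)))
                          (vsub (sqrt_iter m (sqrt_iter n u)) (sqrt_iter n (sqrt_iter n u))))).
    2:{ rewrite (lin_sub (sqrt_iter m)) by auto with l2. simpl.
        vec_ring. }
    rewrite l2_norm_half by auto with l2.
    pose proof (l2_norm_add (sqrt_iter m (vsub (sqrt_iter m u) (sqrt_iter n u)))
       (vsub (sqrt_iter m (sqrt_iter n u)) (sqrt_iter n (sqrt_iter n u))) ltac:(auto with l2) ltac:(auto with l2)) as H.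
    pose proof (IHn m u L U) as H1. pose proof (IHn m (sqrt_iter n u) L ltac:(auto with l2)) as H2.
    pose proof (sqrt_iter_bound m (vsub (sqrt_iter m u) (sqrt_iter n u)) ltac:(auto with l2)) as H3.
    pose proof (sqrt_iter_bound n u U) as H4.
    pose proof (sqrt_bound_range n). pose proof (sqrt_bound_range m). pose proof (sqrt_bound_mono n m L).
    simpl. set (a := sqrt_bound n) in *. set (b := sqrt_bound m) in *. pose proof (l2_norm_pos u).
    assert (b * l2_norm (vsub (sqrt_iter m u) (sqrt_iter n u)) <= b * ((b - a) * l2_norm u))%R by (apply Rmult_le_compat_l; lra).
    assert ((b - a) * l2_norm (sqrt_iter n u) <= (b - a) * (a * l2_norm u))%R by (apply Rmult_le_compat_l; lra).
    nra.
Qed.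

Lemma sqrt_bound_cauchy e : (0 < e)%R -> exists N, forall n m, (N <= n)%nat -> (n <= m)%nat -> (sqrt_bound m - sqrt_bound n <= e)%R.
Proof.
  intros He.
  destruct (ex_finite_lim_seq_incr sqrt_bound 1 sqrt_bound_incr) as [l Hl]. { intros n; apply sqrt_bound_range. }
  apply is_lim_seq_spec in Hl. destruct (Hl (mkposreal (e/2) ltac:(lra))) as [N HN]. exists N. intros n m h1 h2.
  pose proof (HN n h1) as a1. pose proof (HN m ltac:(lia)) as a2. simpl in a1, a2.
  apply Rabs_def2 in a1. apply Rabs_def2 in a2. lra.
Qed.

Lemma sqrt_iter_limit u : l2 u -> exists w, l2 w /\ l2lim (fun n => sqrt_iter n u) w.
Proof.
  intros U. apply l2_complete; auto with l2. intros e He.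
  pose proof (l2_norm_pos u).
  destruct (sqrt_bound_cauchy (e / (l2_norm u + 1))%R) as [N HN]. { apply Rdiv_lt_0_compat; lra. }
  assert (K : forall n m, (N <= n)%nat -> (n <= m)%nat -> (l2_norm (vsub (sqrt_iter m u) (sqrt_iter n u)) <= e)%R).
  { intros n m h1 h2. eapply Rle_trans; [apply sqrt_iter_diff; auto|]. specialize (HN n m h1 h2).
    apply Rle_trans with ((e / (l2_norm u + 1)) * (l2_norm u + 1))%R.
    - pose proof (sqrt_bound_mono n m h2). apply Rmult_le_compat; lra.
    - right; field; lra. }
  exists N. intros n m Hn Hm. destruct (Nat.le_ge_cases n m) as [h|h].
  - replace (vsub (sqrt_iter n u) (sqrt_iter m u)) with (vscal (-1) (vsub (sqrt_iter m u) (sqrt_iter n u))).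
    2:{ vec_ring. }
    rewrite l2_norm_scal by auto with l2. replace (Cmod (-1)) with 1%R.
    2:{ rewrite <- Cmod_m1. f_equal. ring. } rewrite Rmult_1_l. auto.
  - auto.
Qed.

Lemma l2lim_coord s u : (forall k, l2 (s k)) -> l2 u -> l2lim s u -> forall n, clim (fun k => s k n) (u n).
Proof.
  intros Hs Hu L n e He. destruct (L e He) as [N HN]. exists N. intros k Hk.
  eapply Rle_trans; [|apply (HN k Hk)]. apply (l2_norm_coord (vsub (s k) u) n). auto with l2.
Qed.

Lemma l2lim_le s u M : (forall k, l2 (s k)) -> l2 u -> l2lim s u -> (forall k, (l2_norm (s k) <= M)%R) -> (l2_norm u <= M)%R.
Proof.
  intros Hs Hu L B. apply (l2_Fatou s u M).
  - exists 0%nat. auto.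
  - apply l2lim_coord; auto.
Qed.

Definition sqrt_lim : op := fun u => epsilon (inhabits vzero) (fun w => l2 w /\ l2lim (fun n => sqrt_iter n u) w).

Lemma sqrt_lim_spec u : l2 u -> l2 (sqrt_lim u) /\ l2lim (fun n => sqrt_iter n u) (sqrt_lim u).
Proof. intros U. unfold sqrt_lim. apply epsilon_spec. apply sqrt_iter_limit; auto. Qed.

Lemma sqrt_lim_l2 u : l2 u -> l2 (sqrt_lim u).
Proof. intros; apply sqrt_lim_spec; auto. Qed.

#[local] Hint Resolve sqrt_lim_l2 : l2.

Lemma sqrt_lim_coord u n : l2 u -> clim (fun k => sqrt_iter k u n) (sqrt_lim u n).
Proof. intros U. apply (l2lim_coord (fun k => sqrt_iter k u)); auto with l2. apply sqrt_lim_spec; auto. Qed.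

Lemma sqrt_lim_lin : lin_op sqrt_lim.
Proof.
  repeat split; auto with l2.
  - intros u v U V. funext n.
    apply (clim_unique (fun k => sqrt_iter k (vadd u v) n)). { apply sqrt_lim_coord; auto with l2. }
    unfold vadd at 2. 
    replace (fun k => sqrt_iter k (vadd u v) n) with (fun k => sqrt_iter k u n + sqrt_iter k v n).
    + apply clim_plus; apply sqrt_lim_coord; auto.
    + funext k. destruct (sqrt_iter_lin k) as (_ & i2 & _). rewrite i2; auto.
  - intros c u U. funext n.
    apply (clim_unique (fun k => sqrt_iter k (vscal c u) n)). { apply sqrt_lim_coord; auto with l2. }
    unfold vscal at 2. 
    replace (fun k => sqrt_iter k (vscal c u) n) with (fun k => c * sqrt_iter k u n).
    + apply clim_scal; apply sqrt_lim_coord; auto.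
    + funext k. destruct (sqrt_iter_lin k) as (_ & _ & i3). rewrite i3; auto.
Qed.

Lemma sqrt_lim_bound : op_bound sqrt_lim 1.
Proof.
  intros u U. apply (l2lim_le (fun n => sqrt_iter n u)); auto with l2. { apply sqrt_lim_spec; auto. }
  intros k. eapply Rle_trans; [apply sqrt_iter_bound; auto|]. pose proof (sqrt_bound_range k). pose proof (l2_norm_pos u). nra.
Qed.

Lemma sqrt_lim_eq u : l2 u -> vscal 2 (sqrt_lim u) = vadd (T u) (sqrt_lim (sqrt_lim u)).
Proof.
  intros U. pose proof (sqrt_lim_spec u U) as [_ L1]. pose proof (sqrt_lim_spec (sqrt_lim u) ltac:(auto with l2)) as [_ L2].
  assert (L : l2lim (fun n => sqrt_iter n (sqrt_iter n u)) (sqrt_lim (sqrt_lim u))).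
  { intros e He. destruct (L1 (e/2)%R) as [N HN]; [lra|]. destruct (L2 (e/2)%R) as [M HM]; [lra|].
    exists (N + M)%nat. intros k Hk. specialize (HN k ltac:(lia)). specialize (HM k ltac:(lia)). simpl in HN, HM.
    replace (vsub (sqrt_iter k (sqrt_iter k u)) (sqrt_lim (sqrt_lim u))) with
      (vadd (sqrt_iter k (vsub (sqrt_iter k u) (sqrt_lim u))) (vsub (sqrt_iter k (sqrt_lim u)) (sqrt_lim (sqrt_lim u)))).
    2:{ rewrite (lin_sub (sqrt_iter k)) by (auto using sqrt_iter_lin with l2). vec_ring. }
    eapply Rle_trans; [apply l2_norm_add; auto with l2|].
    pose proof (sqrt_iter_bound k (vsub (sqrt_iter k u) (sqrt_lim u)) ltac:(auto with l2)).
    pose proof (sqrt_bound_range k). pose proof (l2_norm_pos (vsub (sqrt_iter k u) (sqrt_lim u))). nra. }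
  funext n.
  pose proof (l2lim_coord (fun k => sqrt_iter k (sqrt_iter k u)) (sqrt_lim (sqrt_lim u)) ltac:(intros; simpl; auto with l2) ltac:(auto with l2) L n) as C1. simpl in C1.
  pose proof (clim_plus _ _ _ _ (clim_const (T u n)) C1) as C2.
  pose proof (clim_scal 2 _ _ (sqrt_lim_coord u n U)) as C3.
  unfold vscal, vadd.
  apply (clim_unique (fun k => 2 * sqrt_iter (S k) u n)).
  - intros e He. destruct (C3 e He) as [N HN]. exists N. intros k Hk. apply HN; lia.
  - replace (fun k => 2 * sqrt_iter (S k) u n) with (fun k => T u n + sqrt_iter k (sqrt_iter k u) n); auto.
    funext k. simpl. unfold vscal, vadd.
    assert (H : 2 * RtoC (/2) = 1). { apply Ceq; simpl; field. } rewrite Cmult_assoc, H. ring.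
Qed.

Lemma sqrt_iter_sym k u v : l2 u -> l2 v -> l2_inner (sqrt_iter k u) v = l2_inner u (sqrt_iter k v).
Proof.
  revert u v. induction k; intros u v U V; simpl.
  - rewrite (inner_conj vzero u). unfold l2_inner. rewrite (CSeries_ext (fun n => vzero n * Cconj (v n)) (fun _ => 0)).
    rewrite (CSeries_ext (fun n => vzero n * Cconj (u n)) (fun _ => 0)). rewrite CSeries_0, Cconj_R; auto.
    intros; unfold vzero; ring. intros; unfold vzero; ring.
  - rewrite inner_scal_l, inner_scal_r, Cconj_R, inner_add_l, inner_add_r, T_sym, IHk, IHk; auto with l2.
Qed.

Lemma sqrt_lim_real u : l2 u -> Im (l2_inner (sqrt_lim u) u) = 0%R.
Proof.
  intros U. assert (H : l2_inner u (sqrt_lim u) = l2_inner (sqrt_lim u) u).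
  { apply (clim_unique (fun k => l2_inner u (sqrt_iter k u))).
    - apply (inner_lim (fun k => sqrt_iter k u)); auto with l2. apply sqrt_lim_spec; auto.
    - pose proof (inner_lim (fun k => sqrt_iter k u) (sqrt_lim u) u ltac:(intros; simpl; auto with l2) ltac:(auto with l2) U (proj2 (sqrt_lim_spec u U))) as L.
      intros e He. destruct (L e He) as [N HN]. exists N. intros k Hk. specialize (HN k Hk). simpl in HN.
      rewrite <- sqrt_iter_sym, (inner_conj u (sqrt_iter k u)), (inner_conj u (sqrt_lim u)), <- Cminus_conj, Cmod_conj by auto. auto. }
  rewrite (inner_conj (sqrt_lim u) u) in H. apply (f_equal Im) in H. rewrite im_conj in H. lra.
Qed.

(** [I - Y] is positive because [|<Y u, u>| <= |u|^2]. *)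
Lemma sqrt_exists : exists A, positive_op A /\ forall u, l2 u -> A (A u) = vsub u (T u).
Proof.
  exists (fun u => vsub u (sqrt_lim u)). destruct sqrt_lim_lin as (y1 & y2 & y3). split.
  - split.
    + apply bounded_op_iff. split; [repeat split|].
      * auto with l2.
      * intros u v U V. rewrite y2 by auto. vec_ring.
      * intros c u U. rewrite y3 by auto. vec_ring.
      * exists 2%R. intros u U. pose proof (l2_norm_sub u (sqrt_lim u) U ltac:(auto with l2)). pose proof (sqrt_lim_bound u U). lra.
    + intros u U. rewrite inner_sub_l, inner_self by auto with l2. unfold Cminus. rewrite im_plus, re_plus, re_opp, re_RtoC.
      split.
      * pose proof (sqrt_lim_real u U). simpl in *. lra.
      * pose proof (Cauchy_Schwarz (sqrt_lim u) u ltac:(auto with l2) U). pose proof (re_le_Cmod (l2_inner (sqrt_lim u) u)).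
        pose proof (Rle_abs (Re (l2_inner (sqrt_lim u) u))). pose proof (sqrt_lim_bound u U). pose proof (l2_norm_pos u).
        rewrite <- l2_norm_sq by auto. nra.
  - intros u U. rewrite (lin_sub sqrt_lim) by (auto using sqrt_lim_lin with l2).
    pose proof (sqrt_lim_eq u U) as E. funext n. apply (f_equal (fun w => w n)) in E.
    unfold vscal, vadd in E. unfold vsub.
    replace (T u n) with (2 * sqrt_lim u n - sqrt_lim (sqrt_lim u) n) by (rewrite E; ring). ring.
Qed.
End SquareRoot.

(** * Goursat's theorem on rectangles *)
Open Scope R_scope.

Lemma half_pow_pos k : 0 < (/2) ^ k.
Proof. apply pow_lt; lra. Qed.

Lemma half_pow_small d : 0 < d -> exists k, (/2) ^ k < d.
Proof.
  intros H. destruct (pow_lt_1_zero (/2) ltac:(rewrite Rabs_pos_eq; lra) d H) as [N HN].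
  exists N. specialize (HN N (le_n _)). rewrite Rabs_pos_eq in HN; auto. left; apply half_pow_pos.
Qed.

Lemma nested_intervals (x l : nat -> R) : (forall k, 0 <= l k) ->
  (forall k, x k <= x (S k)) -> (forall k, x (S k) + l (S k) <= x k + l k) ->
  exists p, forall k, x k <= p <= x k + l k.
Proof.
  intros H0 H1 H2.
  assert (M1 : forall k m, (k <= m)%nat -> x k <= x m).
  { intros k m h; induction h; [lra|]. specialize (H1 m); lra. }
  assert (M2 : forall k m, (k <= m)%nat -> x m + l m <= x k + l k).
  { intros k m h; induction h; [lra|]. specialize (H2 m); lra. }
  assert (B : forall k m, x m <= x k + l k).
  { intros k m. destruct (Nat.le_ge_cases k m) as [h|h].
    - specialize (M2 k m h). specialize (H0 m). lra.
    - specialize (M1 m k h). specialize (H0 k). lra. }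
  destruct (completeness (fun y => exists k, y = x k)) as [p [P1 P2]].
  - exists (x 0%nat + l 0%nat). intros y [k ->]. apply B.
  - exists (x 0%nat), 0%nat. auto.
  - exists p. intros k. split; [apply P1; eauto|]. apply P2. intros y [m ->]. apply B.
Qed.

(** Bisection induction over the subrectangles [x, x + s L] * [y, y + s M]. *)
Section Bisection.
Variables (a c L M : R) (good : R -> R -> R -> Prop).
Hypothesis L0 : 0 <= L.
Hypothesis M0 : 0 <= M.
Hypothesis good_split : forall x y s, 0 < s ->
  good x y (s/2) -> good (x + s/2*L) y (s/2) -> good x (y + s/2*M) (s/2) -> good (x + s/2*L) (y + s/2*M) (s/2) ->
  good x y s.

Lemma bad_quarter x y s : 0 < s -> ~ good x y s -> exists p : R * R,
  (x <= fst p <= x + s/2*L) /\ (y <= snd p <= y + s/2*M) /\ ~ good (fst p) (snd p) (s/2).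
Proof.
  intros Hs B. apply NNPP. intros N. apply B.
  assert (0 <= s/2*L) by (apply Rmult_le_pos; lra). assert (0 <= s/2*M) by (apply Rmult_le_pos; lra).
  apply good_split; auto; apply NNPP; intros G; apply N.
  - exists (x, y); simpl; repeat split; auto; lra.
  - exists (x + s/2*L, y); simpl; repeat split; auto; lra.
  - exists (x, y + s/2*M); simpl; repeat split; auto; lra.
  - exists (x + s/2*L, y + s/2*M); simpl; repeat split; auto; lra.
Qed.

Fixpoint bad_corner (k : nat) : R * R :=
  match k with
  | O => (a, c)
  | S m => let q := bad_corner m in
      epsilon (inhabits q) (fun p =>
        (fst q <= fst p <= fst q + (/2)^m/2*L) /\ (snd q <= snd p <= snd q + (/2)^m/2*M) /\ ~ good (fst p) (snd p) ((/2)^m/2))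
  end.

Lemma bisection_induction :
  (forall x0 y0, a <= x0 <= a + L -> c <= y0 <= c + M -> exists d, 0 < d /\
     forall x y s, 0 < s < d -> x <= x0 <= x + s*L -> y <= y0 <= y + s*M -> good x y s) ->
  good a c 1.
Proof.
  intros Loc. apply NNPP. intros B0.
  assert (B : forall k, ~ good (fst (bad_corner k)) (snd (bad_corner k)) ((/2)^k)).
  { induction k; simpl; auto.
    replace (/2 * (/2)^k) with ((/2)^k/2) by field.
    exact (proj2 (proj2 (epsilon_spec (inhabits (bad_corner k)) _ (bad_quarter _ _ _ (half_pow_pos k) IHk)))). }
  assert (St : forall k, let q := bad_corner k in let p := bad_corner (S k) in
     (fst q <= fst p <= fst q + (/2)^k/2*L) /\ (snd q <= snd p <= snd q + (/2)^k/2*M)).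
  { intros k q p. destruct (epsilon_spec (inhabits (bad_corner k)) _ (bad_quarter _ _ _ (half_pow_pos k) (B k))) as (h1 & h2 & _).
    exact (conj h1 h2). }
  assert (D : forall k X, (/2)^(S k) * X = (/2)^k/2*X) by (intros; simpl; field).
  destruct (nested_intervals (fun k => fst (bad_corner k)) (fun k => (/2)^k*L)) as [x0 Hx0].
  { intros k. apply Rmult_le_pos; auto. left; apply half_pow_pos. }
  { intros k. apply (St k). }
  { intros k. destruct (St k) as [h _]. rewrite D. pose proof (D k L). simpl in *. lra. }
  destruct (nested_intervals (fun k => snd (bad_corner k)) (fun k => (/2)^k*M)) as [y0 Hy0].
  { intros k. apply Rmult_le_pos; auto. left; apply half_pow_pos. }
  { intros k. apply (St k). }
  { intros k. destruct (St k) as [_ h]. rewrite D. simpl in *. lra. }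
  destruct (Loc x0 y0) as [d [Hd HL]].
  { specialize (Hx0 0%nat). simpl in Hx0. lra. }
  { specialize (Hy0 0%nat). simpl in Hy0. lra. }
  destruct (half_pow_small d Hd) as [k Hk]. apply (B k). apply HL; auto. split; auto. apply half_pow_pos.
Qed.
End Bisection.

(** Total differentiability at one point, with partial derivatives [px], [py]; their continuity is
    not part of it, as complex differentiability does not provide it. *)
Definition diff2 (P : R -> R -> R) (x0 y0 px py : R) : Prop :=
  forall e, 0 < e -> exists d, 0 < d /\ forall x y, Rabs (x - x0) < d -> Rabs (y - y0) < d ->
    Rabs (P x y - P x0 y0 - px * (x - x0) - py * (y - y0)) <= e * (Rabs (x - x0) + Rabs (y - y0)).

Lemma continuous_eps (f : R -> R) x :
  (forall e, 0 < e -> exists d, 0 < d /\ forall y, Rabs (y - x) < d -> Rabs (f y - f x) < e) -> continuous f x.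
Proof.
  intros H P [e He]. destruct (H e (cond_pos e)) as [d [Hd Hd']].
  exists (mkposreal d Hd). intros y Hy. apply He. apply Hd'. exact Hy.
Qed.

Lemma continuous_eps_inv (f : R -> R) x : continuous f x -> 
  forall e, 0 < e -> exists d, 0 < d /\ forall y, Rabs (y - x) < d -> Rabs (f y - f x) < e.
Proof.
  intros H e He. destruct (H (fun y => Rabs (y - f x) < e)) as [d Hd].
  - exists (mkposreal e He). intros y Hy. exact Hy.
  - exists d. split; [apply cond_pos|]. intros y Hy. apply (Hd y). exact Hy.
Qed.

Lemma diff2_small P x0 y0 px py e : 0 < e -> diff2 P x0 y0 px py ->
  exists d, 0 < d /\ forall x y, Rabs (x - x0) < d -> Rabs (y - y0) < d -> Rabs (P x y - P x0 y0) < e.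
Proof.
  intros He H. destruct (H 1 ltac:(lra)) as [d [Hd Hd']].
  pose proof (Rabs_pos px). pose proof (Rabs_pos py).
  set (K := Rabs px + Rabs py + 2). assert (0 < K) by (unfold K; lra).
  exists (Rmin d (e / (2*K))). split. { apply Rmin_pos; auto. apply Rdiv_lt_0_compat; lra. }
  intros x y hx hy.
  pose proof (Rmin_l d (e / (2*K))). pose proof (Rmin_r d (e / (2*K))).
  specialize (Hd' x y ltac:(lra) ltac:(lra)).
  pose proof (Rabs_pos (x - x0)). pose proof (Rabs_pos (y - y0)).
  assert (Rabs (P x y - P x0 y0) <= Rabs (P x y - P x0 y0 - px * (x - x0) - py * (y - y0)) + (Rabs px * Rabs (x - x0) + Rabs py * Rabs (y - y0))).
  { rewrite <- !Rabs_mult. 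
    replace (P x y - P x0 y0) with ((P x y - P x0 y0 - px * (x - x0) - py * (y - y0)) + (px * (x - x0) + py * (y - y0))) at 1 by ring.
    eapply Rle_trans; [apply Rabs_triang|]. apply Rplus_le_compat_l. apply Rabs_triang. }
  assert (Rabs (x - x0) < e / (2 * K)) by lra. assert (Rabs (y - y0) < e / (2 * K)) by lra.
  assert (Rabs (P x y - P x0 y0) <= K * (Rabs (x - x0) + Rabs (y - y0))).
  { unfold K. nra. }
  assert (K * (e / (2*K) + e / (2*K)) = e) by (field; lra).
  assert (K * (Rabs (x - x0) + Rabs (y - y0)) < K * (e / (2*K) + e / (2*K))) by (apply Rmult_lt_compat_l; lra).
  lra.
Qed.

Lemma diff2_continuous_l P x0 y0 px py : diff2 P x0 y0 px py -> continuous (fun x => P x y0) x0.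
Proof.
  intros H. apply continuous_eps. intros e He. destruct (diff2_small _ _ _ _ _ e He H) as [d [Hd K]].
  exists d. split; auto. intros y Hy. apply K; auto. rewrite Rminus_diag, Rabs_R0. auto.
Qed.

Lemma diff2_continuous_r P x0 y0 px py : diff2 P x0 y0 px py -> continuous (fun y => P x0 y) y0.
Proof.
  intros H. apply continuous_eps. intros e He. destruct (diff2_small _ _ _ _ _ e He H) as [d [Hd K]].
  exists d. split; auto. intros y Hy. apply K; auto. rewrite Rminus_diag, Rabs_R0. auto.
Qed.

Lemma RInt_near_const (f : R -> R) a b k e : a <= b -> ex_RInt f a b ->
  (forall x, a <= x <= b -> Rabs (f x - k) <= e) -> Rabs (RInt f a b - k * (b - a)) <= e * (b - a).
Proof.
  intros ab E H. apply Rabs_le.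
  assert (C : forall c, RInt (fun _ => c) a b = c * (b - a)).
  { intros c. rewrite RInt_const. unfold scal; simpl; unfold mult; simpl. ring. }
  assert (RInt f a b <= RInt (fun _ => k + e) a b).
  { apply RInt_le; auto. apply ex_RInt_const. intros x hx. specialize (H x ltac:(lra)). apply Rabs_le_between in H. lra. }
  assert (RInt (fun _ => k - e) a b <= RInt f a b).
  { apply RInt_le; auto. apply ex_RInt_const. intros x hx. specialize (H x ltac:(lra)). apply Rabs_le_between in H. lra. }
  rewrite C in *. lra.
Qed.

Definition circulation (P Q : R -> R -> R) (a a' c c' : R) : R :=
  RInt (fun x => P x c - P x c') a a' + RInt (fun y => Q a' y - Q a y) c c'.

Section Goursat.
Variables (P Q : R -> R -> R) (a a' c c' : R).
Hypothesis aa : a <= a'.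
Hypothesis cc : c <= c'.
Hypothesis closed_form : forall x y, a <= x <= a' -> c <= y <= c' ->
  exists px q qy, diff2 P x y px q /\ diff2 Q x y q qy.

Lemma ex_RInt_P x1 x2 y : a <= x1 -> x1 <= x2 -> x2 <= a' -> c <= y <= c' -> ex_RInt (fun x => P x y) x1 x2.
Proof.
  intros. apply (ex_RInt_continuous (V := R_CompleteNormedModule)). intros z Hz. rewrite Rmin_left, Rmax_right in Hz by auto.
  destruct (closed_form z y) as (px & q & qy & h & _); [lra|auto|]. eapply diff2_continuous_l; eauto.
Qed.

Lemma ex_RInt_Q x y1 y2 : c <= y1 -> y1 <= y2 -> y2 <= c' -> a <= x <= a' -> ex_RInt (fun y => Q x y) y1 y2.
Proof.
  intros. apply (ex_RInt_continuous (V := R_CompleteNormedModule)). intros z Hz. rewrite Rmin_left, Rmax_right in Hz by auto.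
  destruct (closed_form x z) as (px & q & qy & _ & h); [auto|lra|]. eapply diff2_continuous_r; eauto.
Qed.

Lemma ex_RInt_dP x1 x2 y y' : a <= x1 -> x1 <= x2 -> x2 <= a' -> c <= y <= c' -> c <= y' <= c' -> ex_RInt (fun x => P x y - P x y') x1 x2.
Proof. intros. apply (ex_RInt_minus (V := R_NormedModule)); apply ex_RInt_P; auto. Qed.

Lemma ex_RInt_dQ x x' y1 y2 : c <= y1 -> y1 <= y2 -> y2 <= c' -> a <= x <= a' -> a <= x' <= a' -> ex_RInt (fun y => Q x' y - Q x y) y1 y2.
Proof. intros. apply (ex_RInt_minus (V := R_NormedModule)); apply ex_RInt_Q; auto. Qed.

Lemma RInt_minus_R f g x y : ex_RInt f x y -> ex_RInt g x y -> RInt (fun t => f t - g t) x y = RInt f x y - RInt g x y.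
Proof. intros. apply (RInt_minus (V := R_CompleteNormedModule)); auto. Qed.

Lemma RInt_Chasles_R f x y z : ex_RInt f x y -> ex_RInt f y z -> RInt f x z = RInt f x y + RInt f y z.
Proof. intros. symmetry. apply (RInt_Chasles (V := R_CompleteNormedModule)); auto. Qed.

Lemma circulation_sides x x' y y' : a <= x -> x <= x' -> x' <= a' -> c <= y -> y <= y' -> y' <= c' ->
  circulation P Q x x' y y' = RInt (fun t => P t y) x x' - RInt (fun t => P t y') x x'
    + (RInt (fun s => Q x' s) y y' - RInt (fun s => Q x s) y y').
Proof.
  intros. unfold circulation.
  rewrite (RInt_minus_R (fun t => P t y) (fun t => P t y')) by (apply ex_RInt_P; lra).
  rewrite (RInt_minus_R (fun s => Q x' s) (fun s => Q x s)) by (apply ex_RInt_Q; lra).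
  reflexivity.
Qed.

Lemma circulation_split x1 x2 x3 y1 y2 y3 :
  a <= x1 -> x1 <= x2 -> x2 <= x3 -> x3 <= a' -> c <= y1 -> y1 <= y2 -> y2 <= y3 -> y3 <= c' ->
  circulation P Q x1 x3 y1 y3 = circulation P Q x1 x2 y1 y2 + circulation P Q x2 x3 y1 y2
    + circulation P Q x1 x2 y2 y3 + circulation P Q x2 x3 y2 y3.
Proof.
  intros. rewrite !circulation_sides by lra.
  rewrite (RInt_Chasles_R (fun x => P x y1) x1 x2 x3) by (apply ex_RInt_P; lra).
  rewrite (RInt_Chasles_R (fun x => P x y3) x1 x2 x3) by (apply ex_RInt_P; lra).
  rewrite (RInt_Chasles_R (fun x => Q x1 x) y1 y2 y3) by (apply ex_RInt_Q; lra).
  rewrite (RInt_Chasles_R (fun x => Q x3 x) y1 y2 y3) by (apply ex_RInt_Q; lra).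
  ring.
Qed.

(** On a small rectangle the affine parts of P and Q contribute nothing, since P_y = Q_x. *)
Lemma circulation_local x0 y0 e : 0 < e -> a <= x0 <= a' -> c <= y0 <= c' ->
  exists d, 0 < d /\ forall x x' y y', a <= x -> x <= x0 -> x0 <= x' -> x' <= a' -> c <= y -> y <= y0 -> y0 <= y' -> y' <= c' ->
    x' - x < d -> y' - y < d -> Rabs (circulation P Q x x' y y') <= 2 * e * ((x' - x) + (y' - y)) ^ 2.
Proof.
  intros He Hx0 Hy0. destruct (closed_form x0 y0 Hx0 Hy0) as (px & q & qy & DP & DQ).
  destruct (DP e He) as [d1 [Hd1 K1]]. destruct (DQ e He) as [d2 [Hd2 K2]].
  exists (Rmin d1 d2). split; [apply Rmin_pos; auto|]. intros x x' y y' h1 h2 h3 h4 h5 h6 h7 h8 hx hy.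
  pose proof (Rmin_l d1 d2). pose proof (Rmin_r d1 d2).
  set (l := x' - x) in *. set (m := y' - y) in *.
  assert (B : forall t s, x <= t <= x' -> y <= s <= y' -> Rabs (t - x0) <= l /\ Rabs (s - y0) <= m).
  { intros t s ht hs. unfold l, m. split; apply Rabs_le; lra. }
  assert (EP : forall t s, x <= t <= x' -> y <= s <= y' -> Rabs (P t s - P x0 y0 - px * (t - x0) - q * (s - y0)) <= e * (l + m)).
  { intros t s ht hs. destruct (B t s ht hs). eapply Rle_trans; [apply K1; lra|]. apply Rmult_le_compat_l; lra. }
  assert (EQ : forall t s, x <= t <= x' -> y <= s <= y' -> Rabs (Q t s - Q x0 y0 - q * (t - x0) - qy * (s - y0)) <= e * (l + m)).
  { intros t s ht hs. destruct (B t s ht hs). eapply Rle_trans; [apply K2; lra|]. apply Rmult_le_compat_l; lra. }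
  unfold circulation.
  assert (I1 : Rabs (RInt (fun t => P t y - P t y') x x' - (- q * m) * l) <= (2 * e * (l + m)) * l).
  { apply RInt_near_const; [lra|apply ex_RInt_dP; lra|]. intros t ht.
    pose proof (EP t y ht ltac:(lra)) as E1. pose proof (EP t y' ht ltac:(lra)) as E2.
    apply Rabs_le_between in E1. apply Rabs_le_between in E2. apply Rabs_le. unfold m in *. lra. }
  assert (I2 : Rabs (RInt (fun s => Q x' s - Q x s) y y' - (q * l) * m) <= (2 * e * (l + m)) * m).
  { apply RInt_near_const; [lra|apply ex_RInt_dQ; lra|]. intros s hs.
    pose proof (EQ x s ltac:(lra) hs) as E1. pose proof (EQ x' s ltac:(lra) hs) as E2.
    apply Rabs_le_between in E1. apply Rabs_le_between in E2. apply Rabs_le. unfold l in *. lra. }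
  apply Rabs_le_between in I1. apply Rabs_le_between in I2. apply Rabs_le. split; nra.
Qed.

(** The bound [e s^2] for the circulation around a subrectangle of scale [s] is inherited by a
    rectangle from its four quarters, and holds around every point at small scale; by bisection it
    holds for the whole rectangle, with [e] arbitrary. *)
Theorem Goursat_rectangle : circulation P Q a a' c c' = 0.
Proof.
  set (L := a' - a). set (M := c' - c).
  assert (L0 : 0 <= L) by (unfold L; lra). assert (M0 : 0 <= M) by (unfold M; lra).
  assert (A : forall e, 0 < e -> Rabs (circulation P Q a a' c c') <= e).
  { intros e He.
    set (good := fun x y s => a <= x -> x + s*L <= a' -> c <= y -> y + s*M <= c' -> Rabs (circulation P Q x (x + s*L) y (y + s*M)) <= e * s^2).
    assert (G : good a c 1).
    { apply (bisection_induction a c L M good L0 M0).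
      - intros x y s Hs g1 g2 g3 g4. unfold good. intros i1 i2 i3 i4.
        assert (P1 : 0 <= s/2*L) by (apply Rmult_le_pos; lra). assert (P2 : 0 <= s/2*M) by (apply Rmult_le_pos; lra).
        assert (X : x + s*L = x + s/2*L + s/2*L) by field. assert (Y : y + s*M = y + s/2*M + s/2*M) by field.
        rewrite X in *. rewrite Y in *.
        rewrite (circulation_split x (x+s/2*L) (x+s/2*L+s/2*L) y (y+s/2*M) (y+s/2*M+s/2*M)) by lra.
        unfold good in *.
        specialize (g1 ltac:(lra) ltac:(lra) ltac:(lra) ltac:(lra)). specialize (g2 ltac:(lra) ltac:(lra) ltac:(lra) ltac:(lra)).
        specialize (g3 ltac:(lra) ltac:(lra) ltac:(lra) ltac:(lra)). specialize (g4 ltac:(lra) ltac:(lra) ltac:(lra) ltac:(lra)).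
        replace (e * s^2) with (4 * (e * (s/2)^2)) by field.
        apply Rabs_le_between in g1. apply Rabs_le_between in g2. apply Rabs_le_between in g3. apply Rabs_le_between in g4.
        apply Rabs_le. lra.
      - intros x0 y0 hx hy.
        set (K := 2 * (L + M)^2 + 1). assert (HK : 0 < K) by (unfold K; nra).
        destruct (circulation_local x0 y0 (e / K)) as [d [Hd H]]; [apply Rdiv_lt_0_compat; lra|unfold L in *; lra|unfold M in *; lra|].
        exists (d / (L + M + 1)). split; [apply Rdiv_lt_0_compat; lra|].
        intros x y s Hs h1 h2. unfold good. intros i1 i2 i3 i4.
        assert (s * (L + M + 1) < d).
        { replace d with (d / (L+M+1) * (L+M+1)) by (field; lra). apply Rmult_lt_compat_r; lra. }
        assert (0 <= s * L) by (apply Rmult_le_pos; lra). assert (0 <= s * M) by (apply Rmult_le_pos; lra).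
        eapply Rle_trans; [apply H; nra|].
        replace (x + s*L - x + (y + s*M - y)) with (s * (L + M)) by ring.
        replace (2 * (e / K) * (s * (L + M))^2) with (e * s^2 * (2 * (L+M)^2 / K)) by (field; lra).
        rewrite <- (Rmult_1_r (e * s^2)) at 2. apply Rmult_le_compat_l. { apply Rmult_le_pos; [lra|apply pow2_ge_0]. }
        apply (Rmult_le_reg_r K); auto. unfold Rdiv. rewrite Rmult_assoc, Rinv_l by lra. unfold K; lra. }
    unfold good in G. replace (a + 1*L) with a' in G by (unfold L; ring). replace (c + 1*M) with c' in G by (unfold M; ring).
    specialize (G ltac:(lra) ltac:(lra) ltac:(lra) ltac:(lra)). lra. }
  apply NNPP. intros N. pose proof (Rabs_pos_lt _ N). specialize (A (Rabs (circulation P Q a a' c c') / 2) ltac:(lra)). lra.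
Qed.

Corollary Goursat_periodic : (forall x, a <= x <= a' -> P x c = P x c') ->
  RInt (fun y => Q a y) c c' = RInt (fun y => Q a' y) c c'.
Proof.
  intros H. pose proof Goursat_rectangle as G. unfold circulation in G.
  rewrite (RInt_ext (fun x => P x c - P x c') (fun _ => 0)) in G.
  - rewrite RInt_const in G. rewrite RInt_minus_R in G by (apply ex_RInt_Q; lra).
    unfold scal in G; simpl in G; unfold mult in G; simpl in G.
    change (RInt (Q a) c c' = RInt (Q a') c c'). lra.
  - intros x hx. rewrite Rmin_left, Rmax_right in hx by auto. rewrite (H x); lra.
Qed.
End Goursat.

Open Scope C_scope.

(** * Complex differentiability *)

Definition cdiff (f : C -> C) (z l : C) : Prop :=
  forall e, (0 < e)%R -> exists d, (0 < d)%R /\ forall y, (Cmod (y - z) < d)%R ->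
    (Cmod (f y - f z - (y - z) * l) <= e * Cmod (y - z))%R.

Lemma is_derive_cdiff f z l : @is_derive C_AbsRing (AbsRing_NormedModule C_AbsRing) f z l <-> cdiff f z l.
Proof.
  split.
  - intros [_ H] e He. destruct (H z (fun P h => h) (mkposreal e He)) as [d Hd].
    exists d. split; [apply cond_pos|]. intros y Hy. exact (Hd y Hy).
  - intros H. split; [apply is_linear_scal_l|]. intros x Hx. apply (is_filter_lim_locally_unique (V := AbsRing_NormedModule C_AbsRing)) in Hx. subst x.
    intros e. destruct (H e (cond_pos e)) as [d [Hd Hd']]. exists (mkposreal d Hd). intros y Hy. exact (Hd' y Hy).
Qed.

Lemma is_derive_C_cdiff f z l : @is_derive C_AbsRing C_NormedModule f z l <-> cdiff f z l.
Proof. rewrite <- is_derive_cdiff. split; intros [_ H]; (split; [apply is_linear_scal_l|exact H]). Qed.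

Lemma cdiff_mult f g z l m : cdiff f z l -> cdiff g z m -> cdiff (fun y => f y * g y) z (l * g z + f z * m).
Proof.
  intros F G. apply is_derive_cdiff in F. apply is_derive_cdiff in G. apply is_derive_cdiff.
  apply (is_derive_mult (K := C_AbsRing) f g z l m F G). apply Cmult_comm.
Qed.

Lemma cdiff_comp f g z l m : cdiff f (g z) l -> cdiff g z m -> cdiff (fun y => f (g y)) z (m * l).
Proof.
  intros F G. apply is_derive_cdiff in F. apply is_derive_cdiff in G. apply is_derive_cdiff.
  apply (is_derive_comp (K := C_AbsRing) (V := AbsRing_NormedModule C_AbsRing) f g z l m F G).
Qed.

Lemma cdiff_affine a b z : cdiff (fun y => a + b * y) z b.
Proof.
  intros e He. exists 1%R. split; [lra|]. intros y _.
  replace (a + b * y - (a + b * z) - (y - z) * b) with (RtoC 0) by ring. rewrite Cmod_0.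
  apply Rmult_le_pos; [lra|apply Cmod_ge_0].
Qed.

Lemma cdiff_ext_loc f g z l : (exists d, (0 < d)%R /\ forall y, (Cmod (y - z) < d)%R -> f y = g y) ->
  cdiff f z l -> cdiff g z l.
Proof.
  intros [d [Hd H]] F e He. destruct (F e He) as [d' [Hd' K]].
  assert (E : f z = g z). { apply H. replace (z - z) with (RtoC 0) by ring. rewrite Cmod_0; auto. }
  exists (Rmin d d'). split; [apply Rmin_pos; auto|]. intros y Hy.
  pose proof (Rmin_l d d'). pose proof (Rmin_r d d'). rewrite <- E, <- (H y) by lra. apply K; lra.
Qed.

Lemma cdiff_inv (z : C) : z <> 0 -> cdiff Cinv z (- / (z * z)).
Proof.
  intros Hz e He. pose proof (proj1 (Cmod_gt_0 z) Hz) as P.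
  set (r := Cmod z) in *.
  exists (Rmin (r / 2) (e * (r * r * r) / 2)). split.
  { apply Rmin_pos; [lra|]. apply Rdiv_lt_0_compat; [|lra]. repeat apply Rmult_lt_0_compat; auto. }
  intros y Hy. pose proof (Rmin_l (r/2) (e * (r*r*r)/2)). pose proof (Rmin_r (r/2) (e * (r*r*r)/2)).
  assert (Hr : (r / 2 <= Cmod y)%R).
  { pose proof (Cmod_triangle y (z - y)). replace (y + (z - y)) with z in H1 by ring. rewrite Cmod_minus_sym in Hy. fold r in H1. lra. }
  assert (Hy0 : y <> 0). { intros ->. rewrite Cmod_0 in Hr. lra. }
  replace (/ y - / z - (y - z) * - / (z * z)) with ((y - z) * ((y - z) / (y * (z * z)))) by (field; auto).
  rewrite Cmod_mult, Rmult_comm. apply Rmult_le_compat_r; [apply Cmod_ge_0|].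
  assert (z * z <> 0) by (apply Cmult_neq_0; auto).
  rewrite Cmod_div by (apply Cmult_neq_0; auto). rewrite !Cmod_mult. fold r.
  apply (Rmult_le_reg_r (Cmod y * (r * r))). { repeat apply Rmult_lt_0_compat; lra. }
  unfold Rdiv. rewrite Rmult_assoc, Rinv_l, Rmult_1_r.
  2:{ apply Rgt_not_eq. repeat apply Rmult_lt_0_compat; lra. }
  apply Rle_trans with (e * (r * r * r) / 2)%R; [lra|].
  replace (e * (r * r * r) / 2)%R with (e * (r * r) * (r / 2))%R by field.
  replace (e * (Cmod y * (r * r)))%R with (e * (r * r) * Cmod y)%R by ring. apply Rmult_le_compat_l; auto.
  repeat apply Rmult_le_pos; lra.
Qed.

Definition ccontinuous (f : C -> C) (z : C) : Prop :=
  forall e, (0 < e)%R -> exists d, (0 < d)%R /\ forall y, (Cmod (y - z) < d)%R -> (Cmod (f y - f z) < e)%R.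

Lemma cdiff_continuous f z l : cdiff f z l -> ccontinuous f z.
Proof.
  intros F e He. destruct (F 1%R ltac:(lra)) as [d [Hd H]]. pose proof (Cmod_ge_0 l).
  assert (P : (0 < e / (Cmod l + 1))%R) by (apply Rdiv_lt_0_compat; lra).
  exists (Rmin d (e / (Cmod l + 1) / 2)). split. { apply Rmin_pos; lra. }
  intros y Hy. pose proof (Rmin_l d (e / (Cmod l + 1) / 2)). pose proof (Rmin_r d (e / (Cmod l + 1) / 2)).
  specialize (H y ltac:(lra)).
  replace (f y - f z) with ((f y - f z - (y - z) * l) + (y - z) * l) by ring.
  eapply Rle_lt_trans; [apply Cmod_triangle|]. rewrite Cmod_mult.
  assert (Cmod (y - z) * (Cmod l + 1) <= e / (Cmod l + 1) / 2 * (Cmod l + 1))%R by (apply Rmult_le_compat_r; lra).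
  replace (e / (Cmod l + 1) / 2 * (Cmod l + 1))%R with (e/2)%R in H3 by (field; lra). lra.
Qed.

Definition dslope (f : C -> C) (w l : C) (z : C) : C :=
  if excluded_middle_informative (z = w) then l else (f z - f w) / (z - w).

Lemma dslope_eq f w l z : f z - f w = (z - w) * dslope f w l z.
Proof.
  unfold dslope. destruct (excluded_middle_informative (z = w)) as [->|n]; [ring|].
  field. intros H. apply n. replace z with (z - w + w) by ring. rewrite H. ring.
Qed.

Lemma ccontinuous_dslope f w l z m : cdiff f w l -> (z <> w -> cdiff f z m) -> ccontinuous (dslope f w l) z.
Proof.
  intros F G. destruct (excluded_middle_informative (z = w)) as [->|n].
  - intros e He. destruct (F (e/2)%R ltac:(lra)) as [d [Hd H]]. exists d. split; auto. intros y Hy.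
    unfold dslope. destruct (excluded_middle_informative (w = w)) as [_|]; [|congruence].
    destruct (excluded_middle_informative (y = w)) as [_|n].
    + replace (l - l) with (RtoC 0) by ring. rewrite Cmod_0; auto.
    + assert (yw : y - w <> 0). { intros K. apply n. replace y with (y - w + w) by ring. rewrite K; ring. }
      specialize (H y Hy). replace ((f y - f w) / (y - w) - l) with ((f y - f w - (y - w) * l) / (y - w)) by (field; auto).
      rewrite Cmod_div by auto. pose proof (proj1 (Cmod_gt_0 _) yw).
      apply Rle_lt_trans with (e/2)%R; [|lra]. apply (Rmult_le_reg_r (Cmod (y - w))); auto.
      unfold Rdiv at 1. rewrite Rmult_assoc, Rinv_l; lra.
  - assert (zw : z - w <> 0). { intros K. apply n. replace z with (z - w + w) by ring. rewrite K; ring. }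
    assert (D : exists k, cdiff (fun y => (f y - f w) * / (y - w)) z k).
    { eexists. apply (cdiff_mult (fun y => f y - f w) (fun y => / (y - w)) z m).
      - intros e He. destruct (G n e He) as [d [Hd H]]. exists d. split; auto. intros y Hy. 
        replace (f y - f w - (f z - f w) - (y - z) * m) with (f y - f z - (y - z) * m) by ring. auto.
      - apply (cdiff_comp Cinv (fun y => y - w)). { apply cdiff_inv; auto. }
        eapply cdiff_ext_loc; [|apply (cdiff_affine (- w) 1)]. exists 1%R. split; [lra|]. intros; ring. }
    destruct D as [k D].
    apply (cdiff_continuous _ _ k). eapply cdiff_ext_loc; [|exact D].
    exists (Cmod (z - w)). split; [apply Cmod_gt_0; auto|]. intros y Hy. unfold dslope.
    destruct (excluded_middle_informative (y = w)) as [->|]; [|reflexivity].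
    rewrite Cmod_minus_sym in Hy. lra.
Qed.

(** ** The complex exponential and circle rotations *)

Definition cis (t : R) : C := (cos t, sin t).
Definition cexp (s : C) : C := RtoC (exp (Re s)) * cis (Im s).

Lemma cis_add x y : cis (x + y) = cis x * cis y.
Proof. apply Ceq; simpl; [rewrite cos_plus|rewrite sin_plus]; ring. Qed.

Lemma cis_0 : cis 0 = 1.
Proof. apply Ceq; simpl; [apply cos_0|apply sin_0]. Qed.

Lemma Cmod_cis t : Cmod (cis t) = 1%R.
Proof.
  unfold Cmod, cis; simpl. rewrite !Rmult_1_r. pose proof (sin2_cos2 t) as H. unfold Rsqr in H.
  replace (cos t * cos t + sin t * sin t)%R with 1%R by lra. apply sqrt_1.
Qed.

Lemma cis_conj t : Cconj (cis t) = cis (- t).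
Proof. apply Ceq; simpl; [rewrite cos_neg|rewrite sin_neg]; ring. Qed.

Lemma Cmod_cexp s : Cmod (cexp s) = exp (Re s).
Proof. unfold cexp. rewrite Cmod_mult, Cmod_cis, Cmod_R, Rabs_pos_eq; [ring|]. left; apply exp_pos. Qed.

Lemma cexp_add s t : cexp (s + t) = cexp s * cexp t.
Proof. unfold cexp. rewrite re_plus, im_plus, exp_plus, cis_add, RtoC_mult. ring. Qed.

Lemma derivable_small (f : R -> R) l : derivable_pt_lim f 0 l -> forall e, (0 < e)%R -> exists d, (0 < d)%R /\
  forall h, (Rabs h < d)%R -> (Rabs (f h - f 0 - h * l) <= e * Rabs h)%R.
Proof.
  intros D e He. destruct (D e He) as [d Hd]. exists d. split; [apply cond_pos|]. intros h Hh.
  destruct (Req_dec h 0) as [->|n].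
  - rewrite Rabs_R0. replace (f 0 - f 0 - 0 * l)%R with 0%R by ring. rewrite Rabs_R0. lra.
  - specialize (Hd h n Hh). rewrite Rplus_0_l in Hd.
    replace (f h - f 0 - h * l)%R with (((f h - f 0) / h - l) * h)%R by (field; auto).
    rewrite Rabs_mult. apply Rmult_le_compat_r; [apply Rabs_pos|lra].
Qed.

Lemma Cmod_le_Rabs (z : C) : (Cmod z <= Rabs (Re z) + Rabs (Im z))%R.
Proof.
  destruct z as [x y]. replace (x, y) with (RtoC x + Ci * RtoC y) by (apply Ceq; simpl; ring).
  eapply Rle_trans; [apply Cmod_triangle|]. rewrite Cmod_mult, Cmod_Ci, !Cmod_R, Rmult_1_l. simpl.
  replace (x + (0 * y - 1 * 0))%R with x by ring. replace (0 + (0 * 0 + 1 * y))%R with y by ring. lra.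
Qed.

(** [exp a cos b - 1 - a] and [exp a sin b - b] are combinations of the one-variable remainders of
    exp, cos and sin at 0; the constant 20 absorbs their number. *)
Lemma cdiff_cexp_0 : cdiff cexp 0 1.
Proof.
  intros e He. set (e' := (Rmin e 1 / 20)%R).
  assert (E1 : (0 < e' <= e / 20 /\ e' <= /20)%R).
  { unfold e'. pose proof (Rmin_l e 1). pose proof (Rmin_r e 1). pose proof (Rmin_pos e 1 He ltac:(lra)). lra. }
  destruct (derivable_small exp 1) with (e := e') as [d1 [Hd1 K1]]; [apply derivable_pt_lim_exp_0|lra|].
  destruct (derivable_small cos 0) with (e := e') as [d2 [Hd2 K2]].
  { pose proof (derivable_pt_lim_cos 0) as H. rewrite sin_0, Ropp_0 in H. exact H. } { lra. }
  destruct (derivable_small sin 1) with (e := e') as [d3 [Hd3 K3]].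
  { pose proof (derivable_pt_lim_sin 0) as H. rewrite cos_0 in H. exact H. } { lra. }
  exists (Rmin (Rmin d1 d2) (Rmin d3 e')). split. { repeat apply Rmin_pos; lra. }
  intros y Hy.
  pose proof (Rmin_l (Rmin d1 d2) (Rmin d3 e')). pose proof (Rmin_r (Rmin d1 d2) (Rmin d3 e')).
  pose proof (Rmin_l d1 d2). pose proof (Rmin_r d1 d2). pose proof (Rmin_l d3 e'). pose proof (Rmin_r d3 e').
  replace (y - 0) with y in * by ring.
  pose proof (re_le_Cmod y) as Ha. pose proof (im_le_Cmod y) as Hb.
  destruct y as [a b]. simpl in Ha, Hb. set (N := Cmod (a, b)) in *.
  specialize (K1 a ltac:(lra)). specialize (K2 b ltac:(lra)). specialize (K3 b ltac:(lra)).
  rewrite exp_0 in K1. rewrite cos_0 in K2. rewrite sin_0 in K3.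
  assert (B1 : (Rabs (exp a - 1 - a) <= e' * N)%R). { replace (exp a - 1 - a)%R with (exp a - 1 - a * 1)%R by ring. nra. }
  assert (B2 : (Rabs (cos b - 1) <= e' * N)%R). { replace (cos b - 1)%R with (cos b - 1 - b * 0)%R by ring. nra. }
  assert (B3 : (Rabs (sin b - b) <= e' * N)%R). { replace (sin b - b)%R with (sin b - 0 - b * 1)%R by ring. nra. }
  assert (N0 : (0 <= N)%R) by apply Cmod_ge_0.
  assert (B4 : (Rabs (exp a - 1) <= 2 * N)%R).
  { replace (exp a - 1)%R with ((exp a - 1 - a) + a)%R by ring. eapply Rle_trans; [apply Rabs_triang|]. nra. }
  assert (B5 : (Rabs (exp a) <= 2)%R).
  { replace (exp a) with ((exp a - 1) + 1)%R by ring. eapply Rle_trans; [apply Rabs_triang|]. rewrite Rabs_R1. lra. }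
  eapply Rle_trans; [apply Cmod_le_Rabs|].
  replace (Re (cexp (a, b) - cexp 0 - (a, b) * 1)) with ((exp a - 1 - a) + exp a * (cos b - 1))%R.
  2:{ unfold cexp; simpl. rewrite exp_0, cos_0, sin_0. ring. }
  replace (Im (cexp (a, b) - cexp 0 - (a, b) * 1)) with (exp a * (sin b - b) + (exp a - 1) * b)%R.
  2:{ unfold cexp; simpl. rewrite exp_0, cos_0, sin_0. ring. }
  pose proof (Rabs_triang (exp a - 1 - a) (exp a * (cos b - 1))) as T1.
  pose proof (Rabs_triang (exp a * (sin b - b)) ((exp a - 1) * b)) as T2.
  rewrite !Rabs_mult in *.
  assert (Rabs (exp a) * Rabs (cos b - 1) <= 2 * (e' * N))%R by (apply Rmult_le_compat; auto; apply Rabs_pos).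
  assert (Rabs (exp a) * Rabs (sin b - b) <= 2 * (e' * N))%R by (apply Rmult_le_compat; auto; apply Rabs_pos).
  assert (Rabs (exp a - 1) * Rabs b <= (2 * N) * e')%R by (apply Rmult_le_compat; auto; try apply Rabs_pos; lra).
  assert (e' * N <= e / 20 * N)%R by (apply Rmult_le_compat_r; lra). nra.
Qed.

Lemma cdiff_cexp s : cdiff cexp s (cexp s).
Proof.
  intros e He. pose proof (exp_pos (Re s)) as P. destruct (cdiff_cexp_0 (e / exp (Re s))%R) as [d [Hd H]].
  { apply Rdiv_lt_0_compat; auto. }
  exists d. split; auto. intros y Hy. specialize (H (y - s)). replace (y - s - 0) with (y - s) in H by ring. specialize (H Hy).
  replace (cexp y) with (cexp s * cexp (y - s)) by (rewrite <- cexp_add; f_equal; ring).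
  assert (E : cexp 0 = 1). { unfold cexp; simpl. rewrite exp_0, cis_0. ring. }
  rewrite E in H.
  replace (cexp s * cexp (y - s) - cexp s - (y - s) * cexp s) with (cexp s * (cexp (y - s) - 1 - (y - s) * 1)) by ring.
  rewrite Cmod_mult, Cmod_cexp. apply Rle_trans with (exp (Re s) * (e / exp (Re s) * Cmod (y - s)))%R.
  - apply Rmult_le_compat_l; lra.
  - right. field. lra.
Qed.

(** ** Integrals of periodic holomorphic functions over vertical segments *)

(** The Cauchy-Riemann equations: both partial derivatives are read off from [l]. *)
Lemma cdiff_diff2 (G : C -> C) x y l : cdiff G (x, y) l ->
  diff2 (fun a b => Re (G (a, b))) x y (Re l) (- Im l) /\ diff2 (fun a b => Im (G (a, b))) x y (Im l) (Re l).
Proof.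
  intros D.
  assert (K : forall e, (0 < e)%R -> exists d, (0 < d)%R /\ forall a b, (Rabs (a - x) < d)%R -> (Rabs (b - y) < d)%R ->
     (Cmod (G (a, b) - G (x, y) - ((a, b) - (x, y)) * l) <= e * (Rabs (a - x) + Rabs (b - y)))%R).
  { intros e He. destruct (D e He) as [d [Hd H]]. exists (d / 2)%R. split; [lra|]. intros a b ha hb.
    assert (Cmod ((a, b) - (x, y)) <= Rabs (a - x) + Rabs (b - y))%R by apply (Cmod_le_Rabs ((a, b) - (x, y))).
    eapply Rle_trans; [apply H; lra|]. apply Rmult_le_compat_l; lra. }
  split; intros e He; destruct (K e He) as [d [Hd H]]; exists d; split; auto; intros a b ha hb; specialize (H a b ha hb).
  - eapply Rle_trans; [|exact H]. eapply Rle_trans; [|apply re_le_Cmod]. right. f_equal.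
    destruct (G (a, b)), (G (x, y)), l; simpl. ring.
  - eapply Rle_trans; [|exact H]. eapply Rle_trans; [|apply im_le_Cmod]. right. f_equal.
    destruct (G (a, b)), (G (x, y)), l; simpl. ring.
Qed.

Lemma diff2_opp P x y p q : diff2 P x y p q -> diff2 (fun a b => - P a b)%R x y (- p) (- q).
Proof.
  intros H e He. destruct (H e He) as [d [Hd K]]. exists d. split; auto. intros a b ha hb.
  rewrite <- Rabs_Ropp. replace (- (- P a b - - P x y - - p * (a - x) - - q * (b - y)))%R with (P a b - P x y - p * (a - x) - q * (b - y))%R by ring. auto.
Qed.

(** The horizontal sides cancel by periodicity, so Goursat's theorem for the closed forms
    [Re (G ds)] and [Im (G ds)] equates the integrals over the two vertical sides. *)
Lemma vertical_integral_const (G : C -> C) x1 x2 c c' : (x1 <= x2)%R -> (c <= c')%R ->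
  (forall x y, (x1 <= x <= x2)%R -> exists l, cdiff G (x, y) l) ->
  (forall x, G (x, c) = G (x, c')) ->
  RInt (fun y => Re (G (x1, y))) c c' = RInt (fun y => Re (G (x2, y))) c c' /\
  RInt (fun y => Im (G (x1, y))) c c' = RInt (fun y => Im (G (x2, y))) c c'.
Proof.
  intros hx hc D Per. split.
  - apply (Goursat_periodic (fun a b => Im (G (a, b))) (fun a b => Re (G (a, b)))); auto.
    + intros x y h _. destruct (D x y h) as [l Hl]. destruct (cdiff_diff2 G x y l Hl). exists (Im l), (Re l), (- Im l)%R. auto.
    + intros; rewrite Per; auto.
  - assert (E : RInt (fun y => - Im (G (x1, y)))%R c c' = RInt (fun y => - Im (G (x2, y)))%R c c').
    { apply (Goursat_periodic (fun a b => Re (G (a, b))) (fun a b => - Im (G (a, b)))%R); auto.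
      + intros x y h _. destruct (D x y h) as [l Hl]. destruct (cdiff_diff2 G x y l Hl) as [d1 d2]. 
        exists (Re l), (- Im l)%R, (- Re l)%R. split; auto. apply diff2_opp in d2. auto.
      + intros; rewrite Per; auto. }
    assert (X : forall x, (x1 <= x <= x2)%R -> ex_RInt (fun y => Im (G (x, y))) c c').
    { intros x h. apply (ex_RInt_continuous (V := R_CompleteNormedModule)). intros z _.
      destruct (D x z h) as [l Hl]. destruct (cdiff_diff2 G x z l Hl) as [_ d]. apply (diff2_continuous_r _ _ _ _ _ d). }
    rewrite !(RInt_opp (V := R_CompleteNormedModule)) in E by (apply X; lra). unfold opp in E; simpl in E. lra.
Qed.

(** * Fourier coefficients *)

Definition ccont (g : R -> C) : Prop :=
  forall t, continuous (fun s => Re (g s)) t /\ continuous (fun s => Im (g s)) t.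

Lemma ccont_plus f g : ccont f -> ccont g -> ccont (fun t => f t + g t).
Proof.
  intros F G t. destruct (F t), (G t). split.
  - apply (continuous_plus (V := R_NormedModule) (fun s => Re (f s)) (fun s => Re (g s))); auto.
  - apply (continuous_plus (V := R_NormedModule) (fun s => Im (f s)) (fun s => Im (g s))); auto.
Qed.

Lemma ccont_mult f g : ccont f -> ccont g -> ccont (fun t => f t * g t).
Proof.
  intros F G t. destruct (F t) as [f1 f2], (G t) as [g1 g2]. split.
  - apply (continuous_minus (V := R_NormedModule) (fun s => Re (f s) * Re (g s))%R (fun s => Im (f s) * Im (g s))%R);
      apply (continuous_mult (K := R_AbsRing)); auto.
  - apply (continuous_plus (V := R_NormedModule) (fun s => Re (f s) * Im (g s))%R (fun s => Im (f s) * Re (g s))%R);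
      apply (continuous_mult (K := R_AbsRing)); auto.
Qed.

Lemma ccont_const c : ccont (fun _ => c).
Proof. intros t; split; apply continuous_const. Qed.

Lemma ccont_conj f : ccont f -> ccont (fun t => Cconj (f t)).
Proof.
  intros F t. destruct (F t) as [f1 f2]. split; auto.
  apply (continuous_opp (V := R_NormedModule) (fun s => Im (f s))); auto.
Qed.

Lemma ccont_cis k : ccont (fun t => cis (k * t)).
Proof.
  intros t. split; simpl.
  - apply (continuous_comp (fun s => k * s)%R cos); [|apply continuous_cos].
    apply (continuous_mult (K := R_AbsRing) (fun _ => k) (fun s => s)); [apply continuous_const|apply continuous_id].
  - apply (continuous_comp (fun s => k * s)%R sin); [|apply continuous_sin].
    apply (continuous_mult (K := R_AbsRing) (fun _ => k) (fun s => s)); [apply continuous_const|apply continuous_id].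
Qed.

#[global] Hint Resolve ccont_plus ccont_mult ccont_const ccont_conj ccont_cis : ccont.

Lemma ccont_csum (f : nat -> R -> C) N : (forall k, ccont (f k)) -> ccont (fun t => csum (fun k => f k t) N).
Proof.
  intros H. induction N.
  - replace (fun t => csum (fun k => f k t) 0) with (f 0%nat); auto.
    apply functional_extensionality; intros; rewrite csum_0; auto.
  - replace (fun t => csum (fun k => f k t) (S N)) with (fun t => csum (fun k => f k t) N + f (S N) t).
    + apply ccont_plus; auto.
    + apply functional_extensionality; intros; rewrite csum_S; auto.
Qed.

Lemma ccont_compose (f : C -> C) (g : R -> C) : (forall t, ccontinuous f (g t)) -> ccont g -> ccont (fun t => f (g t)).
Proof.
  intros F G t. destruct (G t) as [g1 g2].
  assert (K : forall e, (0 < e)%R -> exists d, (0 < d)%R /\ forall s, (Rabs (s - t) < d)%R -> (Cmod (f (g s) - f (g t)) < e)%R).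
  { intros e He. destruct (F t e He) as [d [Hd H]].
    destruct (continuous_eps_inv _ _ g1 (d/2)%R ltac:(lra)) as [d1 [Hd1 K1]].
    destruct (continuous_eps_inv _ _ g2 (d/2)%R ltac:(lra)) as [d2 [Hd2 K2]].
    exists (Rmin d1 d2). split; [apply Rmin_pos; auto|]. intros s Hs. pose proof (Rmin_l d1 d2). pose proof (Rmin_r d1 d2).
    apply H. eapply Rle_lt_trans; [apply Cmod_le_Rabs|]. specialize (K1 s ltac:(lra)). specialize (K2 s ltac:(lra)).
    change (Re (g s - g t)) with (Re (g s) - Re (g t))%R. change (Im (g s - g t)) with (Im (g s) - Im (g t))%R. lra. }
  split; apply continuous_eps; intros e He; destruct (K e He) as [d [Hd H]]; exists d; split; auto; intros s Hs;
    (eapply Rle_lt_trans; [|apply (H s Hs)]).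
  - eapply Rle_trans; [|apply re_le_Cmod]. right; reflexivity.
  - eapply Rle_trans; [|apply im_le_Cmod]. right; reflexivity.
Qed.

Definition mean (g : R -> C) : C :=
  (RInt (fun t => Re (g t)) 0 (2 * PI) / (2 * PI), RInt (fun t => Im (g t)) 0 (2 * PI) / (2 * PI))%R.

Lemma ccont_ex_Re g : ccont g -> ex_RInt (fun t => Re (g t)) 0 (2 * PI).
Proof. intros G. apply (ex_RInt_continuous (V := R_CompleteNormedModule)). intros; apply G. Qed.
Lemma ccont_ex_Im g : ccont g -> ex_RInt (fun t => Im (g t)) 0 (2 * PI).
Proof. intros G. apply (ex_RInt_continuous (V := R_CompleteNormedModule)). intros; apply G. Qed.

Lemma PI2_pos : (0 < 2 * PI)%R.
Proof. pose proof PI_RGT_0; lra. Qed.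

Lemma mean_plus f g : ccont f -> ccont g -> mean (fun t => f t + g t) = mean f + mean g.
Proof.
  intros F G. pose proof PI2_pos. unfold mean. apply Ceq; simpl.
  - rewrite (RInt_plus (V := R_CompleteNormedModule) (fun t => Re (f t)) (fun t => Re (g t))) by auto using ccont_ex_Re.
    unfold plus; simpl; unfold Re. field. pose proof PI_RGT_0; lra.
  - rewrite (RInt_plus (V := R_CompleteNormedModule) (fun t => Im (f t)) (fun t => Im (g t))) by auto using ccont_ex_Im.
    unfold plus; simpl; unfold Im. field. pose proof PI_RGT_0; lra.
Qed.

Lemma RInt_scal_R f c a b : ex_RInt f a b -> RInt (fun t => c * f t)%R a b = (c * RInt f a b)%R.
Proof. intros. apply (RInt_scal (V := R_CompleteNormedModule) f a b c); auto. Qed.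

Lemma ex_RInt_scal_R f c a b : ex_RInt f a b -> ex_RInt (fun t => c * f t)%R a b.
Proof. intros. apply (ex_RInt_scal (V := R_NormedModule) f a b c); auto. Qed.

Lemma mean_scal c g : ccont g -> mean (fun t => c * g t) = c * mean g.
Proof.
  intros G. pose proof PI2_pos. unfold mean. pose proof (ccont_ex_Re g G) as H1. pose proof (ccont_ex_Im g G) as H2.
  apply Ceq.
  - cbn [Re Im fst snd Cmult]. change (fun t => fst c * fst (g t) - snd c * snd (g t))%R with (fun t => fst c * Re (g t) - snd c * Im (g t))%R.
    rewrite (RInt_minus (V := R_CompleteNormedModule) (fun t => fst c * Re (g t))%R (fun t => snd c * Im (g t))%R) by (apply ex_RInt_scal_R; auto).
    rewrite !RInt_scal_R by auto. unfold minus, plus, opp; simpl; unfold Re, Im. field. pose proof PI_RGT_0; lra.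
  - cbn [Re Im fst snd Cmult]. change (fun t => fst c * snd (g t) + snd c * fst (g t))%R with (fun t => fst c * Im (g t) + snd c * Re (g t))%R.
    rewrite (RInt_plus (V := R_CompleteNormedModule) (fun t => fst c * Im (g t))%R (fun t => snd c * Re (g t))%R) by (apply ex_RInt_scal_R; auto).
    rewrite !RInt_scal_R by auto. unfold minus, plus, opp; simpl; unfold Re, Im. field. pose proof PI_RGT_0; lra.
Qed.

Definition mean_sq (g : R -> C) : R := Re (mean (fun t => g t * Cconj (g t))).

Lemma mean_ext f g : (forall t, f t = g t) -> mean f = mean g.
Proof. intros H. f_equal. apply functional_extensionality; auto. Qed.

Lemma mean_conj g : ccont g -> mean (fun t => Cconj (g t)) = Cconj (mean g).
Proof.
  intros G. apply Ceq; [reflexivity|]. unfold mean. simpl.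
  rewrite (RInt_opp (V := R_CompleteNormedModule) (fun t => Im (g t))) by auto using ccont_ex_Im.
  unfold opp; simpl; unfold Im. field. pose proof PI_RGT_0; lra.
Qed.

Lemma mean_csum (f : nat -> R -> C) N : (forall k, ccont (f k)) ->
  mean (fun t => csum (fun k => f k t) N) = csum (fun k => mean (f k)) N.
Proof.
  intros H. induction N.
  - rewrite csum_0. apply mean_ext. intros; rewrite csum_0; auto.
  - rewrite csum_S, <- IHN, <- mean_plus by auto using ccont_csum. apply mean_ext. intros; rewrite csum_S; auto.
Qed.

Lemma mean_le f g : ccont f -> ccont g -> (forall t, (Re (f t) <= Re (g t))%R) -> (Re (mean f) <= Re (mean g))%R.
Proof.
  intros F G H. pose proof PI2_pos. unfold mean. cbn [Re fst]. apply Rmult_le_compat_r.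
  - left; apply Rinv_0_lt_compat; auto.
  - apply RInt_le; auto using ccont_ex_Re; lra.
Qed.

Lemma mean_const c : mean (fun _ => c) = c.
Proof.
  pose proof PI_RGT_0. unfold mean. rewrite !RInt_const. unfold scal; simpl; unfold mult; simpl.
  apply Ceq; simpl; unfold Re, Im; field; lra.
Qed.

Lemma cis_period (k : Z) : cis (IZR k * (2 * PI)) = 1.
Proof.
  assert (S0 : sin (IZR k * PI) = 0%R) by (apply sin_eq_0_1; exists k; auto).
  replace (IZR k * (2 * PI))%R with (2 * (IZR k * PI))%R by ring.
  apply Ceq; simpl; [rewrite cos_2a_sin|rewrite sin_2a]; rewrite S0; ring.
Qed.

Lemma mean_cis (k : Z) : mean (fun t => cis (IZR k * t)) = if Z.eq_dec k 0 then 1 else 0.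
Proof.
  destruct (Z.eq_dec k 0) as [->|n].
  - rewrite <- (mean_const 1). apply mean_ext. intros. rewrite Rmult_0_l. apply cis_0.
  - assert (K : IZR k <> 0%R) by (apply not_0_IZR; auto).
    pose proof (cis_period k) as P. pose proof (f_equal Re P) as P1. pose proof (f_equal Im P) as P2. simpl in P1, P2.
    assert (I1 : RInt (fun t => cos (IZR k * t)) 0 (2 * PI) = 0%R).
    { rewrite (is_RInt_unique _ _ _ (minus (sin (IZR k * (2 * PI)) / IZR k) (sin (IZR k * 0) / IZR k))%R).
      - rewrite P2, Rmult_0_r, sin_0. unfold minus, plus, opp; simpl. field. auto.
      - apply (is_RInt_derive (V := R_CompleteNormedModule) (fun t => sin (IZR k * t) / IZR k)%R).
        + intros x _. auto_derive; auto. field. auto.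
        + intros x _. apply (ccont_cis (IZR k)). }
    assert (I2 : RInt (fun t => sin (IZR k * t)) 0 (2 * PI) = 0%R).
    { rewrite (is_RInt_unique _ _ _ (minus (- cos (IZR k * (2 * PI)) / IZR k) (- cos (IZR k * 0) / IZR k))%R).
      - rewrite P1, Rmult_0_r, cos_0. unfold minus, plus, opp; simpl. field. auto.
      - apply (is_RInt_derive (V := R_CompleteNormedModule) (fun t => - cos (IZR k * t) / IZR k)%R).
        + intros x _. auto_derive; auto. field. auto.
        + intros x _. apply (ccont_cis (IZR k)). }
    unfold mean. apply Ceq; simpl; rewrite ?I1, ?I2; unfold Rdiv; ring.
Qed.

Definition fourier (g : R -> C) (n : Z) : C := mean (fun t => g t * cis (- IZR n * t)).

Lemma ccont_fourier g n : ccont g -> ccont (fun t => g t * cis (- IZR n * t)).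
Proof. auto with ccont. Qed.
#[global] Hint Resolve ccont_fourier : ccont.

Definition trigpoly (nu : nat -> Z) (c : nat -> C) (N : nat) (t : R) : C :=
  csum (fun k => c k * cis (IZR (nu k) * t)) N.

Lemma ccont_trigpoly nu c N : ccont (trigpoly nu c N).
Proof. apply (ccont_csum (fun k t => c k * cis (IZR (nu k) * t))). auto with ccont. Qed.

Lemma mean_trigpoly_conj g nu c N : ccont g ->
  mean (fun t => g t * Cconj (trigpoly nu c N t)) = csum (fun k => Cconj (c k) * fourier g (nu k)) N.
Proof.
  intros G. rewrite (mean_ext _ (fun t => csum (fun k => Cconj (c k) * (g t * cis (- IZR (nu k) * t))) N)).
  - rewrite (mean_csum (fun k t => Cconj (c k) * (g t * cis (- IZR (nu k) * t)))).
    + apply csum_ext. intros k _. rewrite mean_scal by auto with ccont. reflexivity.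
    + auto with ccont.
  - intros t. unfold trigpoly. rewrite csum_conj, <- csum_scal. apply csum_ext. intros k _.
    rewrite Cmult_conj, cis_conj, Ropp_mult_distr_l. ring.
Qed.

Lemma fourier_trigpoly nu c N m : (forall i j, nu i = nu j -> i = j) -> (m <= N)%nat ->
  fourier (trigpoly nu c N) (nu m) = c m.
Proof.
  intros I Hm. unfold fourier.
  rewrite (mean_ext _ (fun t => csum (fun k => c k * cis (IZR (nu k - nu m) * t)) N)).
  - rewrite (mean_csum (fun k t => c k * cis (IZR (nu k - nu m) * t))).
    2:{ auto with ccont. }
    rewrite <- (csum_delta c N m Hm). apply csum_ext. intros k _.
    rewrite mean_scal, mean_cis by apply ccont_cis.
    destruct (Nat.eq_dec k m) as [->|n]; destruct (Z.eq_dec _ 0) as [e|e]; try ring.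
    + exfalso; apply e; ring.
    + exfalso; apply n, I. lia.
  - intros t. unfold trigpoly. rewrite Cmult_comm, <- csum_scal. apply csum_ext. intros k _.
    rewrite minus_IZR. replace ((IZR (nu k) - IZR (nu m)) * t)%R with (IZR (nu k) * t + - IZR (nu m) * t)%R by ring.
    rewrite cis_add. ring.
Qed.

Lemma csum_R (f : nat -> R) N : csum (fun k => RtoC (f k)) N = RtoC (sum_n f N).
Proof. induction N; rewrite ?csum_0, ?csum_S, ?sum_O, ?Rsum_n_S; [auto|]. rewrite IHN, RtoC_plus; auto. Qed.

Lemma Parseval_trigpoly nu c N : (forall i j, nu i = nu j -> i = j) ->
  mean (fun t => trigpoly nu c N t * Cconj (trigpoly nu c N t)) = RtoC (sum_n (fun k => (Cmod (c k) ^ 2)%R) N).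
Proof.
  intros I. rewrite mean_trigpoly_conj by apply ccont_trigpoly. rewrite <- csum_R. apply csum_ext. intros k Hk.
  rewrite fourier_trigpoly by auto. rewrite Cmod2_conj. ring.
Qed.

(** The mean square distance from [g] to its Fourier section is the mean square of [g] minus the
    sum of the squared coefficients. *)
Lemma Bessel g nu N : ccont g -> (forall i j, nu i = nu j -> i = j) ->
  (sum_n (fun k => (Cmod (fourier g (nu k)) ^ 2)%R) N <= mean_sq g)%R.
Proof.
  intros G I. set (c := fun k => fourier g (nu k)). set (p := trigpoly nu c N).
  assert (Cp : ccont p) by apply ccont_trigpoly.
  set (s := sum_n (fun k => (Cmod (fourier g (nu k)) ^ 2)%R) N).
  assert (E1 : mean (fun t => g t * Cconj (p t)) = RtoC s).
  { unfold p. rewrite mean_trigpoly_conj by auto. unfold s. rewrite <- csum_R. apply csum_ext. intros k Hk.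
    rewrite Cmod2_conj. unfold c. ring. }
  assert (E2 : mean (fun t => p t * Cconj (g t)) = RtoC s).
  { rewrite <- (Cconj_R s), <- E1, <- mean_conj by auto with ccont. apply mean_ext. intros t.
    rewrite Cmult_conj, Cconj_conj. ring. }
  assert (E3 : mean (fun t => p t * Cconj (p t)) = RtoC s) by (apply Parseval_trigpoly; auto).
  set (q := fun t => g t + (-1) * p t).
  assert (Cq : ccont q) by (unfold q; auto with ccont).
  assert (E4 : mean (fun t => q t * Cconj (q t)) = mean (fun t => g t * Cconj (g t)) - RtoC s).
  { rewrite (mean_ext _ (fun t => g t * Cconj (g t) + ((-1) * (g t * Cconj (p t)) + ((-1) * (p t * Cconj (g t)) + p t * Cconj (p t))))).
    - rewrite (mean_plus (fun t => g t * Cconj (g t))), (mean_plus (fun t => -1 * (g t * Cconj (p t)))),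
        (mean_plus (fun t => -1 * (p t * Cconj (g t)))), !mean_scal, E1, E2, E3 by auto 6 with ccont. ring.
    - intros t. unfold q. rewrite Cplus_conj, Cmult_conj, Cconj_m1. ring. }
  assert (P : (0 <= Re (mean (fun t => (q t * Cconj (q t))%C)))%R).
  { replace 0%R with (Re (mean (fun _ => 0))) by (rewrite mean_const; auto).
    apply mean_le; [auto with ccont..|]. intros t. rewrite <- Cmod2_conj, !re_RtoC. apply sq_pos. }
  rewrite E4 in P. unfold Cminus in P. rewrite re_plus, re_opp, re_RtoC in P. unfold mean_sq. lra.
Qed.

Lemma mean_sq_bound g M : ccont g -> (forall t, (Cmod (g t) <= M)%R) -> (mean_sq g <= M ^ 2)%R.
Proof.
  intros G H. replace (M ^ 2)%R with (Re (mean (fun _ => RtoC (M ^ 2)))) by (rewrite mean_const; auto).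
  unfold mean_sq. apply mean_le; [auto with ccont..|]. intros t. rewrite <- Cmod2_conj, !re_RtoC.
  specialize (H t). pose proof (Cmod_ge_0 (g t)). simpl. nra.
Qed.

Lemma fourier_bound g M n : ccont g -> (0 <= M)%R -> (forall t, (Cmod (g t) <= M)%R) -> (Cmod (fourier g n) <= M)%R.
Proof.
  intros G M0 H. pose proof (Bessel g (fun k => (n + Z.of_nat k)%Z) 0 G ltac:(intros i j E; simpl in E; lia)) as B.
  rewrite sum_O in B. rewrite Z.add_0_r in B. pose proof (mean_sq_bound g M G H). apply Rsq_le; auto. rewrite <- !Rsqr_pow2 in *. unfold Rsqr in *. lra.
Qed.

Lemma fourier_tends_0 g nu : ccont g -> (forall i j, nu i = nu j -> i = j) -> clim (fun k => fourier g (nu k)) 0.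
Proof.
  intros G I.
  destruct (ex_series_bounded (fun k => (Cmod (fourier g (nu k)) ^ 2)%R) (mean_sq g)) as [E _].
  { intros; apply sq_pos. } { intros; apply Bessel; auto. }
  apply ex_series_lim_0 in E. apply is_lim_seq_spec in E. intros e He.
  destruct (E (mkposreal (e * e) ltac:(nra))) as [N HN]. exists N. intros n Hn. specialize (HN n Hn). simpl in HN.
  replace (fourier g (nu n) - 0) with (fourier g (nu n)) by ring. rewrite Rminus_0_r, Rmult_1_r in HN.
  apply Rsq_le; [lra|]. apply Rabs_def2 in HN. lra.
Qed.

(** * Taylor expansions of bounded holomorphic functions *)

Lemma holomorphic_cdiff U f z : holomorphic_on U f -> U z -> exists l, cdiff f z l.
Proof. intros H Hz. destruct (H z Hz) as [l Hl]. exists l. apply is_derive_C_cdiff. exact Hl. Qed.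

Lemma Cmod_circle r t : (0 <= r)%R -> Cmod (RtoC r * cis t) = r.
Proof. intros. rewrite Cmod_mult, Cmod_cis, Cmod_R, Rabs_pos_eq; lra. Qed.

Lemma ccont_circle r : ccont (fun t => RtoC r * cis t).
Proof.
  apply ccont_mult; [apply ccont_const|].
  assert (E : cis = (fun t => cis (1 * t))) by (apply functional_extensionality; intros; f_equal; ring).
  rewrite E. exact (ccont_cis 1).
Qed.

Lemma ccont_on_circle f r : (0 <= r < 1)%R -> (forall z, disk z -> ccontinuous f z) -> ccont (fun t => f (RtoC r * cis t)).
Proof.
  intros Hr F. apply (ccont_compose f (fun t => RtoC r * cis t)); [|apply ccont_circle].
  intros t. apply F. unfold disk. rewrite Cmod_circle; lra.
Qed.

Section Taylor.
Variable f : C -> C.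
Hypothesis f_ball : Hinf_unit_ball f.

Lemma f_cdiff z : disk z -> exists l, cdiff f z l.
Proof. apply holomorphic_cdiff, f_ball. Qed.

Lemma f_continuous z : disk z -> ccontinuous f z.
Proof. intros H. destruct (f_cdiff z H) as [l Hl]. apply (cdiff_continuous _ _ _ Hl). Qed.

Definition hat (r : R) (n : Z) : C := fourier (fun t => f (RtoC r * cis t)) n.

(** In the coordinate [s = x + i y], [z = exp s], the function [f (exp s) exp (- n s)] is holomorphic
    for [x < 0] and has period [2 pi i], so its mean over a vertical period does not depend on [x]. *)
Lemma hat_const n x1 x2 : (x1 <= x2)%R -> (x2 < 0)%R ->
  RtoC (exp (- IZR n * x1)) * hat (exp x1) n = RtoC (exp (- IZR n * x2)) * hat (exp x2) n.
Proof.
  intros h12 h2.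
  set (G := fun s => f (cexp s) * cexp (RtoC (- IZR n) * s)).
  assert (E : forall x y, G (x, y) = RtoC (exp (- IZR n * x)) * (f (RtoC (exp x) * cis y) * cis (- IZR n * y))).
  { intros x y. unfold G, cexp. replace (Re (RtoC (- IZR n) * (x, y))) with (- IZR n * x)%R by (simpl; ring).
    replace (Im (RtoC (- IZR n) * (x, y))) with (- IZR n * y)%R by (simpl; ring). simpl Re. simpl Im. ring. }
  assert (EM : forall x, (x < 0)%R -> mean (fun y => G (x, y)) = RtoC (exp (- IZR n * x)) * hat (exp x) n).
  { intros x hx. rewrite (mean_ext _ _ (E x)). apply mean_scal. apply ccont_fourier. apply ccont_on_circle.
    - split; [left; apply exp_pos|]. rewrite <- exp_0. apply exp_increasing; auto.
    - apply f_continuous. }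
  rewrite <- !EM by lra.
  destruct (vertical_integral_const G x1 x2 0 (2 * PI)) as [I1 I2]; auto.
  - pose proof PI2_pos; lra.
  - intros x y hx.
    assert (D : disk (cexp (x, y))). { unfold disk. rewrite Cmod_cexp. simpl. rewrite <- exp_0. apply exp_increasing. lra. }
    destruct (f_cdiff _ D) as [l Hl]. eexists. unfold G.
    apply (cdiff_mult (fun s => f (cexp s)) (fun s => cexp (RtoC (- IZR n) * s))).
    + apply (cdiff_comp f cexp); [exact Hl|apply cdiff_cexp].
    + apply (cdiff_comp cexp (fun s => RtoC (- IZR n) * s)); [apply cdiff_cexp|].
      eapply cdiff_ext_loc; [|apply (cdiff_affine 0 (RtoC (- IZR n)))]. exists 1%R. split; [lra|]. intros; ring.
  - intros x. rewrite !E. rewrite Rmult_0_r, cis_0.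
    pose proof (cis_period 1) as P1. rewrite Rmult_1_l in P1. rewrite P1.
    pose proof (cis_period (- n)) as P2. rewrite opp_IZR in P2. rewrite P2. auto.
  - unfold mean. rewrite I1, I2. reflexivity.
Qed.

Lemma hat_bound r n : (0 <= r < 1)%R -> (Cmod (hat r n) <= 1)%R.
Proof.
  intros Hr. apply fourier_bound; [apply ccont_on_circle; auto; apply f_continuous|lra|].
  intros t. apply f_ball. unfold disk. rewrite Cmod_circle; lra.
Qed.

Definition laurent (n : Z) : C := RtoC (exp (IZR n)) * hat (exp (-1)) n.

Lemma hat_laurent x n : (x < 0)%R -> RtoC (exp (- IZR n * x)) * hat (exp x) n = laurent n.
Proof.
  intros hx. unfold laurent. replace (exp (IZR n)) with (exp (- IZR n * -1)) by (f_equal; ring).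
  destruct (Rle_dec x (-1)).
  - apply hat_const; lra.
  - symmetry. apply hat_const; lra.
Qed.

(** Shrinking the circle: as [f] is bounded, [exp (- n x)] tends to 0 when [x] tends to minus
    infinity. *)
Lemma laurent_neg n : (n < 0)%Z -> laurent n = 0.
Proof.
  intros Hn. apply Cmod_small. intros e He. set (x := Rmin (-1) (ln e)).
  assert (hx : (x <= -1 /\ x <= ln e)%R) by (split; [apply Rmin_l|apply Rmin_r]).
  rewrite <- (hat_laurent x n) by lra. rewrite Cmod_mult, Cmod_R, Rabs_pos_eq by (left; apply exp_pos).
  assert (B : (Cmod (hat (exp x) n) <= 1)%R).
  { apply hat_bound. split; [left; apply exp_pos|]. rewrite <- exp_0. apply exp_increasing; lra. }
  assert (exp (- IZR n * x) <= e)%R.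
  { rewrite <- (exp_ln e) by auto. assert (- IZR n * x <= ln e)%R.
    { assert (IZR n <= -1)%R by (apply IZR_le; lia). nra. }
    destruct H as [H|H]; [left; apply exp_increasing; auto|rewrite H; lra]. }
  pose proof (Cmod_ge_0 (hat (exp x) n)). pose proof (exp_pos (- IZR n * x)). nra.
Qed.

Definition taylor_coef (n : nat) : C := laurent (Z.of_nat n).

Lemma hat_pos r n : (0 < r < 1)%R -> hat r (Z.of_nat n) = taylor_coef n * RtoC r ^ n.
Proof.
  intros Hr. assert (hx : (ln r < 0)%R) by (rewrite <- ln_1; apply ln_increasing; lra).
  unfold taylor_coef. rewrite <- (hat_laurent (ln r)) by auto. rewrite exp_ln by lra.
  rewrite <- RtoC_pow, Cmult_comm, Cmult_assoc, <- RtoC_mult.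
  replace (r ^ n * exp (- IZR (Z.of_nat n) * ln r))%R with 1%R; [ring|].
  rewrite <- INR_IZR_INZ, <- Rpower_pow by lra. unfold Rpower. rewrite <- exp_plus.
  replace (INR n * ln r + - INR n * ln r)%R with 0%R by ring. rewrite exp_0; auto.
Qed.

Lemma hat_neg r n : (0 < r < 1)%R -> (n < 0)%Z -> hat r n = 0.
Proof.
  intros Hr Hn. assert (hx : (ln r < 0)%R) by (rewrite <- ln_1; apply ln_increasing; lra).
  pose proof (hat_laurent (ln r) n hx) as H. rewrite laurent_neg, exp_ln in H by (auto; lra).
  apply Cmod_eq_0. apply (f_equal Cmod) in H. rewrite Cmod_mult, Cmod_0, Cmod_R, Rabs_pos_eq in H by (left; apply exp_pos).
  pose proof (exp_pos (- IZR n * ln r)). apply Rmult_integral in H. lra.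
Qed.

(** Chernoff's proof of pointwise convergence: write [f - f w = (z - w) g] with [g] continuous on the
    circle.  Up to normalization the Fourier coefficients of [f - f w] are then differences of
    consecutive coefficients of [g], so the partial sums of the expansion at [w] telescope, and
    they converge because the coefficients of [g] tend to 0. *)
Lemma hat_recursion w r l n : disk w -> cdiff f w l -> (0 < r < 1)%R ->
  let g := fun t => dslope f w l (RtoC r * cis t) in
  hat r n - (if Z.eq_dec n 0 then f w else 0) = RtoC r * fourier g (n - 1) - w * fourier g n.
Proof.
  intros Hw Hl Hr g.
  assert (Cg : ccont g).
  { apply ccont_on_circle; [lra|]. intros z Hz. destruct (f_cdiff z Hz) as [m Hm].
    apply (ccontinuous_dslope f w l z m); auto. }
  assert (Cf : ccont (fun t => f (RtoC r * cis t))) by (apply ccont_on_circle; [lra|apply f_continuous]).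
  assert (Ec : (if Z.eq_dec n 0 then f w else 0) = mean (fun t => f w * cis (IZR (- n) * t))).
  { rewrite mean_scal, mean_cis by apply ccont_cis. destruct (Z.eq_dec n 0), (Z.eq_dec (- n) 0); try lia; ring. }
  rewrite Ec. unfold fourier. rewrite <- !mean_scal by auto with ccont.
  unfold hat, fourier.
  replace (mean (fun t => f (r * cis t) * cis (- IZR n * t)) - mean (fun t => f w * cis (IZR (- n) * t)))
    with (mean (fun t => f (r * cis t) * cis (- IZR n * t)) + (-1) * mean (fun t => f w * cis (IZR (- n) * t))) by ring.
  replace (mean (fun t => r * (g t * cis (- IZR (n - 1) * t))) - mean (fun t => w * (g t * cis (- IZR n * t))))
    with (mean (fun t => r * (g t * cis (- IZR (n - 1) * t))) + (-1) * mean (fun t => w * (g t * cis (- IZR n * t)))) by ring.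
  rewrite <- (mean_scal (-1) (fun t => f w * cis (IZR (- n) * t))), <- (mean_scal (-1) (fun t => w * (g t * cis (- IZR n * t)))) by auto with ccont.
  rewrite <- (mean_plus (fun t => f (r * cis t) * cis (- IZR n * t))), <- (mean_plus (fun t => r * (g t * cis (- IZR (n - 1) * t)))) by auto with ccont.
  apply mean_ext. intros t. rewrite opp_IZR, minus_IZR.
  replace (- (IZR n - 1) * t)%R with (t + - IZR n * t)%R by ring. rewrite cis_add.
  replace (f (r * cis t) * cis (- IZR n * t) + -1 * (f w * cis (- IZR n * t))) with ((f (r * cis t) - f w) * cis (- IZR n * t)) by ring.
  rewrite (dslope_eq f w l). fold (g t). ring.
Qed.

Lemma taylor_at w : disk w -> clim (csum (fun n => taylor_coef n * w ^ n)) (f w).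
Proof.
  intros Hw. destruct (excluded_middle_informative (w = 0)) as [->|w0].
  - assert (E : forall n, csum (fun n => taylor_coef n * 0 ^ n) n = taylor_coef 0).
    { induction n; rewrite ?csum_0, ?csum_S; [simpl; ring|]. rewrite IHn. simpl. ring. }
    assert (Z0 : taylor_coef 0 - f 0 = 0).
    { apply Cmod_small. intros e He. destruct (f_continuous 0 Hw e He) as [d [Hd H]].
      set (r := (Rmin (/2) (d / 2))%R). assert (Hr : (0 < r /\ r <= /2 /\ r <= d / 2)%R).
      { unfold r. split; [apply Rmin_pos; lra|split; [apply Rmin_l|apply Rmin_r]]. }
      assert (Cf : ccont (fun t => f (RtoC r * cis t))) by (apply ccont_on_circle; [lra|apply f_continuous]).
      pose proof (hat_pos r 0 ltac:(lra)) as hp. simpl in hp. rewrite Cmult_1_r in hp. rewrite <- hp.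
      replace (hat r 0 - f 0) with (fourier (fun t => f (RtoC r * cis t) + (- f 0)) 0).
      - apply fourier_bound; [apply ccont_plus; auto; apply ccont_const|lra|]. intros t. left. apply H.
        replace (r * cis t - 0) with (r * cis t) by ring. rewrite Cmod_circle; lra.
      - unfold hat, fourier. rewrite (mean_ext _ (fun t => f (RtoC r * cis t) + (- f 0))).
        + rewrite mean_plus, mean_const by (auto; apply ccont_const). unfold Cminus. f_equal. apply mean_ext. intros t.
          replace (- 0 * t)%R with 0%R by ring. rewrite cis_0. ring.
        + intros t. replace (- 0 * t)%R with 0%R by ring. rewrite cis_0. ring. }
    intros e He. exists 0%nat. intros n _. rewrite E, Z0, Cmod_0. lra.
  - destruct (f_cdiff w Hw) as [l Hl]. set (r := Cmod w). assert (Hr : (0 < r < 1)%R) by (split; [apply Cmod_gt_0; auto|exact Hw]).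
    pose proof (hat_recursion w r l) as Rec0. set (g := fun t => dslope f w l (RtoC r * cis t)) in *.
    assert (Rec : forall n, hat r n - (if Z.eq_dec n 0 then f w else 0) = RtoC r * fourier g (n - 1) - w * fourier g n).
    { intros n. apply (Rec0 n Hw Hl Hr). } clear Rec0.
    assert (Cg : ccont g).
    { apply ccont_on_circle; [lra|]. intros z Hz. destruct (f_cdiff z Hz) as [m Hm].
      apply (ccontinuous_dslope f w l z m); auto. }
    assert (r0 : RtoC r <> 0) by (intros H; apply RtoC_inj in H; lra).
    (* the coefficients of the quotient at -1, -2, ... have the same modulus, hence vanish *)
    assert (N : forall k, Cmod (fourier g (- (1 + Z.of_nat k))) = Cmod (fourier g (-1))).
    { induction k. { f_equal. } rewrite <- IHk.
      pose proof (Rec (- (1 + Z.of_nat k))%Z) as H. destruct (Z.eq_dec _ 0) as [e|_]; [lia|].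
      rewrite hat_neg in H by (auto; lia).
      replace (- (1 + Z.of_nat k) - 1)%Z with (- (1 + Z.of_nat (S k)))%Z in H by lia.
      assert (H' : RtoC r * fourier g (- (1 + Z.of_nat (S k))) = w * fourier g (- (1 + Z.of_nat k))).
      { replace (RtoC r * fourier g (- (1 + Z.of_nat (S k)))) with
          ((RtoC r * fourier g (- (1 + Z.of_nat (S k))) - w * fourier g (- (1 + Z.of_nat k))) + w * fourier g (- (1 + Z.of_nat k))) by ring.
        rewrite <- H. ring. }
      apply (f_equal Cmod) in H'. rewrite !Cmod_mult, Cmod_R, Rabs_pos_eq in H' by lra. fold r in H'.
      apply (Rmult_eq_reg_l r); lra. }
    assert (G1 : fourier g (-1) = 0).
    { apply Cmod_small. intros e He. destruct (fourier_tends_0 g (fun k => - (1 + Z.of_nat k))%Z Cg) with (eps := e) as [K HK]; auto.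
      { intros i j E; cbv beta in E; lia. }
      specialize (HK K (le_n _)). simpl in HK. rewrite <- (N K). replace (fourier g (- (1 + Z.of_nat K))) with (fourier g (- (1 + Z.of_nat K)) - 0) by ring. exact HK. }
    (* the partial sums telescope *)
    assert (T : forall n, csum (fun n => taylor_coef n * w ^ n) n - f w = - (RtoC r * ((w / r) ^ (S n) * fourier g (Z.of_nat n)))).
    { assert (Step : forall n, taylor_coef n * w ^ n = (w / r) ^ n * hat r (Z.of_nat n)).
      { intros n. rewrite hat_pos by auto. 
        replace (w ^ n) with ((w / r) ^ n * RtoC r ^ n). ring. rewrite <- Cpow_mult_l. f_equal. field; auto. }
      induction n.
      - rewrite csum_0, Step. pose proof (Rec 0%Z) as H. simpl in H. rewrite G1 in H. simpl.
        replace (1 * hat r 0 - f w) with (hat r 0 - f w) by ring. rewrite H. field; auto.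
      - rewrite csum_S, Step. pose proof (Rec (Z.of_nat (S n))) as H. destruct (Z.eq_dec _ 0) as [e|_]; [lia|].
        replace (Z.of_nat (S n) - 1)%Z with (Z.of_nat n) in H by lia.
        replace (hat r (Z.of_nat (S n))) with (RtoC r * fourier g (Z.of_nat n) - w * fourier g (Z.of_nat (S n))) by (rewrite <- H; ring).
        replace (csum (fun n0 => taylor_coef n0 * w ^ n0) n + (w / r) ^ S n * (r * fourier g (Z.of_nat n) - w * fourier g (Z.of_nat (S n))) - f w)
         with ((csum (fun n0 => taylor_coef n0 * w ^ n0) n - f w) + (w / r) ^ S n * (r * fourier g (Z.of_nat n) - w * fourier g (Z.of_nat (S n)))) by ring.
        rewrite IHn. rewrite (Cpow_S (w/r) (S n)). field; auto. }
    intros e He. destruct (fourier_tends_0 g Z.of_nat Cg) with (eps := e) as [K HK]; auto. { intros; lia. }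
    exists K. intros n Hn. specialize (HK n Hn). replace (fourier g (Z.of_nat n) - 0) with (fourier g (Z.of_nat n)) in HK by ring.
    rewrite T, Cmod_opp, !Cmod_mult, Cmod_pow, Cmod_div, Cmod_R, Rabs_pos_eq by (auto; lra). fold r.
    replace (r / r)%R with 1%R by (field; lra). rewrite pow1. pose proof (Cmod_ge_0 (fourier g (Z.of_nat n))). nra.
Qed.

Definition conv (a u : nat -> C) (n : nat) : C := csum (fun k => a (n - k)%nat * u k) n.

Lemma csum_trunc (x : nat -> C) n N : (n <= N)%nat -> csum (fun k => if le_dec k n then x k else 0) N = csum x n.
Proof.
  intros H. induction H.
  - apply csum_ext. intros k hk. destruct (le_dec k n); [auto|lia].
  - rewrite csum_S, IHle. destruct (le_dec (S m) n); [lia|ring].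
Qed.

Lemma pow_le_limit (X Y : R) K : (0 <= X)%R -> (forall r, (0 < r < 1)%R -> (r ^ K * X <= Y)%R) -> (X <= Y)%R.
Proof.
  intros X0 H. apply Rnot_lt_le. intros L.
  assert (C : continuous (fun r => (r ^ K * X)%R) 1%R).
  { apply (continuous_mult (K := R_AbsRing) (fun r => r ^ K)%R (fun _ => X)); [|apply continuous_const].
    apply (ex_derive_continuous (K := R_AbsRing) (V := R_NormedModule)). auto_derive. auto. }
  destruct (continuous_eps_inv _ _ C (X - Y)%R ltac:(lra)) as [d [Hd HC]].
  set (r := (1 - Rmin (d/2) (/2))%R). pose proof (Rmin_l (d/2) (/2)). pose proof (Rmin_r (d/2) (/2)).
  assert (0 < Rmin (d/2) (/2))%R by (apply Rmin_pos; lra).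
  specialize (HC r). specialize (H r ltac:(unfold r; lra)). rewrite pow1, Rmult_1_l in HC.
  assert (Rabs (r - 1) < d)%R. { unfold r. rewrite Rabs_left1; lra. }
  specialize (HC H3). apply Rabs_def2 in HC. lra.
Qed.

(** Multiplication by [f] contracts the Hardy norm.  On the circle of radius [r] let [p] be the
    polynomial with coefficients [u]: the first coefficients of [f p] are those of [conv], scaled by
    powers of [r], so Bessel's inequality, [|f p| <= |p|] and Parseval's identity for [p] give the
    claim up to a power of [r], which is removed by [r -> 1]. *)
Lemma conv_taylor_contraction u N :
  (sum_n (fun n => (Cmod (conv taylor_coef u n) ^ 2)%R) N <= sum_n (fun k => (Cmod (u k) ^ 2)%R) N)%R.
Proof.
  apply (pow_le_limit _ _ (2 * N)). { apply Rsum_n_pos. intros; apply sq_pos. }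
  intros r Hr. set (p := trigpoly Z.of_nat (fun k => u k * RtoC r ^ k) N).
  set (F := fun t => f (RtoC r * cis t)). set (g := fun t => F t * p t).
  assert (CF : ccont F) by (apply ccont_on_circle; [lra|apply f_continuous]).
  assert (Cp : ccont p) by apply ccont_trigpoly.
  assert (Cg : ccont g) by (apply ccont_mult; auto).
  assert (I : forall i j, Z.of_nat i = Z.of_nat j -> i = j) by (intros; lia).
  assert (Hg : forall n, (n <= N)%nat -> fourier g (Z.of_nat n) = RtoC r ^ n * conv taylor_coef u n).
  { intros n Hn. unfold fourier.
    rewrite (mean_ext _ (fun t => csum (fun k => (u k * RtoC r ^ k) * (F t * cis (- IZR (Z.of_nat n - Z.of_nat k) * t))) N)).
    - rewrite (mean_csum (fun k t => (u k * RtoC r ^ k) * (F t * cis (- IZR (Z.of_nat n - Z.of_nat k) * t)))).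
      2:{ auto with ccont. }
      unfold conv. rewrite <- csum_scal. rewrite <- (csum_trunc _ n N Hn). apply csum_ext. intros k Hk.
      rewrite mean_scal by auto with ccont. fold (fourier F (Z.of_nat n - Z.of_nat k)). change (fourier F (Z.of_nat n - Z.of_nat k)) with (hat r (Z.of_nat n - Z.of_nat k)).
      destruct (le_dec k n) as [h|h].
      + rewrite <- Nat2Z.inj_sub by auto. rewrite hat_pos by auto.
        replace (RtoC r ^ n) with (RtoC r ^ (n - k) * RtoC r ^ k). ring. rewrite <- Cpow_add_r. f_equal. lia.
      + rewrite hat_neg by (auto; lia). ring.
    - intros t. unfold g, p, trigpoly. rewrite (Cmult_comm (F t)), <- Cmult_assoc, Cmult_comm, <- csum_scal. apply csum_ext. intros k _.
      rewrite minus_IZR. replace (- (IZR (Z.of_nat n) - IZR (Z.of_nat k)) * t)%R with (- IZR (Z.of_nat n) * t + IZR (Z.of_nat k) * t)%R by ring.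
      rewrite cis_add. ring. }
  assert (B1 : (sum_n (fun k => (Cmod (fourier g (Z.of_nat k)) ^ 2)%R) N <= mean_sq g)%R) by (apply Bessel; auto).
  assert (B2 : (mean_sq g <= mean_sq p)%R).
  { apply mean_le; auto with ccont. intros t. rewrite <- !Cmod2_conj, !re_RtoC. unfold g. rewrite Cmod_mult.
    assert (Cmod (F t) <= 1)%R. { apply f_ball. unfold disk. rewrite Cmod_circle; lra. }
    pose proof (Cmod_ge_0 (F t)). pose proof (Cmod_ge_0 (p t)). rewrite Rpow_mult_distr.
    assert (Cmod (F t) ^ 2 <= 1)%R by nra. pose proof (sq_pos (Cmod (p t))). nra. }
  assert (B3 : mean_sq p = sum_n (fun k => (Cmod (u k * RtoC r ^ k) ^ 2)%R) N).
  { unfold mean_sq, p. rewrite Parseval_trigpoly by auto. apply re_RtoC. }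
  assert (B4 : (sum_n (fun k => (Cmod (u k * RtoC r ^ k) ^ 2)%R) N <= sum_n (fun k => (Cmod (u k) ^ 2)%R) N)%R).
  { apply Rsum_n_le. intros k _. rewrite Cmod_mult, Cmod_pow, Cmod_R, Rabs_pos_eq, Rpow_mult_distr by lra.
    assert (0 <= r ^ k <= 1)%R. { split; [apply pow_le; lra|]. rewrite <- (pow1 k). apply pow_incr; lra. }
    pose proof (sq_pos (Cmod (u k))). assert ((r ^ k) ^ 2 <= 1)%R by nra. nra. }
  assert (B5 : (r ^ (2 * N) * sum_n (fun n => (Cmod (conv taylor_coef u n) ^ 2)%R) N <= sum_n (fun k => (Cmod (fourier g (Z.of_nat k)) ^ 2)%R) N)%R).
  { replace (r ^ (2 * N) * sum_n (fun n => (Cmod (conv taylor_coef u n) ^ 2)%R) N)%R with (sum_n (fun n => (r ^ (2 * N) * (Cmod (conv taylor_coef u n) ^ 2))%R) N).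
    2:{ apply (sum_n_mult_l (K := R_AbsRing)). }
    apply Rsum_n_le. intros k Hk. rewrite Hg by auto. rewrite Cmod_mult, Cmod_pow, Cmod_R, Rabs_pos_eq, Rpow_mult_distr by lra.
    apply Rmult_le_compat_r; [apply sq_pos|]. rewrite <- pow_mult.
    replace (2 * N)%nat with (k * 2 + (2 * N - k * 2))%nat by lia. rewrite pow_add.
    assert (0 <= r ^ (2 * N - k * 2) <= 1)%R. { split; [apply pow_le; lra|]. rewrite <- (pow1 (2 * N - k * 2)). apply pow_incr; lra. }
    assert (0 <= r ^ (k * 2))%R by (apply pow_le; lra). nra. }
  lra.
Qed.
End Taylor.

(** * Power series with bounded coefficients *)

Definition peval (u : nat -> C) (z : C) : C := CSeries (fun n => u n * z ^ n).

Definition bseq (u : nat -> C) : Prop := exists M, forall n, (Cmod (u n) <= M)%R.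

Definition seq_shift (k : nat) (u : nat -> C) : nat -> C := fun n => u (k + n)%nat.

Lemma bseq_shift k u : bseq u -> bseq (seq_shift k u).
Proof. intros [M H]. exists M. intros n; apply H. Qed.

Lemma bseq_l2 u : l2 u -> bseq u.
Proof. intros H. exists (l2_norm u). intros n. apply l2_norm_coord; auto. Qed.

Lemma ex_series_geom_scal M q : (0 <= q < 1)%R -> ex_series (fun n => M * q ^ n)%R.
Proof. intros. apply (ex_series_scal (V := R_NormedModule) M (fun n => q ^ n)%R). apply ex_series_geom. rewrite Rabs_pos_eq; lra. Qed.

Lemma asum_peval u z : bseq u -> disk z -> asum (fun n => u n * z ^ n).
Proof.
  intros [M H] Hz. apply (asum_dom _ (fun n => M * Cmod z ^ n)%R).
  - intros n. rewrite Cmod_mult, Cmod_pow. apply Rmult_le_compat_r; auto. apply pow_le, Cmod_ge_0.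
  - apply ex_series_geom_scal. split; [apply Cmod_ge_0|exact Hz].
Qed.

Lemma Cmod_peval u z M : (forall n, (Cmod (u n) <= M)%R) -> disk z -> (Cmod (peval u z) <= M / (1 - Cmod z))%R.
Proof.
  intros H Hz. pose proof (Cmod_ge_0 z). unfold disk in Hz.
  eapply Rle_trans; [apply Cmod_CSeries, asum_peval; [exists M|]; auto|].
  unfold Rdiv. rewrite <- (Series_geom (Cmod z)) by (rewrite Rabs_pos_eq; lra). rewrite <- Series_scal_l.
  apply Series_le; [|apply ex_series_geom_scal; lra].
  intros n. split; [apply Cmod_ge_0|]. rewrite Cmod_mult, Cmod_pow. apply Rmult_le_compat_r; auto. apply pow_le, Cmod_ge_0.
Qed.

Lemma peval_step u z : bseq u -> disk z -> peval u z = u 0%nat + z * peval (seq_shift 1 u) z.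
Proof.
  intros B Hz. unfold peval. rewrite (CSeries_split _ 0) by (apply asum_peval; auto). rewrite csum_0. f_equal.
  - simpl; ring.
  - rewrite <- CSeries_scal by (apply asum_peval; auto using bseq_shift). apply CSeries_ext. intros n.
    unfold seq_shift. simpl. ring.
Qed.

Lemma peval_0 u : bseq u -> peval u 0 = u 0%nat.
Proof. intros B. rewrite peval_step by (auto; unfold disk; rewrite Cmod_0; lra). ring. Qed.

Lemma peval_plus u v z : bseq u -> bseq v -> disk z -> peval (vadd u v) z = peval u z + peval v z.
Proof.
  intros. unfold peval. rewrite <- CSeries_plus by (apply asum_peval; auto). apply CSeries_ext. intros; unfold vadd; ring.
Qed.

Lemma peval_scal c u z : bseq u -> disk z -> peval (vscal c u) z = c * peval u z.
Proof.
  intros. unfold peval. rewrite <- CSeries_scal by (apply asum_peval; auto). apply CSeries_ext. intros; unfold vscal; ring.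
Qed.

Lemma bseq_scal c u : bseq u -> bseq (vscal c u).
Proof. intros [M H]. exists (Cmod c * M)%R. intros n. unfold vscal. rewrite Cmod_mult. apply Rmult_le_compat_l; auto using Cmod_ge_0. Qed.

Lemma bseq_sub u v : bseq u -> bseq v -> bseq (vsub u v).
Proof.
  intros [M H] [N K]. exists (M + N)%R. intros n. unfold vsub, Cminus. eapply Rle_trans; [apply Cmod_triangle|].
  rewrite Cmod_opp. specialize (H n). specialize (K n). lra.
Qed.

Lemma peval_sub u v z : bseq u -> bseq v -> disk z -> peval (vsub u v) z = peval u z - peval v z.
Proof. intros. rewrite vsub_eq, peval_plus, peval_scal by auto using bseq_scal. ring. Qed.

(** Tails [sum_m u (n+m) w^m]; their shift gives the coefficients of the
    difference quotient of the power series at [w]. *)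
Definition tails (u : nat -> C) (w : C) (n : nat) : C := peval (seq_shift n u) w.

Lemma bseq_tails u w : bseq u -> disk w -> bseq (tails u w).
Proof.
  intros [M H] Hw. exists (M / (1 - Cmod w))%R. intros n. apply Cmod_peval; auto. intros k; apply H.
Qed.

Lemma tails_step u w n : bseq u -> disk w -> tails u w n = u n + w * tails u w (S n).
Proof.
  intros B Hw. unfold tails. rewrite peval_step by auto using bseq_shift. unfold seq_shift at 1. rewrite Nat.add_0_r. do 3 f_equal.
  funext k. unfold seq_shift. f_equal; lia.
Qed.

Lemma peval_quotient u w z : bseq u -> disk w -> disk z ->
  peval u z - peval u w = (z - w) * peval (seq_shift 1 (tails u w)) z.
Proof.
  intros B Hw Hz. pose proof (bseq_tails u w B Hw) as T. pose proof (bseq_shift 1 _ T) as T1.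
  pose proof (peval_step (tails u w) z T Hz) as E.
  assert (E2 : peval (vsub (tails u w) u) z = w * peval (seq_shift 1 (tails u w)) z).
  { rewrite <- peval_scal by auto. f_equal. funext n. unfold vsub, vscal, seq_shift.
    rewrite (tails_step u w n) by auto. simpl. ring. }
  rewrite peval_sub in E2 by auto.
  replace (peval u w) with (tails u w 0).
  - replace ((z - w) * peval (seq_shift 1 (tails u w)) z) with (z * peval (seq_shift 1 (tails u w)) z - w * peval (seq_shift 1 (tails u w)) z) by ring.
    rewrite <- E2. rewrite E at 1. ring.
  - unfold tails. f_equal.
Qed.

(** Taking difference quotients twice leaves the remainder [(y - w)^2 g2 (y)] with [g2] a power series
    with bounded coefficients, hence bounded near [w]. *)
Lemma cdiff_peval u w : bseq u -> disk w -> exists l, cdiff (peval u) w l.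
Proof.
  intros B Hw. set (g := seq_shift 1 (tails u w)). assert (Bg : bseq g) by (apply bseq_shift, bseq_tails; auto).
  set (g2 := seq_shift 1 (tails g w)). assert (Bg2 : bseq g2) by (apply bseq_shift, bseq_tails; auto).
  exists (peval g w). intros e He. destruct Bg2 as [M HM].
  assert (M0 : (0 <= M)%R) by (eapply Rle_trans; [apply Cmod_ge_0|apply (HM 0%nat)]).
  unfold disk in Hw. set (t := ((1 - Cmod w) / 2)%R). assert (Ht : (0 < t)%R) by (unfold t; lra).
  exists (Rmin t (e * t / (M + 1))). split. { apply Rmin_pos; auto. apply Rdiv_lt_0_compat; nra. }
  intros y Hy. pose proof (Rmin_l t (e * t / (M + 1))). pose proof (Rmin_r t (e * t / (M + 1))).
  assert (Hy1 : (Cmod y <= Cmod w + Cmod (y - w))%R).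
  { eapply Rle_trans; [|apply Cmod_triangle]. right; f_equal; ring. }
  assert (Dy : disk y) by (unfold disk, t in *; lra).
  rewrite peval_quotient by auto. fold g.
  replace ((y - w) * peval g y - (y - w) * peval g w) with ((y - w) * (peval g y - peval g w)) by ring.
  rewrite (peval_quotient g w y) by auto. fold g2. rewrite !Cmod_mult, Rmult_comm.
  apply Rmult_le_compat_r; [apply Cmod_ge_0|].
  pose proof (Cmod_peval g2 y M HM Dy) as K.
  assert (K2 : (M / (1 - Cmod y) <= M / t)%R).
  { unfold Rdiv. apply Rmult_le_compat_l; auto. apply Rinv_le_contravar; auto. unfold t in *. lra. }
  apply Rle_trans with (e * t / (M + 1) * (M / t))%R.
  - apply Rmult_le_compat; try apply Cmod_ge_0; lra.
  - replace (e * t / (M + 1) * (M / t))%R with (e * (M / (M + 1)))%R by (field; lra).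
    rewrite <- (Rmult_1_r e) at 2. apply Rmult_le_compat_l; [lra|]. apply (Rmult_le_reg_r (M + 1)%R); [lra|].
    unfold Rdiv. rewrite Rmult_assoc, Rinv_l; lra.
Qed.

(** If the coefficients below [n] vanish, dividing by [x^n] at zeros [x -> 0] shows that so does
    the [n]-th one. *)
Lemma peval_identity u : bseq u ->
  (forall d, (0 < d)%R -> exists x : C, x <> 0 /\ (Cmod x < d)%R /\ disk x /\ peval u x = 0) -> u = vzero.
Proof.
  intros B H.
  assert (K : forall n, forall k, (k < n)%nat -> u k = 0).
  { induction n; [lia|]. intros k Hk. destruct (Nat.eq_dec k n) as [->|]; [|apply IHn; lia].
    assert (F : forall x, disk x -> forall m, (m <= n)%nat -> peval u x = x ^ m * peval (seq_shift m u) x).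
    { intros x Hx. induction m; intros Hm. { simpl. unfold seq_shift; simpl. rewrite Cmult_1_l. f_equal. }
      rewrite IHm by lia. rewrite (peval_step (seq_shift m u)) by auto using bseq_shift. unfold seq_shift at 1.
      rewrite Nat.add_0_r, IHn by lia. simpl. replace (seq_shift 1 (seq_shift m u)) with (seq_shift (S m) u). ring.
      funext i. unfold seq_shift. f_equal; lia. }
    assert (D0 : disk 0) by (unfold disk; rewrite Cmod_0; lra).
    destruct (cdiff_peval (seq_shift n u) 0 (bseq_shift n u B) D0) as [l Hl].
    pose proof (cdiff_continuous _ _ _ Hl) as Cn.
    replace (u n) with (peval (seq_shift n u) 0).
    2:{ rewrite peval_0 by auto using bseq_shift. unfold seq_shift. f_equal; lia. }
    apply Cmod_small. intros e He. destruct (Cn e He) as [d [Hd Kd]].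
    destruct (H d Hd) as (x & x0 & xd & Dx & Ex). rewrite (F x Dx n) in Ex by lia.
    assert (X : peval (seq_shift n u) x = 0).
    { apply Cmod_eq_0. apply (f_equal Cmod) in Ex. rewrite Cmod_mult, Cmod_0, Cmod_pow in Ex.
      apply Rmult_integral in Ex. destruct Ex as [Ex|]; auto. pose proof (pow_nonzero (Cmod x) n). 
      pose proof (proj1 (Cmod_gt_0 x) x0). lra. }
    replace (peval (seq_shift n u) 0) with (- (peval (seq_shift n u) x - peval (seq_shift n u) 0)) by (rewrite X; ring).
    rewrite Cmod_opp. left. apply Kd. replace (x - 0) with x by ring. auto. }
  funext n. apply (K (S n)). lia.
Qed.

Lemma small_disk_point d : (0 < d)%R -> exists x : C, x <> 0 /\ (Cmod x < d)%R /\ disk x.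
Proof.
  intros Hd. exists (RtoC (Rmin d 1 / 2)). pose proof (Rmin_l d 1). pose proof (Rmin_r d 1). pose proof (Rmin_pos d 1 Hd ltac:(lra)).
  unfold disk. rewrite Cmod_R, Rabs_pos_eq by lra. split; [|split; lra]. intros E. apply RtoC_inj in E. lra.
Qed.

Lemma peval_inj u v : bseq u -> bseq v -> (forall z, disk z -> peval u z = peval v z) -> u = v.
Proof.
  intros U V H. assert (E : vsub u v = vzero).
  { apply peval_identity; auto using bseq_sub. intros d Hd. destruct (small_disk_point d Hd) as (x & x0 & xd & Dx).
    exists x. repeat split; auto. rewrite peval_sub, H by auto. ring. }
  funext n. apply (f_equal (fun w => w n)) in E. unfold vsub, vzero in E.
  replace (u n) with (u n - v n + v n) by ring. rewrite E. ring.
Qed.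

Lemma pow_n_Cpow (z : C) n : @pow_n C_Ring z n = z ^ n.
Proof. induction n; simpl; auto. Qed.

Lemma is_pseries_clim a z l : @is_pseries C_AbsRing C_NormedModule a z l <-> clim (csum (fun n => a n * z ^ n)) l.
Proof.
  assert (E : forall n, @sum_n C_NormedModule (fun k => scal (@pow_n C_Ring z k) (a k)) n = csum (fun n => a n * z ^ n) n).
  { intros n. unfold csum. apply (sum_n_ext (G := C_AbelianMonoid)). intros k. rewrite pow_n_Cpow. apply Cmult_comm. }
  unfold is_pseries, is_series. split.
  - intros H e He. pose proof (proj1 (filterlim_locally_ball_norm (K := C_AbsRing) (U := C_NormedModule) _ _) H) as H2. clear H. rename H2 into H.
    destruct (H (mkposreal e He)) as [N HN]. exists N. intros n Hn. specialize (HN n Hn). left. rewrite <- E. exact HN.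
  - intros H. apply (filterlim_locally_ball_norm (K := C_AbsRing) (U := C_NormedModule)). intros e.
    destruct (H (e / 2)%R) as [N HN]. { pose proof (cond_pos e); lra. } exists N. intros n Hn. specialize (HN n Hn).
    rewrite <- E in HN. unfold ball_norm. apply Rle_lt_trans with (e / 2)%R; [exact HN|]. pose proof (cond_pos e); lra.
Qed.

Lemma bseq_eventually u M N : (forall n, (N <= n)%nat -> (Cmod (u n) <= M)%R) -> bseq u.
Proof.
  intros H. exists (sum_n (fun k => Cmod (u k)) N + Rabs M)%R. intros n. pose proof (Rabs_pos M). pose proof (Rle_abs M).
  pose proof (Rsum_n_pos (fun k => Cmod (u k)) N (fun k => Cmod_ge_0 _)).
  destruct (Nat.le_gt_cases N n) as [h|h].
  - specialize (H n h). lra.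
  - pose proof (Rsum_n_mono (fun k => Cmod (u k)) n N (fun k => Cmod_ge_0 _) ltac:(lia)) as P.
    assert (Cmod (u n) <= sum_n (fun k => Cmod (u k)) n)%R; [|lra].
    destruct n; rewrite ?sum_O, ?Rsum_n_S; [lra|]. pose proof (Rsum_n_pos (fun k => Cmod (u k)) n (fun k => Cmod_ge_0 _)). lra.
Qed.

Lemma clim_csum_bseq a l : clim (csum a) l -> bseq a.
Proof.
  intros H. destruct (H 1%R ltac:(lra)) as [N HN]. apply (bseq_eventually a 2 (S N)). intros n Hn.
  destruct n as [|n]; [lia|]. pose proof (HN n ltac:(lia)) as H1. pose proof (HN (S n) ltac:(lia)) as H2. rewrite csum_S in H2.
  replace (a (S n)) with ((csum a n + a (S n) - l) - (csum a n - l)) by ring.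
  unfold Cminus at 1. eapply Rle_trans; [apply Cmod_triangle|]. rewrite Cmod_opp. lra.
Qed.

(** Rescaling the variable by 1/2 makes the coefficients bounded, as terms of a convergent series. *)
Lemma expansion_unique a a' (f : C -> C) :
  (forall z, disk z -> clim (csum (fun n => a n * z ^ n)) (f z)) ->
  (forall z, disk z -> clim (csum (fun n => a' n * z ^ n)) (f z)) -> a = a'.
Proof.
  intros A A'. set (h := RtoC (/2)). 
  assert (Dh : forall z, disk z -> disk (h * z)).
  { intros z Hz. unfold disk in *. unfold h. rewrite Cmod_mult, Cmod_R, Rabs_pos_eq by lra. pose proof (Cmod_ge_0 z). lra. }
  assert (Hh : disk h). { unfold disk, h. rewrite Cmod_R, Rabs_pos_eq; lra. }
  pose proof (clim_csum_bseq _ _ (A h Hh)) as B. pose proof (clim_csum_bseq _ _ (A' h Hh)) as B'.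
  assert (P : forall c : nat -> C, (forall z, disk z -> clim (csum (fun n => c n * z ^ n)) (f z)) -> bseq (fun n => c n * h ^ n) ->
     forall z, disk z -> peval (fun n => c n * h ^ n) z = f (h * z)).
  { intros c Hc Bc z Hz. apply (clim_unique (csum (fun n => c n * h ^ n * z ^ n))).
    - apply clim_CSeries. apply (asum_peval (fun n => c n * h ^ n)); auto.
    - specialize (Hc (h * z) (Dh z Hz)). replace (fun n => c n * h ^ n * z ^ n) with (fun n => c n * (h * z) ^ n); auto.
      funext n. rewrite Cpow_mult_l. ring. }
  assert (E : (fun n => a n * h ^ n) = (fun n => a' n * h ^ n)).
  { apply peval_inj; auto. intros z Hz. rewrite !P; auto. }
  funext n. apply (f_equal (fun w => w n)) in E. cbv beta in E.
  assert (h0 : h ^ n <> 0). { apply Cpow_nz. intros K. apply RtoC_inj in K. lra. }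
  replace (a n) with (a n * h ^ n / h ^ n) by (field; auto). rewrite E. field; auto.
Qed.

Lemma taylor_eq f : Hinf_unit_ball f -> taylor f = taylor_coef f.
Proof.
  intros Hf. assert (T : forall z, disk z -> @is_pseries C_AbsRing C_NormedModule (taylor f) z (f z)).
  { unfold taylor. apply epsilon_spec. exists (taylor_coef f). intros z Hz. apply is_pseries_clim. apply taylor_at; auto. }
  apply (expansion_unique _ _ f); intros z Hz.
  - apply is_pseries_clim; auto.
  - apply taylor_at; auto.
Qed.

(** * Toeplitz operators and the reproducing kernel of H(b) *)

Definition trunc (v : nat -> C) (N : nat) : nat -> C := fun k => if le_dec k N then v k else 0.

Lemma l2_trunc v N : l2 (trunc v N).
Proof. apply (l2_finite _ N). intros k Hk. unfold trunc. destruct (le_dec k N); [lia|auto]. Qed.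

#[global] Hint Resolve l2_trunc : l2.

Lemma sqnorm_trunc v N : sqnorm (trunc v N) = sum_n (fun k => (Cmod (v k) ^ 2)%R) N.
Proof.
  unfold sqnorm. rewrite (Series_incr_n _ (S N)); [|lia|exact (l2_trunc v N)]. simpl pred. rewrite <- sum_n_Reals.
  rewrite (Series_ext (fun k => (Cmod (trunc v N (S N + k)) ^ 2)%R) (fun _ => 0 * 0)%R), Series_scal_l, Rmult_0_l, Rplus_0_r.
  - apply sum_n_ext_loc. intros k Hk. unfold trunc. destruct (le_dec k N); [auto|lia].
  - intros k. unfold trunc. destruct (le_dec (S N + k) N); [lia|]. rewrite Cmod_0. ring.
Qed.

Lemma l2lim_trunc v : l2 v -> l2lim (trunc v) v.
Proof.
  intros V e He. destruct (ex_series_tail (fun k => (Cmod (v k) ^ 2)%R) (fun k => sq_pos _) V (e * e)%R) as [N HN]; [nra|].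
  exists N. intros n Hn. apply l2_norm_le; auto with l2; [lra|]. eapply Rle_trans; [|apply (HN n Hn)]. right.
  unfold sqnorm. rewrite (Series_incr_n _ (S n)); [|lia|exact (l2_sub _ _ (l2_trunc v n) V)]. simpl pred. rewrite <- sum_n_Reals.
  rewrite (sum_n_ext_loc _ (fun _ => 0%R)).
  - rewrite sum_n_const, Rmult_0_r, Rplus_0_l. apply Series_ext. intros k. unfold vsub, trunc. destruct (le_dec (S n + k) n); [lia|].
    replace (0 - v (S n + k)%nat) with (- v (S n + k)%nat) by ring. rewrite Cmod_opp. auto.
  - intros k Hk. unfold vsub, trunc. destruct (le_dec k n); [|lia]. replace (v k - v k) with (RtoC 0) by ring. rewrite Cmod_0. change ((0 ^ 2)%R = 0%R). ring.
Qed.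

Definition unit_vec (m : nat) : nat -> C := fun k => if Nat.eq_dec k m then 1 else 0.

Lemma l2_unit m : l2 (unit_vec m).
Proof. apply (l2_finite _ m). intros k Hk. unfold unit_vec. destruct (Nat.eq_dec k m); [lia|auto]. Qed.
#[global] Hint Resolve l2_unit : l2.

Lemma trunc_0 v : trunc v 0 = vscal (v 0%nat) (unit_vec 0).
Proof. funext k. unfold trunc, vscal, unit_vec. destruct (le_dec k 0), (Nat.eq_dec k 0); subst; try lia; ring. Qed.

Lemma trunc_S v N : trunc v (S N) = vadd (trunc v N) (vscal (v (S N)) (unit_vec (S N))).
Proof.
  funext k. unfold trunc, vadd, vscal, unit_vec.
  destruct (le_dec k (S N)), (le_dec k N), (Nat.eq_dec k (S N)); subst; try lia; ring.
Qed.

Definition conv_adj (a u : nat -> C) (n : nat) : C := CSeries (fun j => Cconj (a j) * u (n + j)%nat).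

Lemma l2_shift n u : l2 u -> l2 (fun j => u (n + j)%nat).
Proof. intros U. destruct n; [exact U|]. apply (ex_series_incr_n (fun k => (Cmod (u k) ^ 2)%R) (S n)). exact U. Qed.

Lemma CSeries_shift n (x : nat -> C) : (forall k, (k < n)%nat -> x k = 0) -> asum (fun j => x (n + j)%nat) ->
  CSeries x = CSeries (fun j => x (n + j)%nat).
Proof.
  intros H A. destruct n as [|n]; [reflexivity|]. rewrite (CSeries_split x n).
  - rewrite (csum_ext _ (fun _ => 0)). rewrite csum_zero. ring. intros; apply H; lia.
  - apply (ex_series_incr_n (fun k => Cmod (x k)) (S n)). exact A.
Qed.

Section Multiplier.
Variable b : C -> C.
Hypothesis b_ball : Hinf_unit_ball b.

Let a := taylor_coef b.

Lemma conv_l2_bound u : l2 u -> l2 (conv a u) /\ (sqnorm (conv a u) <= sqnorm u)%R.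
Proof.
  intros U. apply ex_series_bounded. { intros; apply sq_pos. }
  intros n. eapply Rle_trans; [apply (conv_taylor_contraction b b_ball)|]. apply sum_le_Series; auto. intros; apply sq_pos.
Qed.

Lemma conv_l2 u : l2 u -> l2 (conv a u).
Proof. apply conv_l2_bound. Qed.

Lemma l2_norm_mono u v : l2 u -> l2 v -> (sqnorm u <= sqnorm v)%R -> (l2_norm u <= l2_norm v)%R.
Proof. intros. apply l2_norm_le; auto using l2_norm_pos. rewrite l2_norm_sq; auto. Qed.

Lemma conv_bound : op_bound (conv a) 1.
Proof. intros u U. rewrite Rmult_1_l. apply l2_norm_mono; auto; apply conv_l2_bound; auto. Qed.

Lemma conv_lin : lin_op (conv a).
Proof.
  repeat split.
  - apply conv_l2.
  - intros u v _ _. funext n. unfold conv, vadd. rewrite <- csum_plus. apply csum_ext; intros; ring.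
  - intros c u _. funext n. unfold conv, vscal. rewrite <- csum_scal. apply csum_ext; intros; ring.
Qed.

Lemma conv_unit m n : conv a (unit_vec m) n = if le_dec m n then a (n - m)%nat else 0.
Proof.
  unfold conv, unit_vec. destruct (le_dec m n).
  - rewrite <- (csum_delta (fun k => a (n - k)%nat) n m) by auto. apply csum_ext. intros k _. destruct (Nat.eq_dec k m); ring.
  - transitivity (csum (fun _ => 0) n); [|apply csum_zero]. apply csum_ext. intros k hk. destruct (Nat.eq_dec k m); [lia|ring].
Qed.

Lemma l2_taylor : l2 a.
Proof.
  replace a with (conv a (unit_vec 0)). { apply conv_l2; auto with l2. }
  funext n. rewrite conv_unit. destruct (le_dec 0 n); [f_equal|]; lia.
Qed.
Hint Resolve conv_l2 l2_taylor : l2.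

Lemma asum_adj u n : l2 u -> asum (fun j => Cconj (a j) * u (n + j)%nat).
Proof. intros U. apply (l2_prod (fun j => Cconj (a j))); [apply l2_conj, l2_taylor|apply l2_shift; auto]. Qed.

Lemma conv_unit_inner m u : l2 u -> l2_inner (conv a (unit_vec m)) u = Cconj (conv_adj a u m).
Proof.
  intros U. unfold l2_inner, conv_adj. rewrite CSeries_conj.
  assert (E : forall j, conv a (unit_vec m) (m + j)%nat * Cconj (u (m + j)%nat) = Cconj (Cconj (a j) * u (m + j)%nat)).
  { intros j. rewrite conv_unit. destruct (le_dec m (m + j)); [|lia]. rewrite Cmult_conj, Cconj_conj. do 2 f_equal. lia. }
  rewrite (CSeries_shift m).
  - apply CSeries_ext; auto.
  - intros k Hk. rewrite conv_unit. destruct (le_dec m k); [lia|ring].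
  - eapply asum_dom; [|apply (asum_conj _ (asum_adj u m U))]. intros j. rewrite E. apply Rle_refl.
Qed.

Lemma conv_trunc_inner v u N : l2 u -> l2_inner (conv a (trunc v N)) u = csum (fun m => v m * Cconj (conv_adj a u m)) N.
Proof.
  intros U. destruct conv_lin as (c1 & c2 & c3). induction N.
  - rewrite trunc_0, c3, inner_scal_l, conv_unit_inner, csum_0 by auto with l2. auto.
  - rewrite trunc_S, c2, c3, inner_add_l, inner_scal_l, conv_unit_inner, IHN, csum_S by auto with l2. auto.
Qed.

(** Pairing with the truncation [v] of [conv_adj a u] gives [|v|^2 = <conv a v, u> <= |v| |u|]. *)
Lemma conv_adj_l2_bound u : l2 u -> l2 (conv_adj a u) /\ (sqnorm (conv_adj a u) <= sqnorm u)%R.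
Proof.
  intros U. apply ex_series_bounded. { intros; apply sq_pos. }
  intros N. rewrite <- sqnorm_trunc. set (v := trunc (conv_adj a u) N).
  assert (E : l2_inner (conv a v) u = RtoC (sqnorm v)).
  { unfold v. rewrite conv_trunc_inner, sqnorm_trunc, <- csum_R by auto. apply csum_ext. intros k _. rewrite Cmod2_conj. auto. }
  assert (V : l2 v) by (unfold v; auto with l2).
  pose proof (Cauchy_Schwarz_sq (conv a v) u ltac:(auto with l2) U) as CS. rewrite E, Cmod_R, Rabs_pos_eq in CS by (apply sqnorm_pos; auto).
  pose proof (proj2 (conv_l2_bound v V)). pose proof (sqnorm_pos u U). pose proof (sqnorm_pos v V).
  apply Rnot_lt_le. intros L. nra.
Qed.

Lemma conv_adj_l2 u : l2 u -> l2 (conv_adj a u).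
Proof. apply conv_adj_l2_bound. Qed.
Hint Resolve conv_adj_l2 : l2.

(** Both sides are limits of their values at truncations of [v], where the identity is a finite sum. *)
Lemma conv_adjoint v u : l2 v -> l2 u -> l2_inner (conv a v) u = l2_inner v (conv_adj a u).
Proof.
  intros V U. apply (clim_unique (fun N => l2_inner (conv a (trunc v N)) u)).
  - intros e He. pose proof (l2_norm_pos u).
    destruct (l2lim_trunc v V (e / (l2_norm u + 1))%R) as [N HN]. { apply Rdiv_lt_0_compat; lra. }
    exists N. intros n Hn. specialize (HN n Hn). rewrite <- inner_sub_l, <- (lin_sub (conv a)) by (auto using conv_lin with l2).
    eapply Rle_trans; [apply Cauchy_Schwarz; auto with l2|].
    pose proof (conv_bound (vsub (trunc v n) v) ltac:(auto with l2)). pose proof (l2_norm_pos (conv a (vsub (trunc v n) v))).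
    apply Rle_trans with (e / (l2_norm u + 1) * (l2_norm u + 1))%R; [|right; field; lra].
    apply Rmult_le_compat; lra.
  - replace (fun N => l2_inner (conv a (trunc v N)) u) with (csum (fun m => v m * Cconj (conv_adj a u m))).
    + apply clim_CSeries, asum_inner; auto with l2.
    + funext N. rewrite conv_trunc_inner; auto.
Qed.

Lemma conv_adj_lin : lin_op (conv_adj a).
Proof.
  repeat split.
  - apply conv_adj_l2.
  - intros u v U V. funext n. unfold conv_adj, vadd.
    rewrite <- CSeries_plus by (apply asum_adj; auto). apply CSeries_ext; intros; ring.
  - intros c u U. funext n. unfold conv_adj, vscal.
    rewrite <- CSeries_scal by (apply asum_adj; auto). apply CSeries_ext; intros; ring.
Qed.

Lemma CSeriesZ_nonneg (x : Z -> C) : (forall n, x (- Z.of_nat (S n))%Z = 0) -> CSeriesZ x = CSeries (fun n => x (Z.of_nat n)).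
Proof. intros H. unfold CSeriesZ. rewrite (CSeries_ext (fun n => x (- Z.of_nat (S n))%Z) (fun _ => 0)), CSeries_0 by auto. ring. Qed.

Lemma H2_to_L2_neg u k : (k < 0)%Z -> H2_to_L2 u k = 0.
Proof. intros H. unfold H2_to_L2. apply Z.ltb_lt in H. rewrite H. auto. Qed.

Lemma H2_to_L2_nat u n : H2_to_L2 u (Z.of_nat n) = u n.
Proof. unfold H2_to_L2. destruct (Z.ltb_spec (Z.of_nat n) 0); [lia|]. rewrite Nat2Z.id. auto. Qed.

Lemma toeplitz_conv c u : toeplitz (H2_to_L2 c) u = conv c u.
Proof.
  funext n. unfold toeplitz, riesz_proj, L2_mult.
  rewrite CSeriesZ_nonneg by (intros; rewrite (H2_to_L2_neg u) by lia; ring).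
  rewrite (CSeries_finite _ n).
  - unfold conv. apply csum_ext. intros k Hk. rewrite H2_to_L2_nat. rewrite <- Nat2Z.inj_sub by auto. rewrite H2_to_L2_nat. auto.
  - intros k Hk. rewrite (H2_to_L2_neg c) by lia. ring.
Qed.

Lemma toeplitz_conv_adj u : l2 u -> toeplitz (L2_conj (H2_to_L2 a)) u = conv_adj a u.
Proof.
  intros U. funext n. unfold toeplitz, riesz_proj, L2_mult, L2_conj.
  rewrite CSeriesZ_nonneg by (intros; rewrite (H2_to_L2_neg u) by lia; ring).
  assert (E : forall j, Cconj (H2_to_L2 a (- (Z.of_nat n - Z.of_nat (n + j)))) * H2_to_L2 u (Z.of_nat (n + j)) = Cconj (a j) * u (n + j)%nat).
  { intros j. replace (- (Z.of_nat n - Z.of_nat (n + j)))%Z with (Z.of_nat j) by lia. rewrite !H2_to_L2_nat. auto. }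
  rewrite (CSeries_shift n).
  - apply CSeries_ext; auto.
  - intros k Hk. rewrite (H2_to_L2_neg a) by lia. rewrite Cconj_R. ring.
  - eapply asum_dom; [|apply (asum_adj u n U)]. intros j. cbv beta. rewrite E. apply Rle_refl.
Qed.

Lemma defect_op_eq u : l2 u -> defect_op b u = vsub u (conv a (conv_adj a u)).
Proof.
  intros U. unfold defect_op. rewrite taylor_eq by auto. fold a. rewrite toeplitz_conv, toeplitz_conv_adj by auto. reflexivity.
Qed.


Lemma sqrt_op_spec : positive_op (sqrt_op (defect_op b)) /\
  forall u, l2 u -> sqrt_op (defect_op b) (sqrt_op (defect_op b) u) = defect_op b u.
Proof.
  assert (H : exists A, positive_op A /\ forall u, l2 u -> forall n, A (A u) n = defect_op b u n).
  { destruct (sqrt_exists (fun u => conv a (conv_adj a u))) as [A [HA HS]].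
    - destruct conv_lin as (c1 & c2 & c3), conv_adj_lin as (d1 & d2 & d3). repeat split; intros; auto with l2.
      + rewrite d2, c2; auto with l2.
      + rewrite d3, c3; auto with l2.
    - intros u U. pose proof (conv_bound (conv_adj a u) ltac:(auto with l2)).
      pose proof (l2_norm_mono _ _ (conv_adj_l2 u U) U (proj2 (conv_adj_l2_bound u U))). lra.
    - intros u v U V. rewrite conv_adjoint by auto with l2.
      rewrite (inner_conj (conv_adj a v)), (inner_conj (conv a (conv_adj a v)) u), conv_adjoint; auto with l2.
    - exists A. split; auto. intros u U n. rewrite HS, defect_op_eq by auto. auto. }
  destruct (epsilon_spec (inhabits (fun u => u)) _ H) as [E1 E2]. split; [exact E1|].
  intros u U. apply functional_extensionality. apply E2; auto.
Qed.

Definition szego (w : C) : nat -> C := fun n => Cconj w ^ n.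

Lemma disk_conj w : disk w -> disk (Cconj w).
Proof. unfold disk. rewrite Cmod_conj. auto. Qed.

Lemma bseq_one : bseq (fun _ => 1).
Proof. exists 1%R. intros. rewrite Cmod_1. lra. Qed.

Lemma l2_szego w : disk w -> l2 (szego w).
Proof.
  intros Hw. apply (ex_series_ext (fun n => (Cmod w ^ 2) ^ n)%R).
  - intros n. unfold szego. rewrite Cmod_pow, Cmod_conj, <- !pow_mult. f_equal; lia.
  - apply ex_series_geom. unfold disk in Hw. pose proof (Cmod_ge_0 w). rewrite Rabs_pos_eq; nra.
Qed.
Hint Resolve l2_szego : l2.

Lemma inner_szego u w : l2_inner u (szego w) = peval u w.
Proof. unfold l2_inner, peval. apply CSeries_ext. intros n. unfold szego. rewrite <- Cpow_conj, Cconj_conj. auto. Qed.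

Lemma one_minus_neq0 q : disk q -> 1 - q <> 0.
Proof.
  intros H E. assert (q = 1). { replace q with (1 - (1 - q)) by ring. rewrite E. ring. }
  subst. unfold disk in H. rewrite Cmod_1 in H. lra.
Qed.

Lemma disk_mult z w : disk z -> disk w -> disk (z * w).
Proof. unfold disk. intros. rewrite Cmod_mult. pose proof (Cmod_ge_0 z). pose proof (Cmod_ge_0 w). nra. Qed.

Lemma Cseries_geom q : disk q -> CSeries (fun n => q ^ n) = / (1 - q).
Proof.
  intros H. assert (E : peval (fun _ => 1) q = 1 + q * peval (fun _ => 1) q) by (apply (peval_step (fun _ => 1)); auto using bseq_one).
  rewrite (CSeries_ext _ (fun n => 1 * q ^ n)) by (intros; ring). fold (peval (fun _ => 1) q). pose proof (one_minus_neq0 q H).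
  set (s := peval (fun _ => 1) q) in *. replace s with ((s - q * s) / (1 - q)) by (field; auto). rewrite E at 1. field; auto.
Qed.

Lemma peval_szego w z : disk w -> disk z -> peval (szego w) z = / (1 - Cconj w * z).
Proof.
  intros Hw Hz. rewrite <- Cseries_geom by auto using disk_mult, disk_conj. apply CSeries_ext. intros n. unfold szego. rewrite Cpow_mult_l. auto.
Qed.

Lemma peval_taylor z : disk z -> peval a z = b z.
Proof.
  intros Hz. apply (clim_unique (csum (fun n => a n * z ^ n))).
  - apply clim_CSeries, asum_peval; auto using bseq_l2 with l2.
  - apply taylor_at; auto.
Qed.

Lemma conv_adj_szego w : disk w -> conv_adj a (szego w) = vscal (Cconj (b w)) (szego w).
Proof.
  intros Hw. funext n. unfold conv_adj, vscal. rewrite <- (peval_taylor w Hw). unfold peval.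
  rewrite CSeries_conj, Cmult_comm, <- CSeries_scal.
  - apply CSeries_ext. intros j. unfold szego. rewrite Cmult_conj, Cpow_conj, Cpow_add_r. ring.
  - apply asum_conj. apply asum_peval; auto using bseq_l2 with l2.
Qed.

Lemma peval_conv u z : l2 u -> disk z -> peval (conv a u) z = b z * peval u z.
Proof.
  intros U Hz. rewrite <- !inner_szego, conv_adjoint, conv_adj_szego, inner_scal_r, Cconj_conj; auto with l2.
Qed.

Definition dBR_kernel (z w : C) : C := (1 - Cconj (b w) * b z) / (1 - Cconj w * z).

Lemma peval_defect_szego w z : disk w -> disk z -> peval (defect_op b (szego w)) z = dBR_kernel z w.
Proof.
  intros Hw Hz. rewrite defect_op_eq, peval_sub, peval_conv, conv_adj_szego, peval_scal, peval_szego by (auto using bseq_l2 with l2).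
  unfold dBR_kernel, Cdiv. ring.
Qed.

(** Let [A] be the positive square root of [I - T_b T_b^*].  For [F = A f] with [f] orthogonal to the
    kernel of [A], [F w = <A f, k_w> = <f, A k_w>], which is the inner product of [F] with
    [A (A k_w) = (1 - conj (b w) b) k_w] in the range space: replacing [A k_w] by the representative
    orthogonal to the kernel of [A] does not change the pairing with [f].  Only [A^2] enters, so any
    positive square root will do. *)
Lemma dBR_reproducing (K : unit_disk -> unit_disk -> C) :
  reproducing_kernel (dBR_space b) K <-> forall z w, K z w = dBR_kernel (proj1_sig z) (proj1_sig w).
Proof.
  set (A := sqrt_op (defect_op b)). destruct sqrt_op_spec as [PA SA]. fold A in PA, SA.
  pose proof PA as [BA _]. pose proof (proj1 (bounded_op_iff A) BA) as [LA _]. pose proof LA as (A1 & _ & _).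
  assert (Rep : forall F, carrier (dBR_space b) F -> perp_ker A (range_rep A F) /\ forall z, H2_fun (A (range_rep A F)) z = F z).
  { intros F [f [Hf HF]]. unfold range_rep. apply epsilon_spec. destruct (perp_ker_component A f BA Hf) as [g [Hg Eg]].
    exists g. split; auto. intros z. fold A in HF. rewrite Eg. apply HF. }
  set (k := fun z w : unit_disk => dBR_kernel (proj1_sig z) (proj1_sig w)).
  assert (Hk : forall w z, H2_fun (A (A (szego (proj1_sig w)))) z = k z w).
  { intros [w Hw] [z Hz]. unfold k; simpl. rewrite SA by auto with l2. apply peval_defect_szego; auto. }
  assert (Ck : forall w, carrier (dBR_space b) (fun z => k z w)).
  { intros w. exists (A (szego (proj1_sig w))). split; [apply A1, l2_szego, (proj2_sig w)|]. intros z. apply Hk. }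
  assert (RK : reproducing_kernel (dBR_space b) k).
  { intros w. split; auto. intros F HF. destruct (Rep F HF) as [[f1 f2] f3]. destruct (Rep _ (Ck w)) as [[g1 g2] g3].
    change (inner (dBR_space b) F (fun z => k z w)) with (l2_inner (range_rep A F) (range_rep A (fun z => k z w))).
    set (f := range_rep A F) in *. set (g := range_rep A (fun z => k z w)) in *.
    destruct w as [w Hw]. simpl in *. set (h := A (szego w)). assert (Hh : l2 h) by (apply A1; auto with l2).
    assert (Eg : A g = A h).
    { apply peval_inj; auto using bseq_l2. intros z Hz.
      exact (eq_trans (g3 (exist _ z Hz)) (eq_sym (Hk (exist _ w Hw) (exist _ z Hz)))). }
    assert (E0 : l2_inner f (vsub g h) = 0).
    { apply f2; auto with l2. intros n. rewrite lin_sub, Eg by auto. unfold vsub. ring. }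
    rewrite inner_sub_r in E0 by auto.
    replace (l2_inner f g) with (l2_inner f g - l2_inner f h + l2_inner f h) by ring. rewrite E0. unfold h.
    rewrite <- positive_op_sym, inner_szego by auto with l2. rewrite <- f3. unfold H2_fun, peval. simpl. ring. }
  split.
  (* pairing the kernel functions of K and k evaluates each of them at the other's point *)
  - intros HK z w. destruct (HK w) as [Cw _]. destruct (HK z) as [_ _].
    destruct (RK z) as [_ R1]. destruct (HK w) as [_ R2].
    specialize (R1 _ Cw). specialize (R2 _ (Ck z)). cbv beta in R1, R2.
    rewrite <- R1.
    change (inner (dBR_space b) (fun z0 => K z0 w) (fun z0 => k z0 z)) with (l2_inner (range_rep A (fun z0 => K z0 w)) (range_rep A (fun z0 => k z0 z))).
    change (inner (dBR_space b) (fun z0 => k z0 z) (fun z0 => K z0 w)) with (l2_inner (range_rep A (fun z0 => k z0 z)) (range_rep A (fun z0 => K z0 w))) in R2.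
    rewrite (inner_conj (range_rep A (fun z0 => k z0 z))), R2. unfold k, dBR_kernel.
    destruct z as [z Hz], w as [w Hw]; simpl. rewrite Cdiv_conj by (apply one_minus_neq0; auto using disk_mult, disk_conj).
    rewrite !Cminus_conj, !Cmult_conj, !Cconj_conj, !Cconj_R. f_equal; ring.
  - intros HK. replace K with k; auto. funext z. funext w. rewrite HK; auto.
Qed.

End Multiplier.

(** * Positive kernels *)

#[global] Hint Resolve l2_szego : l2.

Definition qform {X : Type} (K : X -> X -> C) (x : nat -> X) (c : nat -> C) (n : nat) : C :=
  csum (fun i => csum (fun j => Cconj (c i) * K (x i) (x j) * c j) n) n.

Definition nonneg (s : C) : Prop := Im s = 0%R /\ (0 <= Re s)%R.

Lemma positive_kernel_iff {X} (K : X -> X -> C) :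
  positive_kernel K <-> (forall x y, K x y = Cconj (K y x)) /\ forall n x c, nonneg (qform K x c n).
Proof. split; intros [H1 H2]; split; auto; intros n x c; exact (H2 n x c). Qed.

Lemma nonneg_plus s t : nonneg s -> nonneg t -> nonneg (s + t).
Proof. intros [h1 h2] [h3 h4]. unfold nonneg. rewrite re_plus, im_plus. lra. Qed.

Lemma nonneg_scal (r : R) s : (0 <= r)%R -> nonneg s -> nonneg (r * s).
Proof. intros Hr [h1 h2]. unfold nonneg. rewrite re_scal_l. split; [|nra]. rewrite im_mult, h1, re_RtoC. simpl. ring. Qed.

Lemma pos_ext {X} (K L : X -> X -> C) : (forall p q, K p q = L p q) -> positive_kernel K -> positive_kernel L.
Proof.
  intros H. replace L with K; auto. funext p; funext q; auto.
Qed.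

Lemma pos_plus {X} (K L : X -> X -> C) : positive_kernel K -> positive_kernel L -> positive_kernel (fun p q => K p q + L p q).
Proof.
  rewrite !positive_kernel_iff. intros [h1 h2] [h3 h4]. split.
  - intros x y. rewrite Cplus_conj, <- h1, <- h3. auto.
  - intros n x c. replace (qform _ x c n) with (qform K x c n + qform L x c n); [apply nonneg_plus; auto|].
    unfold qform. rewrite <- csum_plus. apply csum_ext. intros i _. rewrite <- csum_plus. apply csum_ext. intros j _. ring.
Qed.

Lemma pos_scal {X} (K : X -> X -> C) (r : R) : (0 <= r)%R -> positive_kernel K -> positive_kernel (fun p q => r * K p q).
Proof.
  intros Hr. rewrite !positive_kernel_iff. intros [h1 h2]. split.
  - intros x y. rewrite Cmult_conj, <- h1, Cconj_R. auto.
  - intros n x c. replace (qform _ x c n) with (r * qform K x c n); [apply nonneg_scal; auto|].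
    unfold qform. rewrite <- csum_scal. apply csum_ext. intros i _. rewrite <- csum_scal. apply csum_ext. intros j _. ring.
Qed.

Lemma pos_conj_scal {X} (K : X -> X -> C) (f : X -> C) : positive_kernel K -> positive_kernel (fun p q => f p * K p q * Cconj (f q)).
Proof.
  rewrite !positive_kernel_iff. intros [h1 h2]. split.
  - intros x y. rewrite !Cmult_conj, Cconj_conj, <- h1. ring.
  - intros n x c. replace (qform _ x c n) with (qform K x (fun i => Cconj (f (x i)) * c i) n); [auto|].
    unfold qform. apply csum_ext. intros i _. apply csum_ext. intros j _. rewrite Cmult_conj, Cconj_conj. ring.
Qed.

Lemma pos_comp {X Y} (K : Y -> Y -> C) (g : X -> Y) : positive_kernel K -> positive_kernel (fun p q => K (g p) (g q)).
Proof. intros [h1 h2]. split; auto. intros n x c. apply (h2 n (fun i => g (x i)) c). Qed.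

Definition lincomb (c : nat -> C) (g : nat -> nat -> C) (n : nat) : nat -> C := fun k => csum (fun i => c i * g i k) n.

Lemma lincomb_0 c g : lincomb c g 0 = vscal (c 0%nat) (g 0%nat).
Proof. funext k. unfold lincomb. rewrite csum_0. auto. Qed.

Lemma lincomb_S c g n : lincomb c g (S n) = vadd (lincomb c g n) (vscal (c (S n)) (g (S n))).
Proof. funext k. unfold lincomb. rewrite csum_S. auto. Qed.

Lemma l2_lincomb c g n : (forall i, l2 (g i)) -> l2 (lincomb c g n).
Proof. intros H. induction n; rewrite ?lincomb_0, ?lincomb_S; auto with l2. Qed.

Lemma lincomb_inner c g n w : (forall i, l2 (g i)) -> l2 w -> l2_inner (lincomb c g n) w = csum (fun i => c i * l2_inner (g i) w) n.
Proof.
  intros H W. induction n; rewrite ?lincomb_0, ?lincomb_S, ?csum_0, ?csum_S.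
  - apply inner_scal_l; auto.
  - rewrite inner_add_l, inner_scal_l, IHn by auto using l2_lincomb with l2. auto.
Qed.

Lemma qform_gram {X} (g : X -> nat -> C) x c n : (forall p, l2 (g p)) ->
  qform (fun p q => l2_inner (g q) (g p)) x c n = RtoC (sqnorm (lincomb c (fun i => g (x i)) n)).
Proof.
  intros H. rewrite <- inner_self, (inner_conj (lincomb _ _ _)), lincomb_inner by auto using l2_lincomb.
  rewrite csum_conj. unfold qform. apply csum_ext. intros i _.
  rewrite Cmult_conj, <- inner_conj, lincomb_inner, <- csum_scal by auto. apply csum_ext. intros j _. ring.
Qed.

Lemma pos_gram {X} (g : X -> nat -> C) : (forall p, l2 (g p)) -> positive_kernel (fun p q => l2_inner (g q) (g p)).
Proof.
  intros H. apply positive_kernel_iff. split.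
  - intros x y. apply inner_conj.
  - intros n x c. rewrite qform_gram by auto. split; [reflexivity|]. rewrite re_RtoC. apply sqnorm_pos, l2_lincomb; auto.
Qed.

Lemma pos_diag {X} (K : X -> X -> C) p : positive_kernel K -> K p p = RtoC (Re (K p p)) /\ (0 <= Re (K p p))%R.
Proof.
  intros P. apply positive_kernel_iff in P. destruct P as [_ P]. specialize (P 0%nat (fun _ => p) (fun _ => 1)). unfold qform in P.
  rewrite !csum_0 in P. replace (Cconj 1 * K p p * 1) with (K p p) in P by (rewrite Cconj_R; ring). destruct P as [h1 h2]. split; auto.
  apply Ceq; auto.
Qed.

Lemma pos_rank_one {X} (f : X -> C) : positive_kernel (fun p q => f p * Cconj (f q)).
Proof.
  apply (pos_ext (fun p q => f p * l2_inner (unit_vec 0) (unit_vec 0) * Cconj (f q))).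
  - intros p q. replace (l2_inner (unit_vec 0) (unit_vec 0)) with (RtoC 1). ring.
    unfold l2_inner. rewrite (CSeries_finite _ 0). { rewrite csum_0. unfold unit_vec; simpl. rewrite Cconj_R; ring. }
    intros k Hk. unfold unit_vec. destruct (Nat.eq_dec k 0); [lia|ring].
  - apply pos_conj_scal. apply (pos_gram (fun _ => unit_vec 0)). auto with l2.
Qed.

(** Moving the origin of the feature space to the feature vector of [o]:
    append [o] to the points, with coefficient minus the sum of the others. *)
Lemma pos_translate {X} (K : X -> X -> C) o : positive_kernel K ->
  positive_kernel (fun p q => K p q - K p o - K o q + K o o).
Proof.
  rewrite !positive_kernel_iff. intros [h1 h2]. split.
  - intros x y. rewrite !Cplus_conj, !Cminus_conj, <- !h1. ring.
  - intros n x c. set (s := csum c n).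
    set (x' := fun i => if le_dec i n then x i else o). set (c' := fun i => if le_dec i n then c i else - s).
    replace (qform _ x c n) with (qform K x' c' (S n)); auto.
    assert (X1 : forall i, (i <= n)%nat -> x' i = x i) by (intros i Hi; unfold x'; destruct (le_dec i n); [auto|lia]).
    assert (C1 : forall i, (i <= n)%nat -> c' i = c i) by (intros i Hi; unfold c'; destruct (le_dec i n); [auto|lia]).
    assert (X2 : x' (S n) = o) by (unfold x'; destruct (le_dec (S n) n); [lia|auto]).
    assert (C2 : c' (S n) = - s) by (unfold c'; destruct (le_dec (S n) n); [lia|auto]).
    set (r := fun y => csum (fun j => K y (x j) * c j) n).
    assert (Row : forall i y, csum (fun j => Cconj (c' i) * K y (x' j) * c' j) (S n) = Cconj (c' i) * (r y - K y o * s)).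
    { intros i y. rewrite csum_S, X2, C2. unfold r.
      replace (Cconj (c' i) * (csum (fun j => K y (x j) * c j) n - K y o * s)) with
        (Cconj (c' i) * csum (fun j => K y (x j) * c j) n + Cconj (c' i) * K y o * - s) by ring.
      f_equal. rewrite <- csum_scal. apply csum_ext. intros j Hj. rewrite (X1 j), (C1 j) by auto. ring. }
    unfold qform at 1. rewrite (csum_ext _ (fun i => Cconj (c' i) * (r (x' i) - K (x' i) o * s)) _ (fun i _ => Row i (x' i))), csum_S, X2, C2.
    rewrite (csum_ext (fun i => Cconj (c' i) * (r (x' i) - K (x' i) o * s)) (fun i => Cconj (c i) * (r (x i) - K (x i) o * s))) by (intros i Hi; rewrite X1, C1 by auto; auto).
    assert (S1 : Cconj (- s) * (r o - K o o * s) = csum (fun i => Cconj (c i) * (- (r o - K o o * s))) n).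
    { unfold s at 1. rewrite Copp_conj, csum_conj.
      rewrite (csum_ext (fun i => Cconj (c i) * (- (r o - K o o * s))) (fun i => (- (r o - K o o * s)) * Cconj (c i))) by (intros; ring).
      rewrite csum_scal. ring. }
    rewrite S1, <- csum_plus. unfold qform. apply csum_ext. intros i Hi.
    replace (Cconj (c i) * (r (x i) - K (x i) o * s) + Cconj (c i) * - (r o - K o o * s)) with
      (Cconj (c i) * r (x i) + ((Cconj (c i) * (K o o - K (x i) o)) * s + (- Cconj (c i)) * r o)) by ring.
    unfold r, s. rewrite <- !csum_scal, <- !csum_plus. apply csum_ext. intros j Hj. ring.
Qed.

(** Let [F] be the positive kernel attached to the base point [a] and [f = F (o, o) < 1].  The kernel
    attached to [o] is
      [((1 - f) (F(z,w) - F(z,o) - F(o,w) + f) + (F(z,o) - f) (F(o,w) - f)) / ((1 - F(z,o)) (1 - F(o,w)))],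
    a rescaled sum of a translate of [F] and a rank one kernel.  In terms of feature vectors this is
    the automorphism of the ball that moves the image of [o] to the origin. *)
Lemma CNP_base_change {X} (K : X -> X -> C) (a o : X) :
  positive_kernel K -> (forall z w, K z w <> 0) ->
  positive_kernel (fun z w => 1 - (K z a * K a w) / (K a a * K z w)) ->
  positive_kernel (fun z w => 1 - (K z o * K o w) / (K o o * K z w)).
Proof.
  intros PK NZ PF. set (F := fun z w => 1 - (K z a * K a w) / (K a a * K z w)) in *.
  assert (HK : forall x y, K x y = Cconj (K y x)) by apply PK.
  assert (HF : forall x y, F x y = Cconj (F y x)) by apply PF.
  destruct (pos_diag F o PF) as [Fo _]. set (f := Re (F o o)) in *.
  assert (F1 : forall z w, 1 - F z w <> 0).
  { intros z w. unfold F. replace (1 - (1 - K z a * K a w / (K a a * K z w))) with (K z a * K a w / (K a a * K z w)) by ring.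
    intros E. assert (K z a * K a w = 0). { replace (K z a * K a w) with (K z a * K a w / (K a a * K z w) * (K a a * K z w)) by (field; split; auto). rewrite E; ring. }
    apply (Cmult_neq_0 (K z a) (K a w)); auto. }
  assert (f1 : (0 <= 1 - f)%R).
  { destruct (pos_diag K a PK) as [Ka Pa]. destruct (pos_diag K o PK) as [Ko Po].
    assert (Ra : (0 < Re (K a a))%R). { destruct Pa as [|e]; auto. exfalso. apply (NZ a a). rewrite Ka, <- e. auto. }
    assert (Ro : (0 < Re (K o o))%R). { destruct Po as [|e]; auto. exfalso. apply (NZ o o). rewrite Ko, <- e. auto. }
    replace (1 - f)%R with (Re (1 - F o o)) by (rewrite Fo, <- RtoC_minus; apply re_RtoC).
    unfold F. replace (1 - (1 - K o a * K a o / (K a a * K o o))) with (RtoC (Cmod (K o a) ^ 2 / (Re (K a a) * Re (K o o)))).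
    - rewrite re_RtoC. apply Rmult_le_pos; [apply sq_pos|]. left. apply Rinv_0_lt_compat. nra.
    - rewrite RtoC_div, RtoC_mult, <- Ka, <- Ko, Cmod2_conj, <- HK by nra. ring. }
  apply (pos_ext (fun z w => / (1 - F z o) * ((1 - f)%R * (F z w - F z o - F o w + F o o) + (F z o - F o o) * Cconj (F w o - F o o)) * Cconj (/ (1 - F w o)))).
  - intros z w. rewrite Cinv_conj by auto. rewrite !Cminus_conj, Cconj_R, <- !HF, RtoC_minus, <- Fo.
    unfold F. field. repeat split; auto; try apply NZ.
    + intros H. apply (Cmult_neq_0 (K o a) (K a w)); try apply NZ. rewrite <- H. ring.
    + intros H. apply (Cmult_neq_0 (K z a) (K a o)); try apply NZ. rewrite <- H. ring.
  - apply (pos_conj_scal (fun z w => (1 - f)%R * (F z w - F z o - F o w + F o o) + (F z o - F o o) * Cconj (F w o - F o o)) (fun z => / (1 - F z o))).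
    apply (pos_plus (fun z w => (1 - f)%R * (F z w - F z o - F o w + F o o)) (fun z w => (F z o - F o o) * Cconj (F w o - F o o))).
    + apply (pos_scal (fun z w => F z w - F z o - F o w + F o o)); auto. apply pos_translate; auto.
    + apply (pos_rank_one (fun z => F z o - F o o)).
Qed.

(** * Nevanlinna-Pick interpolation *)

Definition rshift (u : nat -> C) (n : nat) : C := match n with O => 0 | S m => u m end.

Lemma bseq_rshift u : bseq u -> bseq (rshift u).
Proof.
  intros [M H]. exists (Rmax M 0). intros [|n]; simpl.
  - rewrite Cmod_0. apply Rmax_r.
  - eapply Rle_trans; [apply H|apply Rmax_l].
Qed.

Lemma peval_rshift u z : bseq u -> disk z -> peval (rshift u) z = z * peval u z.
Proof. intros B Hz. rewrite peval_step by auto using bseq_rshift. simpl. change (seq_shift 1 (rshift u)) with u. ring. Qed.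

Lemma sqnorm_szego z : disk z -> RtoC (sqnorm (szego z)) = / (1 - Cconj z * z).
Proof. intros Hz. rewrite <- inner_self, inner_szego, peval_szego; auto. Qed.

Lemma peval_unit z : peval (unit_vec 0) z = 1.
Proof.
  unfold peval. rewrite (CSeries_finite _ 0). { rewrite csum_0. unfold unit_vec; simpl. ring. }
  intros k Hk. unfold unit_vec. destruct (Nat.eq_dec k 0); [lia|ring].
Qed.

Section Pick.
Variables (X : Type) (x psi : X -> C).
Hypothesis x_disk : forall p, disk (x p).
Hypothesis x_clusters : forall d, (0 < d)%R -> exists p, x p <> 0 /\ (Cmod (x p) < d)%R.
Hypothesis pick_pos : positive_kernel (fun p q => (1 - psi p * Cconj (psi q)) / (1 - x p * Cconj (x q))).

(** Pairs [(v, v')] of combinations of the kernels at the nodes, [v'] being the image of [v]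
    under the would-be adjoint multiplier [k_p |-> conj (psi p) k_p]. *)
Inductive node_comb : (nat -> C) -> (nat -> C) -> Prop :=
| node_comb_zero : node_comb vzero vzero
| node_comb_add c p v v' : node_comb v v' ->
    node_comb (vadd v (vscal c (szego (x p)))) (vadd v' (vscal (c * Cconj (psi p)) (szego (x p)))).

Lemma node_comb_linear v v' w w' t : node_comb v v' -> node_comb w w' ->
  node_comb (vadd v (vscal t w)) (vadd v' (vscal t w')).
Proof.
  intros V W. induction W as [|c p w w' W IH].
  - replace (vadd v (vscal t vzero)) with v by vec_ring. replace (vadd v' (vscal t vzero)) with v' by vec_ring. auto.
  - apply (node_comb_add (t * c) p) in IH.
    replace (vadd v (vscal t (vadd w (vscal c (szego (x p)))))) with (vadd (vadd v (vscal t w)) (vscal (t * c) (szego (x p)))) by vec_ring.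
    replace (vadd v' (vscal t (vadd w' (vscal (c * Cconj (psi p)) (szego (x p)))))) with (vadd (vadd v' (vscal t w')) (vscal (t * c * Cconj (psi p)) (szego (x p)))) by vec_ring.
    exact IH.
Qed.

Lemma node_comb_lincomb v v' : node_comb v v' -> exists n p c,
  v = lincomb c (fun i => szego (x (p i))) n /\ v' = lincomb (fun i => c i * Cconj (psi (p i))) (fun i => szego (x (p i))) n.
Proof.
  destruct (x_clusters 1 ltac:(lra)) as [p0 _].
  induction 1 as [|c p v v' H (n & q & e & -> & ->)].
  - exists 0%nat, (fun _ => p0), (fun _ => 0). rewrite !lincomb_0. split; vec_ring.
  - exists (S n), (fun i => if le_dec i n then q i else p), (fun i => if le_dec i n then e i else c).
    rewrite !lincomb_S. destruct (le_dec (S n) n); [lia|]. split; f_equal;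
      (funext k; unfold lincomb; apply csum_ext; intros i Hi; destruct (le_dec i n); [auto|lia]).
Qed.

Lemma node_comb_l2 v v' : node_comb v v' -> l2 v /\ l2 v'.
Proof.
  induction 1 as [|c p v v' H [h1 h2]]; split; auto with l2.
Qed.

(** The Pick condition says that [|v|^2 - |v'|^2] is nonnegative. *)
Lemma node_comb_contract v v' : node_comb v v' -> (sqnorm v' <= sqnorm v)%R.
Proof.
  intros H. destruct (node_comb_lincomb v v' H) as (n & p & c & -> & ->).
  pose proof (proj2 (proj2 (proj1 (positive_kernel_iff _) pick_pos) n p c)) as Q.
  set (g := fun q => szego (x q)). assert (G : forall q, l2 (g q)) by (intros q; apply l2_szego; auto).
  pose proof (qform_gram g p c n G) as E1. change (fun i => g (p i)) with (fun i => szego (x (p i))) in E1.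
  pose proof (qform_gram (fun q => vscal (Cconj (psi q)) (g q)) p c n ltac:(intros; apply l2_scal, G)) as E2. cbv beta in E2.
  replace (lincomb c (fun i => vscal (Cconj (psi (p i))) (g (p i))) n) with (lincomb (fun i => c i * Cconj (psi (p i))) (fun i => szego (x (p i))) n) in E2
    by (funext k; unfold lincomb, vscal, g; apply csum_ext; intros; ring).
  set (s1 := sqnorm (lincomb c (fun i => szego (x (p i))) n)) in *.
  set (s2 := sqnorm (lincomb (fun i => c i * Cconj (psi (p i))) (fun i => szego (x (p i))) n)) in *.
  assert (E : qform (fun p q => (1 - psi p * Cconj (psi q)) / (1 - x p * Cconj (x q))) p c n = RtoC (s1 - s2)).
  { replace (RtoC (s1 - s2)) with (RtoC s1 + (-1) * RtoC s2) by (rewrite RtoC_minus; ring).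
    rewrite <- E1, <- E2. unfold qform. rewrite <- csum_scal, <- csum_plus. apply csum_ext. intros i _.
    rewrite <- csum_scal, <- csum_plus. apply csum_ext. intros j _.
    rewrite inner_scal_l, inner_scal_r, Cconj_conj by auto with l2. unfold g. rewrite inner_szego, peval_szego by auto.
    rewrite (Cmult_comm (Cconj (x (p j)))). unfold Cdiv. ring. }
  rewrite E, re_RtoC in Q. lra.
Qed.

(** The bounded functional [v |-> <v', g>] is represented by a vector interpolating [psi g]. *)
Lemma multiplier_image g : l2 g -> exists u, l2 u /\ (l2_norm u <= l2_norm g)%R /\ forall p, peval u (x p) = psi p * peval g (x p).
Proof.
  intros G.
  destruct (Riesz_relation (fun v al => exists v', node_comb v v' /\ al = l2_inner v' g) (l2_norm g)) as (u & Hu & Bu & Ru & _).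
  - apply l2_norm_pos.
  - exists vzero, (l2_inner vzero g), vzero. split; auto. constructor.
  - intros v al [v' [H _]]. apply (node_comb_l2 v v' H).
  - intros v al w be t [v' [Hv ->]] [w' [Hw ->]]. exists (vadd v' (vscal t w')). split; [apply node_comb_linear; auto|].
    pose proof (node_comb_l2 _ _ Hv). pose proof (node_comb_l2 _ _ Hw). rewrite inner_add_l, inner_scal_l; tauto || (auto with l2); apply l2_scal; tauto.
  - intros v al [v' [Hv ->]]. pose proof (node_comb_l2 _ _ Hv) as [h1 h2]. pose proof (node_comb_contract _ _ Hv).
    pose proof (Cauchy_Schwarz v' g h2 G). pose proof (l2_norm_mono v' v h2 h1 H). pose proof (l2_norm_pos g). nra.
  - exists u. split; [auto|split; [auto|]]. intros p.
    assert (E : l2_inner (szego (x p)) u = Cconj (psi p) * l2_inner (szego (x p)) g).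
    { rewrite <- inner_scal_l by auto with l2. apply Ru. exists (vscal (Cconj (psi p)) (szego (x p))). split; auto.
      pose proof (node_comb_add 1 p _ _ node_comb_zero) as N.
      replace (vadd vzero (vscal 1 (szego (x p)))) with (szego (x p)) in N by vec_ring.
      replace (vadd vzero (vscal (1 * Cconj (psi p)) (szego (x p)))) with (vscal (Cconj (psi p)) (szego (x p))) in N by vec_ring. auto. }
    rewrite <- !inner_szego, (inner_conj (szego (x p)) u), E, Cmult_conj, Cconj_conj, <- inner_conj. auto.
Qed.

Lemma nodes_identity u : bseq u -> (forall p, peval u (x p) = 0) -> u = vzero.
Proof.
  intros B H. apply peval_identity; auto. intros d Hd. destruct (x_clusters d Hd) as (p & p0 & pd). exists (x p). auto.
Qed.

(** [Q] is the image [M 1] of the constant 1 under the multiplier [M] of [multiplier_image].  The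
    nodes cluster at 0, so identities between power series may be checked at the nodes.  As
    [k_z = s + conj z s (y - z) k_z] with [s = |k_z|^2], applying [M] and evaluating at [z] gives
    [(M k_z)(z) = s Q(z)], while [|(M k_z)(z)| <= |M k_z| |k_z| <= s]. *)
Theorem Pick_interpolation : exists Q, l2 Q /\ (forall p, peval Q (x p) = psi p) /\ forall z, disk z -> (Cmod (peval Q z) <= 1)%R.
Proof.
  destruct (multiplier_image (unit_vec 0) ltac:(auto with l2)) as (Q & HQ & _ & EQ).
  exists Q. split; auto. split. { intros p. rewrite EQ, peval_unit. ring. }
  intros z Hz. destruct (multiplier_image (szego z) (l2_szego z Hz)) as (U & HU & BU & EU).
  set (s := sqnorm (szego z)). pose proof (sqnorm_szego z Hz) as Es. fold s in Es.
  assert (nz : forall y, disk y -> 1 - Cconj z * y <> 0) by (intros; apply one_minus_neq0; auto using disk_mult, disk_conj).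
  assert (BQ : bseq Q) by auto using bseq_l2. assert (BU' : bseq U) by auto using bseq_l2.
  (* W is (y - z) U(y), and V = 0 says that U = M k_z equals s Q + conj z s (y - z) U *)
  set (W := vsub (rshift U) (vscal z U)). assert (BW : bseq W) by (unfold W; auto using bseq_sub, bseq_rshift, bseq_scal).
  set (V := vsub (vsub U (vscal s Q)) (vscal (Cconj z * s) W)).
  assert (EV : forall y, disk y -> peval V y = peval U y - s * peval Q y - Cconj z * s * ((y - z) * peval U y)).
  { intros y Hy. unfold V, W. rewrite !peval_sub, !peval_scal, peval_sub, peval_rshift, peval_scal by auto using bseq_sub, bseq_rshift, bseq_scal. ring. }
  assert (V0 : V = vzero).
  { apply nodes_identity. { unfold V. auto using bseq_sub, bseq_scal. } intros p. rewrite EV by auto. rewrite EU, EQ, peval_unit, peval_szego, Es by auto.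
    field. split; apply nz; auto. }
  pose proof (EV z Hz) as E. rewrite V0 in E. replace (peval vzero z) with (RtoC 0) in E.
  2:{ unfold peval. rewrite (CSeries_ext _ (fun _ => 0)), CSeries_0; auto. intros; unfold vzero; ring. }
  assert (E' : peval U z = s * peval Q z).
  { replace (peval U z) with (s * peval Q z + (peval U z - s * peval Q z - Cconj z * s * ((z - z) * peval U z))) by ring. rewrite <- E. ring. }
  assert (Ps : (0 < s)%R).
  { destruct (sqnorm_pos (szego z) (l2_szego z Hz)) as [|e]; auto. exfalso. fold s in e. rewrite <- e in Es.
    apply (nz z Hz). replace (1 - Cconj z * z) with ((1 - Cconj z * z) * (1 - Cconj z * z) * / (1 - Cconj z * z)) by (field; auto). rewrite <- Es. ring. }
  pose proof (Cauchy_Schwarz U (szego z) HU (l2_szego z Hz)) as CS. rewrite inner_szego, E', Cmod_mult, Cmod_R, Rabs_pos_eq in CS by lra.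
  pose proof (l2_norm_sq (szego z) (l2_szego z Hz)). fold s in H. pose proof (l2_norm_pos (szego z)).
  apply (Rmult_le_reg_l s); auto. nra.
Qed.
End Pick.

(** * The characterization of the complete Nevanlinna-Pick property *)

Lemma dBR_kernel_gram b z w : Hinf_unit_ball b -> disk z -> disk w ->
  dBR_kernel b z w = l2_inner (sqrt_op (defect_op b) (szego w)) (sqrt_op (defect_op b) (szego z)).
Proof.
  intros Hb Hz Hw. destruct (sqrt_op_spec b Hb) as [PA SA].
  pose proof (proj1 (bounded_op_iff _) (proj1 PA)) as [(A1 & _ & _) _].
  rewrite <- positive_op_sym, SA, inner_szego by auto with l2. symmetry. apply peval_defect_szego; auto.
Qed.

Lemma l2_sqrt_szego b z : Hinf_unit_ball b -> disk z -> l2 (sqrt_op (defect_op b) (szego z)).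
Proof.
  intros Hb Hz. destruct (sqrt_op_spec b Hb) as [PA SA].
  pose proof (proj1 (bounded_op_iff _) (proj1 PA)) as [(A1 & _ & _) _]. auto with l2.
Qed.

Lemma dBR_kernel_pos b : Hinf_unit_ball b ->
  positive_kernel (fun z w : unit_disk => dBR_kernel b (proj1_sig z) (proj1_sig w)).
Proof.
  intros Hb. apply (pos_ext (fun z w : unit_disk => l2_inner (sqrt_op (defect_op b) (szego (proj1_sig w))) (sqrt_op (defect_op b) (szego (proj1_sig z))))).
  - intros [z Hz] [w Hw]. simpl. symmetry. apply dBR_kernel_gram; auto.
  - apply (pos_gram (fun z : unit_disk => sqrt_op (defect_op b) (szego (proj1_sig z)))). intros [z Hz]. apply l2_sqrt_szego; auto.
Qed.

(** Strict form of the maximum principle: if [|b z0| = 1] then the kernel function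
    at [z0] has norm zero, so that [k(z0, w) = 0] for all [w]. *)
Lemma nonconstant_strict b : Hinf_unit_ball b -> (~ exists c : C, forall z, disk z -> b z = c) ->
  forall z, disk z -> disk (b z).
Proof.
  intros Hb Hnc z Hz. destruct (proj2 Hb z Hz) as [|e]; [auto|]. exfalso. apply Hnc. exists (b z). intros w Hw.
  assert (E1 : b z * Cconj (b z) = 1) by (rewrite <- Cmod2_conj, e, pow1; auto).
  set (A := sqrt_op (defect_op b)).
  assert (K0 : sqnorm (A (szego z)) = 0%R).
  { apply RtoC_inj. rewrite <- inner_self. unfold A. rewrite <- dBR_kernel_gram by auto. unfold dBR_kernel. rewrite Cmult_comm, Cmult_comm in E1.
    rewrite (Cmult_comm (Cconj (b z))), E1. unfold Cdiv. ring. }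
  assert (V0 : A (szego z) = vzero). { apply sqnorm_zero; [apply l2_sqrt_szego; auto|rewrite K0; lra]. }
  assert (Kw : dBR_kernel b w z = 0).
  { rewrite dBR_kernel_gram by auto. fold A. rewrite V0. unfold l2_inner. rewrite (CSeries_ext _ (fun _ => 0)), CSeries_0; auto. intros; unfold vzero; ring. }
  unfold dBR_kernel in Kw.
  assert (N : 1 - Cconj z * w <> 0) by (apply one_minus_neq0; auto using disk_mult, disk_conj).
  assert (E2 : 1 - Cconj (b z) * b w = 0).
  { replace (1 - Cconj (b z) * b w) with ((1 - Cconj (b z) * b w) / (1 - Cconj z * w) * (1 - Cconj z * w)) by (field; auto). rewrite Kw. ring. }
  replace (b w) with (b w * 1 + b z * (1 - Cconj (b z) * b w) - b z * (1 - Cconj (b z) * b w)) by ring.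
  rewrite E2. rewrite <- E1. replace (b w * (b z * Cconj (b z)) + b z * 0 - b z * 0) with (b z * (1 - (1 - Cconj (b z) * b w))) by ring.
  rewrite E2. ring.
Qed.

Definition mobius (c y : C) : C := (y - c) / (1 - Cconj c * y).

Lemma mobius_denom c y : disk c -> disk y -> 1 - Cconj c * y <> 0.
Proof. intros. apply one_minus_neq0; auto using disk_mult, disk_conj. Qed.

Lemma disk_mobius c y : disk c -> disk y -> disk (mobius c y).
Proof.
  intros Hc Hy. pose proof (mobius_denom c y Hc Hy) as N. unfold disk, mobius. rewrite Cmod_div by auto.
  pose proof (proj1 (Cmod_gt_0 _) N) as P. apply (Rmult_lt_reg_r (Cmod (1 - Cconj c * y))); auto.
  unfold Rdiv. rewrite Rmult_assoc, Rinv_l, Rmult_1_l, Rmult_1_r by lra.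
  assert (S : (Cmod (1 - Cconj c * y) ^ 2 - Cmod (y - c) ^ 2 = (1 - Cmod c ^ 2) * (1 - Cmod y ^ 2))%R).
  { rewrite !Cmod2_alt. destruct c, y; simpl. ring. }
  unfold disk in *. pose proof (Cmod_ge_0 c). pose proof (Cmod_ge_0 y). pose proof (Cmod_ge_0 (y - c)).
  assert (0 < (1 - Cmod c ^ 2) * (1 - Cmod y ^ 2))%R by (apply Rmult_lt_0_compat; nra).
  apply Rnot_le_lt. intros L. nra.
Qed.

Lemma cdiff_div f g z l m : cdiff f z l -> cdiff g z m -> g z <> 0 -> exists k, cdiff (fun y => f y / g y) z k.
Proof.
  intros F G N. eexists. apply (cdiff_mult f (fun y => / g y)); [exact F|]. apply (cdiff_comp Cinv g); [|exact G]. apply cdiff_inv; auto.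
Qed.

Lemma cdiff_shift_affine a c z : cdiff (fun y => a - c * y) z (- c).
Proof. eapply cdiff_ext_loc; [|apply (cdiff_affine a (- c))]. exists 1%R. split; [lra|]. intros; ring. Qed.

Lemma cdiff_mobius c y : disk c -> disk y -> exists l, cdiff (mobius c) y l.
Proof.
  intros Hc Hy. apply (cdiff_div (fun y => y - c) (fun y => 1 - Cconj c * y) y 1 (- Cconj c)).
  - eapply cdiff_ext_loc; [|apply (cdiff_affine (- c) 1)]. exists 1%R. split; [lra|]. intros; ring.
  - apply cdiff_shift_affine.
  - apply mobius_denom; auto.
Qed.

Lemma ex_derive_cdiff f z : (exists l, cdiff f z l) -> @ex_derive C_AbsRing C_NormedModule f z.
Proof. intros [l Hl]. exists l. apply is_derive_C_cdiff. auto. Qed.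

Definition disk0 : unit_disk := exist disk 0 ltac:(unfold disk; rewrite Cmod_0; exact Rlt_0_1).

Section Main.
Variable b : C -> C.
Hypothesis b_ball : Hinf_unit_ball b.
Hypothesis b_nonconst : ~ exists c : C, forall z, disk z -> b z = c.

Let k (z w : unit_disk) : C := dBR_kernel b (proj1_sig z) (proj1_sig w).

Lemma disk_origin : disk 0.
Proof. exact (proj2_sig disk0). Qed.

Lemma b_strict z : disk z -> disk (b z).
Proof. apply nonconstant_strict; auto. Qed.

Lemma k_nonzero z w : k z w <> 0.
Proof.
  destruct z as [z Hz], w as [w Hw]. unfold k, dBR_kernel; simpl. unfold Cdiv. apply Cmult_neq_0.
  - apply mobius_denom; apply b_strict; auto.
  - intros E. pose proof (mobius_denom w z Hw Hz) as N.
    assert (X : (1 - Cconj w * z) * / (1 - Cconj w * z) = 1) by (field; auto). rewrite E in X. 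
    apply (f_equal Re) in X. rewrite Cmult_0_r in X. simpl in X. lra.
Qed.

Lemma CNP_at_origin : has_CNP_property (dBR_space b) <->
  positive_kernel (fun z w => 1 - (k z disk0 * k disk0 w) / (k disk0 disk0 * k z w)).
Proof.
  split.
  - intros [K [RK [PK [NK [a Pa]]]]]. pose proof (proj1 (dBR_reproducing b b_ball K) RK) as E.
    assert (EK : K = k) by (funext z; funext w; apply E).
    subst K. apply (CNP_base_change k a disk0); auto.
  - intros P. exists k. split; [apply dBR_reproducing; auto|]. split; [apply dBR_kernel_pos; auto|]. split; [apply k_nonzero|].
    exists disk0. exact P.
Qed.

Let b0 := b 0.

Definition phi (z : C) : C := mobius b0 (b z).

Lemma disk_phi z : disk z -> disk (phi z).
Proof. intros Hz. apply disk_mobius; apply b_strict; auto using disk_origin. Qed.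

Lemma phi_0 : phi 0 = 0.
Proof. unfold phi, mobius. fold b0. unfold Cminus at 1, Cdiv. rewrite Cplus_opp_r. ring. Qed.

Lemma Cconj_1 : Cconj 1 = 1.
Proof. apply Cconj_R. Qed.

Lemma denom_conj c y : disk c -> disk y -> 1 - c * Cconj y <> 0.
Proof. intros. rewrite Cmult_comm. apply mobius_denom; auto. Qed.

(** The disk automorphism multiplies [1 - b(z) conj b(w)] by factors depending on [z] and [w]
    alone, which are exactly those of [k(z, 0) k(0, w) / k(0, 0)]. *)
Lemma CNP_kernel_phi z w : disk z -> disk w ->
  1 - (dBR_kernel b z 0 * dBR_kernel b 0 w) / (dBR_kernel b 0 0 * dBR_kernel b z w) =
  (z * Cconj w - phi z * Cconj (phi w)) / (1 - phi z * Cconj (phi w)).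
Proof.
  intros Hz Hw. pose proof (b_strict 0 disk_origin) as h0. pose proof (b_strict z Hz) as hz. pose proof (b_strict w Hw) as hw.
  pose proof (denom_conj _ _ (disk_phi z Hz) (disk_phi w Hw)) as N1.
  unfold dBR_kernel, phi, mobius in N1 |- *. change (b 0) with b0 in h0 |- *.
  rewrite !Cdiv_conj, !Cminus_conj, !Cmult_conj, !Cconj_conj, !Cconj_1 in N1 by (apply mobius_denom; auto).
  rewrite !Cdiv_conj, !Cminus_conj, !Cmult_conj, !Cconj_conj, !Cconj_1 by (apply mobius_denom; auto).
  rewrite !(Cconj_R 0).
  pose proof (mobius_denom b0 (b z) h0 hz). pose proof (denom_conj b0 (b w) h0 hw). pose proof (mobius_denom b0 b0 h0 h0).
  pose proof (mobius_denom (b w) (b z) hw hz). pose proof (mobius_denom w z Hw Hz).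
  pose proof (mobius_denom (b w) b0 hw h0).
  set (B := b z) in *. set (B' := Cconj (b w)) in *. set (b0' := Cconj b0) in *. set (w' := Cconj w) in *.
  clearbody B B' b0' w'. revert N1. 
  replace (1 - (B - b0) / (1 - b0' * B) * ((B' - b0') / (1 - b0 * B'))) with ((1 - b0' * b0) * (1 - B' * B) / ((1 - b0' * B) * (1 - b0 * B'))) by (field; auto).
  intros _. field. repeat split; auto.
Qed.

(** [phi] tends to 0 at the origin, and if it vanished on a neighbourhood then [b] would be constant. *)
Lemma phi_small d : (0 < d)%R -> exists z, disk z /\ z <> 0 /\ phi z <> 0 /\ (Cmod z < d)%R /\ (Cmod (phi z) < d)%R.
Proof.
  intros Hd. pose proof (b_strict 0 disk_origin) as h0. fold b0 in h0.
  destruct (holomorphic_cdiff disk b 0 (proj1 b_ball) disk_origin) as [l Hl].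
  destruct (cdiff_mobius b0 b0 h0 h0) as [m Hm].
  pose proof (cdiff_continuous _ _ _ (cdiff_comp (mobius b0) b 0 m l Hm Hl)) as Cn.
  destruct (Cn d Hd) as [e [He Ke]]. set (r := Rmin e d). assert (Hr : (0 < r)%R) by (apply Rmin_pos; auto).
  apply NNPP. intros N. apply b_nonconst. exists b0.
  (* otherwise b - b0 vanishes near 0, hence everywhere *)
  assert (Z : forall z, disk z -> z <> 0 -> (Cmod z < r)%R -> b z = b0).
  { intros z Hz z0 zr. pose proof (Rmin_l e d). pose proof (Rmin_r e d).
    assert (P : phi z = 0).
    { apply NNPP. intros P. apply N. exists z. repeat split; auto. unfold r in zr; lra.
      specialize (Ke z). replace (z - 0) with z in Ke by ring. cbv beta in Ke. fold (phi z) (phi 0) in Ke. rewrite phi_0 in Ke.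
      replace (phi z - 0) with (phi z) in Ke by ring. apply Ke. unfold r in zr; lra. }
    pose proof (mobius_denom b0 (b z) h0 (b_strict z Hz)) as Nz.
    replace (b z) with (b0 + phi z * (1 - Cconj b0 * b z)) by (unfold phi, mobius; field; auto). rewrite P. ring. }
  pose proof (l2_taylor b b_ball) as La. set (a := taylor_coef b) in *.
  assert (Bv : bseq (vsub a (vscal b0 (unit_vec 0)))) by (apply bseq_l2; auto with l2).
  assert (Ev : forall z, disk z -> peval (vsub a (vscal b0 (unit_vec 0))) z = b z - b0).
  { intros z Hz. unfold a. rewrite peval_sub, peval_taylor, peval_scal, peval_unit by (auto using bseq_l2 with l2). ring. }
  assert (V : vsub a (vscal b0 (unit_vec 0)) = vzero).
  { apply peval_identity; auto. intros d' Hd'. destruct (small_disk_point (Rmin d' r)) as (z & z0 & zr & Dz). { apply Rmin_pos; auto. }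
    pose proof (Rmin_l d' r). pose proof (Rmin_r d' r). exists z. repeat split; auto; [lra|]. rewrite Ev, Z by (auto; lra). ring. }
  intros z Hz. specialize (Ev z Hz). rewrite V in Ev. unfold peval in Ev. rewrite (CSeries_ext _ (fun _ => 0)), CSeries_0 in Ev by (intros; unfold vzero; ring).
  replace (b z) with (b z - b0 + b0) by ring. rewrite <- Ev. ring.
Qed.

(** Away from [z = 0] put [psi = phi / z].  Dividing the kernel of [CNP_kernel_phi] by [z conj w]
    turns it into [(1 - psi conj psi) / (1 - phi conj phi)], the Pick condition for [Q (phi) = psi]. *)
Lemma CNP_factor :
  positive_kernel (fun z w => 1 - (k z disk0 * k disk0 w) / (k disk0 disk0 * k z w)) ->
  exists Q, bseq Q /\ (forall z, disk z -> (Cmod (peval Q z) <= 1)%R) /\ forall z, disk z -> phi z = z * peval Q (phi z).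
Proof.
  intros P. set (X := {z : C | disk z /\ z <> 0}).
  set (inc := fun p : X => exist disk (proj1_sig p) (proj1 (proj2_sig p)) : unit_disk).
  destruct (Pick_interpolation X (fun p => phi (proj1_sig p)) (fun p => phi (proj1_sig p) / proj1_sig p)) as (Q & HQ & EQ & BQ).
  - intros [z [Hz z0]]. apply disk_phi; auto.
  - intros d Hd. destruct (phi_small d Hd) as (z & Hz & z0 & p0 & _ & pd). exists (exist _ z (conj Hz z0)). auto.
  - apply (pos_ext (fun p q : X => / proj1_sig p * (1 - (k (inc p) disk0 * k disk0 (inc q)) / (k disk0 disk0 * k (inc p) (inc q))) * Cconj (/ proj1_sig q))).
    + intros [z [Hz z0]] [w [Hw w0]]. unfold k; simpl. rewrite CNP_kernel_phi by auto.
      assert (w0' : Cconj w <> 0). { intros E. apply w0. rewrite <- (Cconj_conj w), E. apply Cconj_R. }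
      rewrite Cinv_conj, Cdiv_conj by auto. pose proof (denom_conj _ _ (disk_phi z Hz) (disk_phi w Hw)). field. auto.
    + apply (pos_conj_scal (fun p q : X => 1 - (k (inc p) disk0 * k disk0 (inc q)) / (k disk0 disk0 * k (inc p) (inc q))) (fun p => / proj1_sig p)).
      apply (pos_comp (fun z w => 1 - (k z disk0 * k disk0 w) / (k disk0 disk0 * k z w)) inc P).
  - exists Q. split; [apply bseq_l2; auto|split; auto]. intros z Hz. destruct (excluded_middle_informative (z = 0)) as [->|z0].
    + rewrite phi_0. ring.
    + specialize (EQ (exist _ z (conj Hz z0))). simpl in EQ. rewrite EQ. field; auto.
Qed.

(** If [Q (0) = 0] then [phi = z Q(phi)] would vanish at 0 to higher order than itself. *)
Lemma factor_nonzero Q : bseq Q -> (forall z, disk z -> phi z = z * peval Q (phi z)) ->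
  forall z, disk z -> peval Q (phi z) <> 0.
Proof.
  intros BQ E.
  assert (Q0 : peval Q 0 <> 0).
  { intros Z. destruct (bseq_shift 1 Q BQ) as [M HM]. 
    assert (M0 : (0 <= M)%R) by (eapply Rle_trans; [apply Cmod_ge_0|apply (HM 0%nat)]).
    set (d := (/ (2 * M + 2))%R). assert (Hd : (0 < d)%R) by (apply Rinv_0_lt_compat; lra).
    assert (d2 : (d <= /2)%R) by (apply Rinv_le_contravar; lra).
    destruct (phi_small d Hd) as (z & Hz & z0 & p0 & zd & pd). pose proof (disk_phi z Hz) as Dp.
    pose proof (E z Hz) as Ez. rewrite (peval_step Q) in Ez by auto. rewrite peval_0 in Z by auto. rewrite Z in Ez.
    set (R := peval (seq_shift 1 Q) (phi z)) in *.
    assert (One : z * R = 1).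
    { replace (z * R) with (z * (0 + phi z * R) / phi z) by (field; auto). rewrite <- Ez. field; auto. }
    pose proof (Cmod_peval _ _ M HM Dp) as BR. fold R in BR.
    assert (BR2 : (Cmod R <= 2 * M)%R).
    { eapply Rle_trans; [exact BR|]. replace (2 * M)%R with (M * / / 2)%R by (rewrite Rinv_inv; ring). unfold Rdiv. apply Rmult_le_compat_l; auto. apply Rinv_le_contravar; lra. }
    apply (f_equal Cmod) in One. rewrite Cmod_mult, Cmod_1 in One.
    pose proof (Cmod_ge_0 z). pose proof (Cmod_ge_0 R).
    assert (Cmod z * Cmod R <= d * (2 * M))%R by (apply Rmult_le_compat; lra).
    assert (d * (2 * M + 2) = 1)%R by (apply Rinv_l; lra). lra. }
  intros z Hz Z. pose proof (E z Hz) as Ez. rewrite Z in Ez. replace (z * 0) with (RtoC 0) in Ez by ring. rewrite Ez in Z. auto.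
Qed.

(** Since [phi = z Q(phi)] with [Q(phi)] zero-free, [z = phi / Q(phi)] is a holomorphic function of
    [phi], and hence of [b]. *)
Lemma necessity :
  positive_kernel (fun z w => 1 - (k z disk0 * k disk0 w) / (k disk0 disk0 * k z w)) ->
  exists h : C -> C,
    holomorphic_on (image_of disk b) h /\
    (forall z, disk z -> h (b z) = z) /\
    exists q : C -> C,
      holomorphic_on disk q /\
      (forall z, image_of disk b z -> z <> b 0 -> q z = (z - b 0) / h z) /\
      (forall z, disk z -> (Cmod (q z) <= Cmod (1 - Cconj (b 0) * z))%R).
Proof.
  intros P. destruct (CNP_factor P) as (Q & BQ & Q1 & E). pose proof (factor_nonzero Q BQ E) as NQ.
  pose proof (b_strict 0 disk_origin) as h0. fold b0 in h0 |- *.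
  assert (HQ : forall y, disk y -> exists l, cdiff (fun y => peval Q (mobius b0 y)) y l).
  { intros y Hy. destruct (cdiff_mobius b0 y h0 Hy) as [m Hm]. destruct (cdiff_peval Q (mobius b0 y) BQ (disk_mobius b0 y h0 Hy)) as [l Hl].
    exists (m * l). apply (cdiff_comp (peval Q) (mobius b0)); auto. }
  exists (fun y => mobius b0 y / peval Q (mobius b0 y)). repeat split.
  - intros y [z [Hz <-]]. apply ex_derive_cdiff. pose proof (b_strict z Hz) as hz.
    destruct (cdiff_mobius b0 (b z) h0 hz) as [m Hm]. destruct (HQ (b z) hz) as [l Hl].
    apply (cdiff_div (mobius b0) (fun y => peval Q (mobius b0 y)) (b z) m l); auto. apply (NQ z Hz).
  - intros z Hz. fold (phi z). pose proof (NQ z Hz). rewrite (E z Hz) at 1. field; auto.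
  - exists (fun y => (1 - Cconj b0 * y) * peval Q (mobius b0 y)). repeat split.
    + intros y Hy. apply ex_derive_cdiff. destruct (HQ y Hy) as [l Hl]. eexists.
      apply (cdiff_mult (fun y => 1 - Cconj b0 * y)); [apply cdiff_shift_affine|exact Hl].
    + intros y [z [Hz <-]] Hb. pose proof (b_strict z Hz) as hz. pose proof (mobius_denom b0 (b z) h0 hz) as N1. pose proof (NQ z Hz) as N2.
      fold (phi z). unfold phi at 2. unfold mobius.
      assert (b z - b0 <> 0). { intros Z. apply Hb. replace (b z) with (b z - b0 + b0) by ring. rewrite Z; ring. }
      field. repeat split; auto.
    + intros y Hy. rewrite Cmod_mult. pose proof (Q1 _ (disk_mobius b0 y h0 Hy)). pose proof (Cmod_ge_0 (1 - Cconj b0 * y)). nra.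
Qed.

(** With [Q (y) = q (y) / (1 - conj b0 y)], the identity [h (b z) = z] turns the definition of [q] into
    [z q(b z) = b z - b0], and the kernel becomes [f(z) k_Q(b z, b w) conj f(w)] up to a positive
    constant, with [f = z (1 - conj b0 b)] and [k_Q] the kernel of H(Q), which is positive. *)
Lemma sufficiency h q :
  (forall z, disk z -> h (b z) = z) -> holomorphic_on disk q ->
  (forall z, image_of disk b z -> z <> b 0 -> q z = (z - b 0) / h z) ->
  (forall z, disk z -> (Cmod (q z) <= Cmod (1 - Cconj (b 0) * z))%R) ->
  positive_kernel (fun z w => 1 - (k z disk0 * k disk0 w) / (k disk0 disk0 * k z w)).
Proof.
  intros Hh Hq Eq Bq. pose proof (b_strict 0 disk_origin) as h0. fold b0 in h0, Eq, Bq.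
  assert (Fac : forall z, disk z -> z * q (b z) = b z - b0).
  { intros z Hz. destruct (excluded_middle_informative (b z = b0)) as [e|n].
    - assert (z = 0). { rewrite <- (Hh z Hz), e. apply (Hh 0 disk_origin). } subst. rewrite e. ring.
    - rewrite Eq by (auto; exists z; auto). rewrite Hh by auto.
      assert (z <> 0). { intros ->. apply n. reflexivity. } field; auto. }
  set (Q := fun y => q y / (1 - Cconj b0 * y)).
  assert (HQ : Hinf_unit_ball Q).
  { split.
    - intros y Hy. apply ex_derive_cdiff. destruct (holomorphic_cdiff disk q y Hq Hy) as [l Hl].
      apply (cdiff_div q (fun y => 1 - Cconj b0 * y) y l (- Cconj b0)); auto. apply cdiff_shift_affine. apply mobius_denom; auto.
    - intros y Hy. pose proof (mobius_denom b0 y h0 Hy) as N. unfold Q. rewrite Cmod_div by auto. pose proof (proj1 (Cmod_gt_0 _) N).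
      apply (Rmult_le_reg_r (Cmod (1 - Cconj b0 * y))); auto. unfold Rdiv. rewrite Rmult_assoc, Rinv_l by lra. specialize (Bq y Hy). lra. }
  set (r := (/ (1 - Cmod b0 ^ 2))%R).
  assert (r0 : (0 < 1 - Cmod b0 ^ 2)%R) by (unfold disk in h0; pose proof (Cmod_ge_0 b0); nra).
  set (bd := fun z : unit_disk => exist disk (b (proj1_sig z)) (b_strict _ (proj2_sig z)) : unit_disk).
  set (f := fun z : unit_disk => proj1_sig z * (1 - Cconj b0 * b (proj1_sig z))).
  apply (pos_ext (fun z w : unit_disk => RtoC r * (f z * dBR_kernel Q (proj1_sig (bd z)) (proj1_sig (bd w)) * Cconj (f w)))).
  - intros [z Hz] [w Hw]. unfold k, f, bd; simpl. pose proof (b_strict z Hz) as hz. pose proof (b_strict w Hw) as hw.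
    unfold dBR_kernel, Q, r. change (b 0) with b0. rewrite RtoC_inv, RtoC_minus, Cmod2_conj by lra.
    pose proof (mobius_denom b0 (b z) h0 hz). pose proof (denom_conj b0 (b w) h0 hw). pose proof (denom_conj b0 b0 h0 h0).
    pose proof (mobius_denom (b w) (b z) hw hz). pose proof (mobius_denom w z Hw Hz). pose proof (mobius_denom (b w) b0 hw h0).
    assert (F1 : q (b z) * z = b z - b0) by (rewrite <- Fac by auto; ring).
    assert (F2 : Cconj (q (b w)) * Cconj w = Cconj (b w) - Cconj b0) by (rewrite <- Cmult_conj, <- Cminus_conj, <- Fac by auto; f_equal; ring).
    rewrite Cdiv_conj by (apply mobius_denom; auto). rewrite !Cmult_conj, !Cminus_conj, !Cmult_conj, !Cconj_conj, !Cconj_1, !(Cconj_R 0).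
    transitivity ((z * Cconj w * (1 - Cconj b0 * b z) * (1 - b0 * Cconj (b w)) - (q (b z) * z) * (Cconj (q (b w)) * Cconj w)) / ((1 - b0 * Cconj b0) * (1 - Cconj (b w) * b z))).
    + field. repeat split; auto.
    + rewrite F1, F2. field. repeat split; auto. apply mobius_denom; auto.
  - apply (pos_scal (fun z w : unit_disk => f z * dBR_kernel Q (proj1_sig (bd z)) (proj1_sig (bd w)) * Cconj (f w))).
    { left. apply Rinv_0_lt_compat; auto. }
    apply (pos_conj_scal (fun z w : unit_disk => dBR_kernel Q (proj1_sig (bd z)) (proj1_sig (bd w))) f).
    apply (pos_comp (fun z w : unit_disk => dBR_kernel Q (proj1_sig z) (proj1_sig w)) bd). apply dBR_kernel_pos; auto.
Qed.
End Main.

Theorem theorem1p1 (b : C -> C)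
    (hb : Hinf_unit_ball b)
    (hnc : ~ exists c : C, forall z, disk z -> b z = c) :
  has_CNP_property (dBR_space b) <->
  exists h : C -> C,
    holomorphic_on (image_of disk b) h /\
    (forall z, disk z -> h (b z) = z) /\
    exists q : C -> C,
      holomorphic_on disk q /\
      (forall z, image_of disk b z -> z <> b 0 -> q z = (z - b 0) / h z) /\
      (forall z, disk z -> (Cmod (q z) <= Cmod (1 - Cconj (b 0) * z))%R).
Proof.
  rewrite (CNP_at_origin b hb hnc). split.
  - apply necessity; auto.
  - intros (h & _ & Hh & q & Hq & Eq & Bq). apply (sufficiency b hb hnc h q); auto.
Qed.
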